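(* Let $G\in\mathrm{Gl}_n(\mathbb{R})$, $D\in\mathbb{R}^{n\times n}$ with $D=D^\top$, $B\in\mathbb{R}^{n\times m}$ with $\operatorname{rank}B=m$, and $$\mathcal{A}=\begin{bmatrix}0&G^\top\\-G&-D\end{bmatrix},\qquad \mathcal{B}=\begin{bmatrix}0\\ B\end{bmatrix}=\mathcal{C}^\top ,$$ such that $[\mathcal{A},\mathcal{B},\mathcal{C}]$ is stabilizable. Let $M:=I_n$, $K:=GG^\top$, and assume that $D>0$ and that the overdamping condition $$(v^*Dv)^2>4(v^*Mv)(v^*Kv)\quad\text{for all } v\in\mathbb{C}^n\setminus\{0\}$$ holds. Let $[\widetilde{\mathcal{A}},\widetilde{\mathcal{B}},\widetilde{\mathcal{C}}]=[W^\top\mathcal{A}V,W^\top\mathcal{B},\mathcal{C}V]$ be the reduced system of order $2r$ constructed as described in the context with admissible truncation indices satisfying $r:=r^+=r^-$, and let $\widetilde{\mathbf{G}}(s)$ be its transfer function. Suppose that the eigenvalues of $\mathcal{A}$ and $\widetilde{\mathcal{A}}$ and the zeros of $[\mathcal{A},\mathcal{B},\mathcal{C}]$ and $[\widetilde{\mathcal{A}},\widetilde{\mathcal{B}},\widetilde{\mathcal{C}}]$ are all semi-simple. Then all eigenvalues of $\widetilde{\mathcal{A}}$ are real and fulfill $$\tilde\lambda_1^-\le\dots\le\tilde\lambda_r^-<\tilde\lambda_1^+\le\dots\le\tilde\lambda_r^+,$$ where $\tilde\lambda_i^-$ and $\tilde\lambda_i^+$ are the eigenvalues of $(\mathcal{S}_r,\widetilde{\mathcal{A}})$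 of negative and positive type, respectively. In particular, every second order realization $$\widetilde M\ddot{\tilde p}(t)+\widetilde D\dot{\tilde p}(t)+\widetilde K\tilde p(t)=\widetilde Bu(t),\qquad \tilde y(t)=\widetilde B^\top\dot{\tilde p}(t)$$ of $\widetilde{\mathbf{G}}(s)$ with symmetric $\widetilde M,\widetilde D,\widetilde K\in\mathbb{R}^{r\times r}$ fulfills $\widetilde M,\widetilde D,\widetilde K>0$ and $(v^*\widetilde Dv)^2>4(v^*\widetilde Mv)(v^*\widetilde Kv)$ for all $v\in\mathbb{C}^r\setminus\{0\}$. Moreover, $\widetilde{\mathbf{G}}(s)$ possesses such a second order realization.
   Context: $[\mathcal{A},\mathcal{B},\mathcal{C}]$ denotes the system $\dot x=\mathcal{A}x+\mathcal{B}u$, $y=\mathcal{C}x$, with transfer function $\mathcal{C}(sI-\mathcal{A})^{-1}\mathcal{B}$. A second order realization of $\widetilde{\mathbf G}(s)$ is one with $\widetilde{\mathbf G}(s)=s\widetilde B^\top(s^2\widetilde M+s\widetilde D+\widetilde K)^{-1}\widetilde B$, $\widetilde B\in\mathbb{R}^{r\times m}$. The KYP inequality is $$\mathcal{W}_{[\mathcal{A},\mathcal{B},\mathcal{C},0]}(P):=\begin{bmatrix}\mathcal{A}^\top P+P\mathcal{A}&P\mathcal{B}-\mathcal{C}^\top\\ \mathcal{B}^\top P-\mathcal{C}&0\end{bmatrix}\le0,$$ and its minimal solution $P_{\min}\ge0$ is the positive semidefinite solution with $P_{\min}\le P$ for all positive semidefinite solutions $P$. Construction of the reduced system. Put $\mathcal{S}_n=\operatorname{diag}(-I_n,I_n)$.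 Let $P_{\min}\ge0$ be the minimal solution of $\mathcal{W}_{[\mathcal{A},\mathcal{B},\mathcal{C},0]}(P)\le0$ (which exists under the present assumptions) and $P_{\min}=L^\top L$ with $L\in\mathbb{R}^{2n\times2n}$. Take an eigendecomposition $L\mathcal{S}_nL^\top=U\mathcal{S}_n\Sigma U^\top$ with $U=[U^-\ U^+]\in\mathbb{R}^{2n\times 2n}$ orthogonal, $\Sigma=\operatorname{diag}(\Sigma^-,\Sigma^+)$, $\Sigma^\pm\in\mathbb{R}^{n\times n}$, $$\Sigma^-=\operatorname{diag}(\sigma_1^-I_{n_1^-},\dots,\sigma^-_{h^-}I_{n^-_{h^-}}),\qquad \Sigma^+=\operatorname{diag}(\sigma^+_{h^+}I_{n^+_{h^+}},\dots,\sigma_1^+I_{n_1^+}),$$ $0\le\sigma^\pm_{h^\pm}<\dots<\sigma^\pm_1\le1$. Admissible truncation indices: $1\le q^\pm\le h^\pm$ with $\sigma^\pm_{q^\pm}>0$, $r^\pm=\sum_{j=1}^{q^\pm}n_j^\pm$, and $\sigma^-_{q^-+j^-}\ne\sigma^+_{i^+}$, $\sigma^+_{q^++j^+}\neq\sigma^-_{i^-}$ for all $i^\pm=1,\dots,q^\pm$, $j^\pm=1,\dots,h^\pm-q^\pm$. Let $U_1^-$ consist of the first $r^-$ columns of $U^-$, $U_1^+$ of the last $r^+$ columns of $U^+$, and let $\Sigma_1^-=\operatorname{diag}(\sigma_1^-I_{n_1^-},\dots,\sigma_{q^-}^-I_{n^-_{q^-}})$, $\Sigma_1^+=\operatorname{diag}(\sigma^+_{q^+}I_{n^+_{q^+}},\dots,\sigma_1^+I_{n_1^+})$,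 $\Sigma_1=\operatorname{diag}(\Sigma_1^-,\Sigma_1^+)$, $U_1=[U_1^-\ U_1^+]$. Set $W^\top:=\Sigma_1^{-1/2}\mathcal{S}_rU_1^\top L$ and $V:=\mathcal{S}_nL^\top U_1\Sigma_1^{-1/2}$ (where $r=r^+=r^-$). The matrix $\widetilde{\mathcal A}$ is then $\mathcal{S}_r$-self-adjoint, i.e. $\widetilde{\mathcal A}^\top\mathcal{S}_r=\mathcal{S}_r\widetilde{\mathcal A}$. Sign characteristics. Let $S\in\mathrm{Gl}_N(\mathbb{R})$ be symmetric and $A\in\mathbb{R}^{N\times N}$ be $S$-self-adjoint ($A^\top S=SA$) and diagonalizable over $\mathbb{C}$. There is $T\in\mathrm{Gl}_N(\mathbb{R})$ with $T^\top ST=\operatorname{diag}(\varepsilon_1,\dots,\varepsilon_k,\begin{bmatrix}0&1\\1&0\end{bmatrix},\dots,\begin{bmatrix}0&1\\1&0\end{bmatrix})$ and $T^{-1}AT=\operatorname{diag}(\lambda_1,\dots,\lambda_k,\begin{bmatrix}\sigma_1&\tau_1\\-\tau_1&\sigma_1\end{bmatrix},\dots,\begin{bmatrix}\sigma_c&\tau_c\\-\tau_c&\sigma_c\end{bmatrix})$, $\varepsilon_i=\pm1$, $\lambda_i,\sigma_i\in\mathbb{R}$, $\tau_i>0$; the pairs $(\varepsilon_i,\lambda_i)$ are uniquely determined up to order, and a real eigenvalue $\lambda$ is of positive (negative) type if $(1,\lambda)$ (resp. $(-1,\lambda)$) occurs among them (a value may occur repeatedly). Zeros. $\mu\in\mathbb{C}$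 is a zero of $[\mathcal{A},\mathcal{B},\mathcal{C}]$ if the complex rank of $\begin{bmatrix}-\mu I+\mathcal{A}&\mathcal{B}\\\mathcal{C}&0\end{bmatrix}$ is smaller than the rank over $\mathbb{R}(s)$ of $\begin{bmatrix}-sI+\mathcal{A}&\mathcal{B}\\\mathcal{C}&0\end{bmatrix}$; for a square invertible transfer function it is semi-simple if its order as a zero of the determinant of the pencil equals the dimension of the kernel of the pencil at $s=\mu$.
   Formalization: The printed ordering is reversed for these sign conventions (G=2, D=5, B=1 gives -1 of negative and -4 of positive type); what is proved is that all r eigenvalues of positive type lie strictly below all r eigenvalues of negative type. *)

(* Defs.v *)
From mathcomp Require Import all_boot all_order all_algebra.
From mathcomp Require Import reals.
From mathcomp Require Import complex.

Set Implicit Arguments.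
Unset Strict Implicit.
Unset Printing Implicit Defensive.

Import Order.TTheory GRing.Theory Num.Theory.

Local Open Scope ring_scope.
Local Open Scope complex_scope.
Local Open Scope sesquilinear_scope.

(* The embeddings of R in C = R[i] and in R(s) = {fraction {poly R}}.         *)
Definition cmx (R : realType) (p q : nat) (A : 'M[R]_(p, q)) : 'M[R[i]]_(p, q) :=
  map_mx (real_complex R) A.

Definition fmx (R : realType) (p q : nat) (A : 'M[{poly R}]_(p, q)) :
    'M[{fraction {poly R}}]_(p, q) :=
  map_mx (@tofrac {poly R}) A.

Definition pmx (R : realType) (p q : nat) (A : 'M[R]_(p, q)) : 'M[{poly R}]_(p, q) :=
  map_mx polyC A.

(* Definiteness of real matrices includes symmetry.                           *)
Definition psdmx (R : realType) (n : nat) (P : 'M[R]_n) : Prop :=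
  P^T = P /\ forall x : 'cV[R]_n, 0 <= (x^T *m P *m x) 0 0.

Definition pdmx (R : realType) (n : nat) (P : 'M[R]_n) : Prop :=
  P^T = P /\ forall x : 'cV[R]_n, x != 0 -> 0 < (x^T *m P *m x) 0 0.

(* The strict order of R[i] compares real parts of numbers with equal         *)
(* imaginary parts; for symmetric M, D, K both sides below are real.          *)
Definition cqform (R : realType) (n : nat) (X : 'M[R]_n) (v : 'cV[R[i]]_n) : R[i] :=
  (v ^t* *m cmx X *m v) 0 0.

Definition overdamped (R : realType) (n : nat) (M D K : 'M[R]_n) : Prop :=
  forall v : 'cV[R[i]]_n, v != 0 ->
    4%:R * (cqform M v) * (cqform K v) < (cqform D v) ^+ 2.

Section LinearSystems.
Variable R : realType.

Definition stabilizable (N m : nat) (A : 'M[R]_N) (B : 'M[R]_(N, m)) : Prop :=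
  exists F : 'M[R]_(m, N),
    forall z : R[i], eigenvalue (cmx (A + B *m F)) z -> complex.Re z < 0.

Definition transfer (N m p : nat) (A : 'M[R]_N) (B : 'M[R]_(N, m))
    (C : 'M[R]_(p, N)) : 'M[{fraction {poly R}}]_(p, m) :=
  fmx (pmx C) *m invmx (fmx ('X%:M - pmx A)) *m fmx (pmx B).

(* invmx is the identity on singular matrices, whence the first conjunct.     *)
Definition second_order_realization (r m : nat)
    (H : 'M[{fraction {poly R}}]_m) (M D K : 'M[R]_r) (B : 'M[R]_(r, m)) : Prop :=
  let Q := fmx ('X^2 *: pmx M + 'X *: pmx D + pmx K) in
  Q \in unitmx /\
  H = tofrac 'X *: (fmx (pmx B^T) *m invmx Q *m fmx (pmx B)).

Definition KYPmx (N m : nat) (A : 'M[R]_N) (B : 'M[R]_(N, m)) (C : 'M[R]_(m, N))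
    (P : 'M[R]_N) : 'M[R]_(N + m) :=
  block_mx (A^T *m P + P *m A) (P *m B - C^T) (B^T *m P - C) 0.

Definition KYP_psd_solution (N m : nat) (A : 'M[R]_N) (B : 'M[R]_(N, m))
    (C : 'M[R]_(m, N)) (P : 'M[R]_N) : Prop :=
  psdmx P /\ psdmx (- KYPmx A B C P).

Definition KYP_minimal_solution (N m : nat) (A : 'M[R]_N) (B : 'M[R]_(N, m))
    (C : 'M[R]_(m, N)) (P : 'M[R]_N) : Prop :=
  KYP_psd_solution A B C P /\
  forall Q : 'M[R]_N, KYP_psd_solution A B C Q -> psdmx (Q - P).

Definition semisimple_eigenvalue (N : nat) (A : 'M[R]_N) (z : R[i]) : Prop :=
  mup z (char_poly (cmx A)) = \rank (eigenspace (cmx A) z).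

Definition pencil (N m p : nat) (A : 'M[R]_N) (B : 'M[R]_(N, m))
    (C : 'M[R]_(p, N)) : 'M[{poly R}]_(N + p, N + m) :=
  block_mx (- 'X%:M + pmx A) (pmx B) (pmx C) 0.

Definition pencil_at (N m p : nat) (A : 'M[R]_N) (B : 'M[R]_(N, m))
    (C : 'M[R]_(p, N)) (z : R[i]) : 'M[R[i]]_(N + p, N + m) :=
  block_mx (- z%:M + cmx A) (cmx B) (cmx C) 0.

Definition system_zero (N m p : nat) (A : 'M[R]_N) (B : 'M[R]_(N, m))
    (C : 'M[R]_(p, N)) (z : R[i]) : Prop :=
  (\rank (pencil_at A B C z) < \rank (fmx (pencil A B C)))%N.

(* kermx is a left kernel, hence the transpose.                               *)
Definition semisimple_zero (N m : nat) (A : 'M[R]_N) (B : 'M[R]_(N, m))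
    (C : 'M[R]_(m, N)) (z : R[i]) : Prop :=
  mup z (map_poly (real_complex R) (\det (pencil A B C)))
  = \rank (kermx (pencil_at A B C z)^T).

End LinearSystems.

(* Sign characteristic of (S, A).  The list p holds the pairs (eps_i, lam_i). *)
(* The rectangular type of T avoids a cast along N = k + 2 c, an equality     *)
(* which the two inverse conditions enforce.                                  *)
Section SignCharacteristic.
Variable R : realType.

Definition mx2 (a b c d : R) : 'M[R]_2 :=
  \matrix_(i < 2, j < 2)
    if i == 0 then (if j == 0 then a else b) else (if j == 0 then c else d).

Definition row_of_seq (n : nat) (s : seq R) : 'rV[R]_n := \row_(i < n) s`_i.

Definition diag_seq (k : nat) (s : seq R) : 'M[R]_k := diag_mx (row_of_seq k s).

Definition canonical_pairs (N : nat) (S A : 'M[R]_N) (p : seq (R * R)) : Prop :=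
  all (fun el => (el.1 == 1) || (el.1 == -1)) p /\
  exists (c : nat) (sigma tau : 'I_c -> R),
  exists (T : 'M[R]_(N, size p + \sum_(j < c) 2))
         (Tinv : 'M[R]_(size p + \sum_(j < c) 2, N)),
  [/\ forall j, 0 < tau j,
      T *m Tinv = 1%:M /\ Tinv *m T = 1%:M,
      T^T *m S *m T =
        block_mx (diag_seq (size p) (map fst p)) 0
                 0 (\mxdiag_(j < c) mx2 0 1 1 0)
    & Tinv *m A *m T =
        block_mx (diag_seq (size p) (map snd p)) 0
                 0 (\mxdiag_(j < c) mx2 (sigma j) (tau j) (- tau j) (sigma j))].

Definition sign_characteristic (N : nat) (S A : 'M[R]_N) (p : seq (R * R)) : Prop :=
  canonical_pairs S A p /\
  forall p', canonical_pairs S A p' -> perm_eq p' p.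

(* lm and lp list, with repetitions, the eigenvalues of negative and of       *)
(* positive type.  Pitfall: for A = [0 G^T; -G -D] and S = diag (-I, I), an   *)
(* eigenvector (G^T v / x, v) to the eigenvalue x has S-square                *)
(* v^T (2 x I + D) v / x.  Overdamping makes the numerator positive at the n  *)
(* larger eigenvalues, and x < 0: the larger eigenvalues have negative type.  *)
(* For instance G = 2, D = 5 gives x = -1 with eigenvector (2, -1), of        *)
(* negative type, and x = -4 with eigenvector (1, -2), of positive type.      *)
Definition typed_eigenvalues (N : nat) (S A : 'M[R]_N) (lm lp : seq R) : Prop :=
  sign_characteristic S A
    ([seq (-1, x) | x <- lm] ++ [seq (1, x) | x <- lp]).

End SignCharacteristic.

Section Reduction.
Variable R : realType.

Definition Smx (n : nat) : 'M[R]_(n + n) := block_mx (- 1%:M) 0 0 1%:M.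

Definition Asys (n : nat) (G D : 'M[R]_n) : 'M[R]_(n + n) :=
  block_mx 0 G^T (- G) (- D).

Definition Bsys (n m : nat) (B : 'M[R]_(n, m)) : 'M[R]_(n + n, m) := col_mx 0 B.

(* The list sigma_1, ..., sigma_1, ..., sigma_h, ..., sigma_h, with sigma_j   *)
(* repeated k_j times (indices start at 1).                                   *)
Definition expand (sigma : nat -> R) (k : nat -> nat) (h : nat) : seq R :=
  flatten [seq nseq (k j) (sigma j) | j <- iota 1 h].

(* n counts the entries of expand sigma k h.                                  *)
Definition graded (n : nat) (sigma : nat -> R) (k : nat -> nat) (h : nat) : Prop :=
  [/\ (\sum_(1 <= j < h.+1) k j = n)%N,
      forall j : nat, (1 <= j <= h)%N -> (0 < k j)%N,
      forall i j : nat, (1 <= i)%N -> (i < j <= h)%N -> sigma j < sigma i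
    & forall j : nat, (1 <= j <= h)%N -> 0 <= sigma j <= 1].

(* The diagonal of diag (Sigma^-, Sigma^+) for block counts hm, hp, and of    *)
(* Sigma_1 for the truncated counts qm, qp; the + values come in reverse.     *)
Definition sigma_row (n : nat) (sm sp : nat -> R) (km kp : nat -> nat)
    (hm hp : nat) : 'rV[R]_(n + n) :=
  row_mx (row_of_seq n (expand sm km hm)) (row_of_seq n (rev (expand sp kp hp))).

Definition admissible (sm sp : nat -> R) (hm hp qm qp : nat) : Prop :=
  [/\ (1 <= qm <= hm)%N /\ (1 <= qp <= hp)%N,
      0 < sm qm /\ 0 < sp qp,
      forall i j : nat, (1 <= i <= qp)%N -> (1 <= j <= hm - qm)%N ->
        sm (qm + j)%N != sp i
    & forall i j : nat, (1 <= i <= qm)%N -> (1 <= j <= hp - qp)%N ->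
        sp (qp + j)%N != sm i].

(* The j-th column of the result is column f j of X (null if f j >= n).       *)
Definition pick_cols (N n r : nat) (f : nat -> nat) (X : 'M[R]_(N, n)) : 'M[R]_(N, r) :=
  \matrix_(i < N, j < r) oapp (X i) 0 (insub (f j) : option 'I_n).

Definition first_cols (N n r : nat) (X : 'M[R]_(N, n)) : 'M[R]_(N, r) :=
  pick_cols r id X.

Definition last_cols (N n r : nat) (X : 'M[R]_(N, n)) : 'M[R]_(N, r) :=
  pick_cols r (fun j => n - r + j)%N X.

Definition trunc_basis (n r : nat) (U : 'M[R]_(n + n)) : 'M[R]_(n + n, r + r) :=
  row_mx (first_cols r (lsubmx U)) (last_cols r (rsubmx U)).

Definition invsqrt_diag (N : nat) (d : 'rV[R]_N) : 'M[R]_N :=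
  diag_mx (map_mx (fun x => (Num.sqrt x)^-1) d).

Definition projW (n r : nat) (L U : 'M[R]_(n + n)) (d : 'rV[R]_(r + r)) :
    'M[R]_(n + n, r + r) :=
  (invsqrt_diag d *m Smx r *m (trunc_basis r U)^T *m L)^T.

Definition projV (n r : nat) (L U : 'M[R]_(n + n)) (d : 'rV[R]_(r + r)) :
    'M[R]_(n + n, r + r) :=
  Smx n *m L^T *m trunc_basis r U *m invsqrt_diag d.

End Reduction.

(* Main.v *)
Require Import Defs.
From mathcomp Require Import all_boot all_order all_algebra perm.
From mathcomp Require Import reals.
From mathcomp Require Import complex polyrcf.
From mathcomp Require Import boolp classical_sets topology normedtype derive.
From mathcomp Require Import ring lra.

(** Why the theorem holds.  Write S for the signature matrix diag (-1, 1) of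
    any size.  The given system satisfies (S A)^T = S A and S Bc = Bc = C^T.
    The balancing relation L S L^T = U S Sigma U^T makes the reduction an
    isometric compression: V^T S V = S and W^T = S V^T S.  Hence
    S At = V^T (S A) V is symmetric again and Ct = Bt^T S.

    Spectrum.  Overdamping provides one real number g < 0 which separates, for
    all v at once, the two roots of x^2 v^T v + x v^T D v + v^T K v
    (hyperbolic_gap); equivalently, S A - g S is negative definite, and this
    survives the compression.  A definite pencil S At - g S can be
    diagonalized together with S, so all eigenvalues are real; an eigenvector
    x to l satisfies (l - g) x^T S x < 0, so that the type of l tells on which
    side of g it lies, and the signature (r, r) of S leaves r eigenvalues on
    each side (hyperbolic_canonical, hyperbolic_typed).

    What survives the reduction.  P := Pmin satisfies P V = S V S Sigma_1, so
    Sigma_1 solves the KYP inequality of the reduced system.  A vector w with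
    S P w = mu w is reproduced by the reduction, V W^T w = w, as soon as mu is
    nonzero and is not one of the discarded signed values (proj_keep).  This
    applies to the columns of Bc (mu = 1) and of A^-1 Bc (mu = -1).  So there
    is z with At z = Bt and Ct z = 0 (red_static).

    Existence of a realization.  The position vectors of a second order system
    form an r-dimensional subspace on which S At vanishes and which lies in the
    kernel of Ct.  Such a subspace is found as the graph of a suitable isometry
    between the two spectral subspaces, chosen so as to contain the columns of
    z; then its S-orthogonality to Bt = At z is automatic
    (neutral_complement, second_order_exists).

    All realizations.  Everything depends on the minimality of the reduced
    system (red_observable), for otherwise a realization could contain an
    arbitrary unobservable part.  Since P is the minimal solution of the KYP
    inequality, the residual Th = -(A^T P + P A) has rank m, which is the
    Riccati equation (minimal_fixpoint, Riccati); moreover P <= I, because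
    the physical energy I is a solution.  If At x = l x and Ct x = 0 with
    l < 0, then the closed loop matrix of the reduced Riccati equation has the
    eigenvalue -l > 0; comparison with the dual solution Sigma_1^-1 >= Sigma_1
    confines the eigenvector to the directions with sigma = 1, where P <= I and
    D > 0 leave no room for it (closed_loop_inj).  For l = 0 the kernel of At
    is stable under S Sigma_1, and the admissibility of the truncation lifts a
    vector of the kernel of At to a vector of the kernel of A (red_inj).
    A second order realization is a pencil of order 2r with the same
    transfer function as the minimal [At, Bt, Ct].  Divided differences of the
    transfer function show that the two pencils are strictly equivalent
    (loewner_equivalence), and uniqueness of the equivalence makes it a
    congruence between (diag (-K, M), [0, -K; -K, -D]) and (S, S At)
    (pencil_congruence).  The definiteness of S At - g S then reads as K > 0,
    M > 0, D > 0 and g^2 M + g D + K < 0, which is overdamping. *)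

Set Implicit Arguments.
Unset Strict Implicit.
Unset Printing Implicit Defensive.

Import Order.TTheory GRing.Theory Num.Theory.
Import numFieldNormedType.Exports.
Local Open Scope ring_scope.

(** * Linear equations and bilinear forms *)

Section Injectivity.
Variable F : fieldType.

Lemma mx_inj_unit p (P : 'M[F]_p) :
  (forall x : 'cV_p, P *m x = 0 -> x = 0) -> P \in unitmx.
Proof.
move=> hP; rewrite -unitmx_tr -row_free_unit -kermx_eq0; apply/eqP/row_matrixP => i.
rewrite row0; set u := row i _.
have u0 : u *m P^T = 0 by apply: (sub_kermxP (row_sub _ _)).
have /hP : P *m u^T = 0 by apply: trmx_inj; rewrite trmx_mul trmxK u0 trmx0.
by move/(congr1 trmx); rewrite trmxK trmx0.
Qed.

Lemma mx_inj_col p q (P : 'M[F]_(p, q)) : (q <= \rank P)%N ->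
  forall x : 'cV_q, P *m x = 0 -> x = 0.
Proof.
move=> h x h0; have f : row_free P^T.
  by rewrite /row_free mxrank_tr eqn_leq h andbT rank_leq_col.
apply: trmx_inj; apply: (row_free_inj f).
by rewrite trmx0 mul0mx -trmx_mul h0 trmx0.
Qed.

Lemma mx_ker_ex p q (P : 'M[F]_(p, q)) : (p < q)%N ->
  exists2 x : 'cV_q, x != 0 & P *m x = 0.
Proof.
move=> pq; have : kermx P^T != 0.
  rewrite kermx_eq0 /row_free mxrank_tr neq_ltn.
  by rewrite (leq_ltn_trans (rank_leq_row P) pq).
move=> /rowV0Pn [u /sub_kermxP uk u0]; exists u^T.
  by apply: contra u0 => /eqP/(congr1 trmx); rewrite trmxK trmx0 => ->.
by apply: trmx_inj; rewrite trmx_mul trmxK uk trmx0.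
Qed.

End Injectivity.

(** Reading the 1 x 1 matrix as a number turns identities between quadratic
    forms into identities and inequalities in R. *)

Definition bf (R : realType) (p q : nat) (P : 'M[R]_(p, q)) (x : 'cV[R]_p) (y : 'cV[R]_q) : R :=
  (x^T *m P *m y) 0 0.

Section BilinearForms.
Variable R : realType.

Lemma bfDl p q (P : 'M[R]_(p, q)) x x' y : bf P (x + x') y = bf P x y + bf P x' y.
Proof. by rewrite /bf linearD /= !mulmxDl mxE. Qed.

Lemma bfDr p q (P : 'M[R]_(p, q)) x y y' : bf P x (y + y') = bf P x y + bf P x y'.
Proof. by rewrite /bf mulmxDr mxE. Qed.

Lemma bfNl p q (P : 'M[R]_(p, q)) x y : bf P (- x) y = - bf P x y.
Proof. by rewrite /bf linearN /= !mulNmx mxE. Qed.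

Lemma bfNr p q (P : 'M[R]_(p, q)) x y : bf P x (- y) = - bf P x y.
Proof. by rewrite /bf mulmxN mxE. Qed.

Lemma bfZl p q (P : 'M[R]_(p, q)) a x y : bf P (a *: x) y = a * bf P x y.
Proof. by rewrite /bf linearZ /= -!scalemxAl mxE. Qed.

Lemma bfZr p q (P : 'M[R]_(p, q)) a x y : bf P x (a *: y) = a * bf P x y.
Proof. by rewrite /bf -scalemxAr mxE. Qed.

Lemma bf0l p q (P : 'M[R]_(p, q)) y : bf P 0 y = 0.
Proof. by rewrite /bf trmx0 !mul0mx mxE. Qed.

Lemma bf0r p q (P : 'M[R]_(p, q)) x : bf P x 0 = 0.
Proof. by rewrite /bf mulmx0 mxE. Qed.

Lemma bfD p q (P Q : 'M[R]_(p, q)) x y : bf (P + Q) x y = bf P x y + bf Q x y.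
Proof. by rewrite /bf mulmxDr mulmxDl mxE. Qed.

Lemma bfN p q (P : 'M[R]_(p, q)) x y : bf (- P) x y = - bf P x y.
Proof. by rewrite /bf mulmxN mulNmx mxE. Qed.

Lemma bfZ p q (P : 'M[R]_(p, q)) a x y : bf (a *: P) x y = a * bf P x y.
Proof. by rewrite /bf -scalemxAr -scalemxAl mxE. Qed.

Lemma bf0 p q x y : bf (0 : 'M[R]_(p, q)) x y = 0.
Proof. by rewrite /bf mulmx0 mul0mx mxE. Qed.

Definition bfE := (bfDl, bfDr, bfNl, bfNr, bfZl, bfZr, bfD, bfN, bfZ).

Definition bfvE := (bfDl, bfDr, bfNl, bfNr, bfZl, bfZr).

Lemma bf_tr p q (P : 'M[R]_(p, q)) x y : bf P^T x y = bf P y x.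
Proof.
have -> : bf P y x = (y^T *m P *m x)^T 0 0 by rewrite mxE.
by rewrite /bf !trmx_mul trmxK mulmxA.
Qed.

Lemma bf_sym p (P : 'M[R]_p) x y : P^T = P -> bf P x y = bf P y x.
Proof. by move=> {1}<-; rewrite bf_tr. Qed.

Lemma bf_mulr p q s (P : 'M[R]_(p, q)) (M : 'M[R]_(q, s)) x y :
  bf P x (M *m y) = bf (P *m M) x y.
Proof. by rewrite /bf !mulmxA. Qed.

Lemma bf_mull p q s (P : 'M[R]_(p, q)) (M : 'M[R]_(p, s)) x y :
  bf P (M *m x) y = bf (M^T *m P) x y.
Proof. by rewrite /bf trmx_mul !mulmxA. Qed.

Lemma bf_congr p q s t (P : 'M[R]_(p, q)) (X : 'M[R]_(p, s)) (Y : 'M[R]_(q, t)) x y :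
  bf (X^T *m P *m Y) x y = bf P (X *m x) (Y *m y).
Proof. by rewrite bf_mull bf_mulr. Qed.

Lemma bf1E p (x y : 'cV[R]_p) : bf 1%:M x y = \sum_i x i 0 * y i 0.
Proof. by rewrite /bf mulmx1 mxE; apply: eq_bigr => i _; rewrite mxE. Qed.

Lemma bf_diagE p (d : 'rV[R]_p) (x y : 'cV[R]_p) :
  bf (diag_mx d) x y = \sum_i d 0 i * (x i 0 * y i 0).
Proof.
rewrite /bf -mulmxA mxE; apply: eq_bigr => i _.
by rewrite mul_diag_mx !mxE mulrCA.
Qed.

Lemma bf1_ge0 p (x : 'cV[R]_p) : 0 <= bf 1%:M x x.
Proof. by rewrite bf1E sumr_ge0 // => i _; rewrite -expr2 sqr_ge0. Qed.

Lemma bf1_eq0 p (x : 'cV[R]_p) : (bf 1%:M x x == 0) = (x == 0).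
Proof.
apply/idP/eqP => [|->]; last by rewrite bf0r.
rewrite bf1E psumr_eq0 => [|i _]; last by rewrite -expr2 sqr_ge0.
move=> /allP h; apply/colP => i; apply/eqP; rewrite !mxE.
by have := h i (mem_index_enum _); rewrite /= -expr2 sqrf_eq0.
Qed.

Lemma bf1_gt0 p (x : 'cV[R]_p) : x != 0 -> 0 < bf 1%:M x x.
Proof. by move=> x0; rewrite lt_def bf1_ge0 bf1_eq0 x0. Qed.

Lemma bf_block p q s t (P : 'M[R]_(p, s)) (Q : 'M[R]_(p, t)) (M : 'M[R]_(q, s)) (N : 'M[R]_(q, t))
   a b c d :
  bf (block_mx P Q M N) (col_mx a b) (col_mx c d) =
  bf P a c + bf Q a d + bf M b c + bf N b d.
Proof.
rewrite /bf tr_col_mx mul_row_block mul_row_col !mulmxDl !mxE.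
by ring.
Qed.

Lemma bf_inj p q (P Q : 'M[R]_(p, q)) : (forall x y, bf P x y = bf Q x y) -> P = Q.
Proof.
move=> h; apply/matrixP => i j; have := h (delta_mx i 0) (delta_mx j 0).
by rewrite /bf !trmx_delta -!rowE -!colE !mxE.
Qed.

Lemma pdmx_ge0 p (P : 'M[R]_p) x : pdmx P -> 0 <= bf P x x.
Proof.
case=> _ h; have [->|x0] := eqVneq x 0; first by rewrite bf0l.
exact/ltW/h.
Qed.

Lemma tr_congr p q s (P : 'M[R]_p) (X : 'M[R]_(p, q)) (Y : 'M[R]_(p, s)) :
  P^T = P -> (X^T *m P *m Y)^T = Y^T *m P *m X.
Proof. by move=> sP; rewrite !trmx_mul trmxK sP mulmxA. Qed.

Lemma sym_congr p q (P : 'M[R]_p) (X : 'M[R]_(p, q)) : P^T = P -> (X^T *m P *m X)^T = X^T *m P *m X.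
Proof. by move=> sP; rewrite !trmx_mul trmxK sP mulmxA. Qed.

(** A nonnegative form that vanishes at x has its minimum there, so its gradient
    P x is zero; a trial step in the direction P x makes this quantitative. *)
Lemma psd_ker p (P : 'M[R]_p) x : psdmx P -> bf P x x = 0 -> P *m x = 0.
Proof.
move=> [sP hP] x0; apply/eqP; rewrite -bf1_eq0; apply/eqP.
set y := P *m x.
have hxy : bf P x y = bf 1%:M y y by rewrite bf_mull mulmx1 bf_mulr sP bf_mulr.
have hyx : bf P y x = bf 1%:M y y by rewrite bf_sym.
have k0 := bf1_ge0 y.
have [//|kn] := eqVneq (bf 1%:M y y) 0.
have kp : 0 < bf 1%:M y y by rewrite lt_def kn.
have c0 : 0 <= bf P y y := hP y.
set k := bf 1%:M y y in hxy hyx k0 kn kp *; set c := bf P y y in c0.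
have := hP (- ((c + 1)) *: x + y) ; rewrite -/(bf _ _ _) !bfE x0 hxy hyx -/c => h.
have := hP (x + (- (k / (c + 1))) *: y); rewrite -/(bf _ _ _) !bfE x0 hxy hyx -/c => h2.
have c1 : 0 < c + 1 by lra.
have e : k / (c + 1) * (c + 1) = k by rewrite divfK // gt_eqF.
have u0 : 0 < k / (c + 1) by rewrite divr_gt0.
set u := k / (c + 1) in e u0 h2; nra.
Qed.

Lemma psd_ker_mx p q (P : 'M[R]_p) (X : 'M[R]_(p, q)) :
  psdmx P -> X^T *m P *m X = 0 -> P *m X = 0.
Proof.
move=> hP h; apply/matrixP => i j; rewrite [RHS]mxE.
have -> : (P *m X) i j = (P *m (X *m (delta_mx j 0 : 'cV_q))) i 0 by rewrite mulmxA -colE [RHS]mxE.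
by rewrite psd_ker ?mxE // bf_mull bf_mulr h bf0.
Qed.

Lemma pd_unit p (P : 'M[R]_p) : pdmx P -> P \in unitmx.
Proof.
move=> [sP hP]; rewrite -row_free_unit -kermx_eq0; apply/eqP/row_matrixP => i.
rewrite row0; set u := row i _.
have u0 : u *m P = 0 by apply: (sub_kermxP (row_sub _ _)).
have [//|un] := eqVneq u 0.
have : u^T != 0 by apply: contra un => /eqP/(congr1 trmx); rewrite trmxK trmx0 => ->.
by move/hP; rewrite trmxK u0 mul0mx mxE ltxx.
Qed.

End BilinearForms.

(** * Minimum of a function on the sphere *)

Section Sphere.
Variable R : realType.

Lemma sum_continuous (T : topologicalType) (I : Type) (r : seq I) (f : I -> T -> R) :
  (forall i, continuous (f i)) -> continuous (fun x => \sum_(i <- r) f i x).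
Proof.
move=> cf; elim: r => [|i r IH] x.
  by under eq_fun do rewrite big_nil; exact: cvg_cst.
under eq_fun do rewrite big_cons.
by apply: cvgD; [exact: cf|exact: IH].
Qed.

Lemma mul_continuous (T : topologicalType) (f g : T -> R) :
  continuous f -> continuous g -> continuous (fun x => f x * g x).
Proof. by move=> cf cg x; apply: cvgM; [exact: cf|exact: cg]. Qed.

Lemma add_continuous (T : topologicalType) (f g : T -> R) :
  continuous f -> continuous g -> continuous (fun x => f x + g x).
Proof. by move=> cf cg x; apply: cvgD; [exact: cf|exact: cg]. Qed.

Lemma bf_continuous n (P : 'M[R]_n) :
  continuous (fun v : 'rV[R]_n => bf P v^T v^T).
Proof.
have -> : (fun v : 'rV[R]_n => bf P v^T v^T) =
    (fun v => \sum_j (\sum_k v 0 k * P k j) * v 0 j).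
  apply/funext => v; rewrite /bf trmxK mxE; apply: eq_bigr => j _.
  by rewrite !mxE.
have cs j : continuous (fun v : 'rV[R]_n => \sum_k v 0 k * P k j).
  apply: (@sum_continuous _ _ _ (fun k (v : 'rV[R]_n) => v 0 k * P k j)) => k.
  by apply: mul_continuous => [v|v]; [exact: coord_continuous|exact: cst_continuous].
apply: (@sum_continuous _ _ _ (fun j (v : 'rV[R]_n) => (\sum_k v 0 k * P k j) * v 0 j)).
by move=> j; apply: mul_continuous => [|v]; [exact: cs|exact: coord_continuous].
Qed.

(** The sphere is closed inside the compact cube [-1, 1]^n. *)
Lemma sphere_min n (f : 'rV[R]_n.+1 -> R) : continuous f ->
  exists2 c : 'rV_n.+1, bf 1%:M c^T c^T = 1 &
    forall v : 'rV_n.+1, bf 1%:M v^T v^T = 1 -> f c <= f v.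
Proof.
move=> cf.
pose A : set 'rV[R]_n.+1 := [set v | bf 1%:M v^T v^T = 1]%classic.
have cA : compact A.
  apply: (@subclosed_compact _ _ [set v : 'rV[R]_n.+1 | forall i, `[(-1 : R), 1]%classic (v ord0 i)]%classic).
  - rewrite (_ : A = (fun v : 'rV[R]_n.+1 => bf 1%:M v^T v^T) @^-1` [set 1 : R])%classic //.
    apply: preimage_closed => //; first by move=> v _; exact: bf_continuous.
  - by apply: (@rV_compact _ _ (fun=> `[(-1 : R), 1]%classic)) => _; exact: segment_compact.
  - move=> v; rewrite /A /= => v1 i.
    have : v ord0 i ^+ 2 <= 1.
      rewrite -v1 bf1E (bigD1 i) //= !mxE -expr2 lerDl.
      by rewrite sumr_ge0 // => j _; rewrite -expr2 sqr_ge0.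
    by rewrite in_itv /= => h; apply/andP; split; nra.
have A0 : (A !=set0)%classic.
  exists (delta_mx 0 0); rewrite /A /= bf1E (bigD1 0) //= big1 ?addr0 ?mxE ?eqxx ?mulr1 //.
  by move=> j /negbTE j0; rewrite !mxE j0 mulr0.
have [c /set_mem cA' hc] := EVT_min_rV A0 cA (continuous_subspaceT cf).
by exists c => // v v1; apply: hc; rewrite inE.
Qed.

Lemma bf1_normalize n (v : 'cV[R]_n) : v != 0 ->
  exists c : R, [/\ 0 < c & bf 1%:M (c *: v) (c *: v) = 1].
Proof.
move=> v0; have m0 := bf1_gt0 v0; exists (Num.sqrt (bf 1%:M v v))^-1.
split; first by rewrite invr_gt0 sqrtr_gt0.
by rewrite bfZl bfZr mulrA -expr2 exprVn sqr_sqrtr ?ltW // mulVf // gt_eqF.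
Qed.

End Sphere.

(** * Reflections and the spectral theorem *)

Section Orthogonal.
Variable R : realType.

Lemma sphere_min_col n (A : 'M[R]_n.+1) :
  exists2 c : 'cV_n.+1, bf 1%:M c c = 1 &
    forall v, bf A c c * bf 1%:M v v <= bf A v v.
Proof.
have [c c1 hc] := sphere_min (@bf_continuous R n.+1 A).
exists c^T => // v; have [->|v0] := eqVneq v 0; first by rewrite !bf0l mulr0.
have [k [k0 k1]] := bf1_normalize v0.
have := hc (k *: v)^T; rewrite trmxK => /(_ k1).
have k2 : 0 < k * k by rewrite mulr_gt0.
rewrite !bfE in k1 *; move=> h.
rewrite -(ler_pM2l k2) mulrCA -[k * k * _]mulrA k1 mulr1 (le_trans h) //.
by rewrite mulrA.
Qed.

(** The minimum l of the Rayleigh quotient makes A - l semidefinite, and the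
    minimizer is a zero of that form, hence a kernel vector. *)
Lemma sym_eigenvector n (A : 'M[R]_n.+1) : A^T = A ->
  exists (c : 'cV_n.+1) l, bf 1%:M c c = 1 /\ A *m c = l *: c.
Proof.
move=> sA; have [c c1 hc] := sphere_min_col A; exists c, (bf A c c); split=> //.
have hp : psdmx (A - (bf A c c) *: 1%:M).
  split; first by rewrite linearB linearZ /= sA trmx1.
  by move=> v; rewrite -/(bf _ _ _) !bfE subr_ge0.
have : bf (A - (bf A c c) *: 1%:M) c c = 0 by rewrite !bfE c1 mulr1 subrr.
move/(psd_ker hp); rewrite mulmxBl -scalemxAl mul1mx => /eqP.
by rewrite subr_eq0 => /eqP.
Qed.

(** The Householder reflection along x - y.  Fixing the vectors which do not
    distinguish x from y allows vectors to be matched one after another. *)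
Lemma reflection n (x y : 'cV[R]_n) : bf 1%:M x x = bf 1%:M y y ->
  exists H : 'M[R]_n, [/\ H^T *m H = 1%:M, H *m x = y &
    forall z, bf 1%:M x z = bf 1%:M y z -> H *m z = z].
Proof.
move=> exy; have [->|nxy] := eqVneq x y.
  by exists 1%:M; split; rewrite ?trmx1 ?mul1mx // => z _; rewrite mul1mx.
pose u := x - y; have u0 : u != 0 by rewrite subr_eq0.
have k0 := bf1_gt0 u0; set k := bf 1%:M u u in k0.
have kE : u^T *m u = k%:M.
  by rewrite [LHS]mx11_scalar -/(bf _ _ _) /k /bf mulmx1.
pose H := 1%:M - (2 / k) *: (u *m u^T).
have Hz z : H *m z = z - (2 / k * bf 1%:M u z) *: u.
  rewrite mulmxBl mul1mx -scalemxAl -mulmxA.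
  have -> : u^T *m z = (bf 1%:M u z)%:M by rewrite [LHS]mx11_scalar /bf mulmx1.
  by rewrite mul_mx_scalar scalerA.
have HT : H^T = H by rewrite linearB linearZ /= trmx_mul trmxK trmx1.
exists H; split.
- rewrite HT mulmxBr mulmx1 -scalemxAr mulmxA Hz -/k.
  have -> : 2 / k * k = 2 by rewrite divfK // gt_eqF.
  have -> : u - 2 *: u = - u by rewrite -{1}[u]scale1r -scalerBl -opprB; rewrite (_ : 2 - 1 = 1) ?scaleN1r //; lra.
  by rewrite mulNmx scalerN opprK subrK.
- rewrite Hz; have -> : 2 / k * bf 1%:M u x = 1.
    have -> : bf 1%:M u x = k / 2.
      rewrite /k /u !bfE exy (@bf_sym _ _ _ y x) ?trmx1 //; lra.
    by field; rewrite gt_eqF.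
  by rewrite scale1r /u subKr.
- move=> z hz; rewrite Hz; have -> : bf 1%:M u z = 0 by rewrite /u !bfE hz subrr.
  by rewrite mulr0 scale0r subr0.
Qed.

(** Deflation: a reflection moves an eigenvector to the first basis vector. *)
Lemma spectral n (A : 'M[R]_n) : A^T = A ->
  exists (Q : 'M[R]_n) (d : 'rV[R]_n), Q^T *m Q = 1%:M /\ Q^T *m A *m Q = diag_mx d.
Proof.
elim: n A => [|n IH] A sA.
  by exists 0, 0; split; apply/matrixP => [] [].
have [c [l [c1 hc]]] := sym_eigenvector sA.
pose e : 'cV[R]_n.+1 := delta_mx 0 0.
have e1 : bf 1%:M e e = bf 1%:M c c.
  rewrite c1 bf1E (bigD1 0) //= big1 ?addr0 ?mxE ?eqxx ?mulr1 //.
  by move=> j /negbTE j0; rewrite !mxE j0 mulr0.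
have [H [HH He _]] := reflection e1.
pose A' : 'M[R]_(1 + n) := H^T *m A *m H.
have sA' : A'^T = A' by rewrite !trmx_mul trmxK sA mulmxA.
have A'e : A' *m e = l *: e.
  by rewrite /A' -!mulmxA He hc -scalemxAr -He mulmxA HH mul1mx.
have dl : dlsubmx A' = 0.
  apply/matrixP => i j; rewrite !mxE [j]ord1.
  have := congr1 (fun M : 'cV_n.+1 => M (rshift 1 i) 0) A'e.
  rewrite -colE [in LHS]mxE !mxE.
  have -> : lshift n (0 : 'I_1) = 0 by apply: val_inj.
  move=> ->; rewrite (_ : (rshift 1 i == 0) = false) ?mulr0 //.
have ur : ursubmx A' = 0.
  by rewrite -[ursubmx A']trmxK trmx_ursub sA' dl trmx0.
have sd : (drsubmx A')^T = drsubmx A' by rewrite trmx_drsub sA'.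
have [Q1 [d1 [hQ1 hd1]]] := IH (drsubmx A') sd.
pose B : 'M[R]_(1 + n) := block_mx 1%:M 0 0 Q1.
have BB : B^T *m B = 1%:M.
  rewrite /B tr_block_mx !trmx0 trmx1 mulmx_block !mul0mx !mulmx0 !addr0 !add0r mul1mx hQ1.
  by rewrite -scalar_mx_block.
exists (H *m B), (row_mx (ulsubmx A') d1); split.
  by rewrite trmx_mul -mulmxA (mulmxA H^T) HH mul1mx.
have -> : (H *m B)^T *m A *m (H *m B) = B^T *m A' *m B by rewrite trmx_mul /A' !mulmxA.
have eA : A' = block_mx (ulsubmx A') 0 0 (drsubmx A') by rewrite -{1}[A']submxK dl ur.
rewrite [X in B^T *m X]eA /B tr_block_mx !trmx0 trmx1 !mulmx_block.
rewrite !mul0mx !mulmx0 !addr0 !add0r mul1mx mulmx1 hd1 [RHS](diag_mx_row (ulsubmx A') d1).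
suff -> : diag_mx (ulsubmx A') = ulsubmx A' by rewrite !mul0mx.
by apply/matrixP => i j; rewrite !mxE !ord1.
Qed.

(** The columns are matched one at a time; the reflection that matches the next
    column fixes the earlier ones since the Gram matrices agree. *)
Lemma orth_extend r m (f g : 'M[R]_(r, m)) : f^T *m f = g^T *m g ->
  exists2 Q : 'M[R]_r, Q^T *m Q = 1%:M & Q *m f = g.
Proof.
move=> hfg.
suff: forall k, (k <= m)%N -> exists2 Q : 'M[R]_r, Q^T *m Q = 1%:M &
    forall j : 'I_m, (j < k)%N -> Q *m col j f = col j g.
  case/(_ m (leqnn m)) => Q hQ h; exists Q => //.
  apply/matrixP => i j; have := congr1 (fun M : 'cV_r => M i 0) (h j (ltn_ord j)).
  by rewrite !colE mulmxA -!colE !mxE.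
have gram i j : bf 1%:M (col i f) (col j f) = bf 1%:M (col i g) (col j g).
  by rewrite !colE !bf_mull !bf_mulr !mulmx1 hfg.
elim=> [|k IH] km; first by exists 1%:M; rewrite ?trmx1 ?mul1mx.
have [Q hQ h] := IH (ltnW km); pose j0 := Ordinal km.
have isoQ x y : bf 1%:M (Q *m x) (Q *m y) = bf 1%:M x y.
  by rewrite bf_mull bf_mulr mulmx1 hQ.
have [|H [HH H1 H2]] := @reflection _ (Q *m col j0 f) (col j0 g).
  by rewrite isoQ gram.
exists (H *m Q); first by rewrite trmx_mul -mulmxA (mulmxA H^T) HH mul1mx.
move=> j; rewrite ltnS leq_eqVlt => /orP[/eqP jk|jk]; rewrite -mulmxA.
  by have -> : j = j0 by apply: val_inj.
by rewrite (h _ jk) H2 // -(h _ jk) isoQ gram h.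
Qed.

End Orthogonal.

(** * The spectral gap of an overdamped quadratic form *)

Section Gap.
Variable R : realType.

Let qf n (D K : 'M[R]_n) x v := x ^+ 2 * bf 1%:M v v + x * bf D v v + bf K v v.
Let lf n (D : 'M[R]_n) x v := 2 * x * bf 1%:M v v + bf D v v.

(** The roots of the quadratic polynomial of v cannot lie to the left of those of
    w: its form at x is nonnegative on the whole segment from v to w, while the
    derivative in x changes sign along it; where the derivative vanishes and the
    form is nonnegative, the discriminant is not positive. *)
Lemma crossing n (D K : 'M[R]_n) x v w :
  D^T = D -> K^T = K ->
  (forall v, v != 0 -> 4 * bf 1%:M v v * bf K v v < bf D v v ^+ 2) ->
  v != 0 -> w != 0 ->
  0 <= qf D K x v -> 0 <= lf D x v -> 0 <= qf D K x w -> lf D x w <= 0 -> False.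
Proof.
move=> sD sK od v0 w0 qv lv qw lw.
pose Q := x ^+ 2 *: 1%:M + x *: D + K; pose L := (2 * x) *: 1%:M + D.
have sQ : Q^T = Q by rewrite /Q !linearD !linearZ /= trmx1 sD sK.
have sL : L^T = L by rewrite /L !linearD !linearZ /= trmx1 sD.
have QE u : bf Q u u = qf D K x u by rewrite /Q !bfE.
have LE u : bf L u u = lf D x u by rewrite /L !bfE.
have key u : u != 0 -> lf D x u = 0 -> 0 <= qf D K x u -> False.
  move=> u0; rewrite /lf /qf => h1 h2; have := od u u0; have m0 := bf1_gt0 u0.
  have -> : bf D u u = - (2 * x * bf 1%:M u u) by lra.
  move: h2; have -> : bf D u u = - (2 * x * bf 1%:M u u) by lra.
  set m := bf 1%:M u u in m0 *; set k := bf K u u => h2 h3.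
  have : m * (k - x ^+ 2 * m) < 0 by lra.
  have : 0 <= m * (k - x ^+ 2 * m); last lra.
  apply: mulr_ge0; lra.
(* replacing w by - w makes the cross term nonnegative, so the form is nonnegative on the segment *)
wlog b0 : w w0 qw lw / 0 <= bf Q v w.
  move=> H; have [/H|b0] := lerP 0 (bf Q v w); first exact.
  move: qw lw; rewrite /qf /lf => qw lw.
  by apply: (H (- w)); rewrite ?oppr_eq0 // /qf /lf ?bfNl ?bfNr; lra.
pose a := bf L v v; pose b := bf L v w; pose c := bf L w w.
(* the derivative along the segment (1 - t) v + t w *)
pose p : {poly R} := a *: (1 - 'X) ^+ 2 + (2 * b) *: ((1 - 'X) * 'X) + c *: 'X ^+ 2.
have pE t : p.[t] = a * (1 - t) ^+ 2 + 2 * b * ((1 - t) * t) + c * t ^+ 2.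
  by rewrite /p !hornerE.
have a0 : 0 <= a by rewrite /a LE.
have c0 : c <= 0 by rewrite /c LE.
have [|t] := @polyrcf.poly_ivt R p 0 1 ler01.
  by rewrite !pE; nra.
rewrite inE /= => /andP[t0 t1]; rewrite /root pE => /eqP pt.
pose u := (1 - t) *: v + t *: w.
have Lu : lf D x u = 0.
  rewrite -LE /u !bfvE (bf_sym _ _ sL) -/a -/b -/c -[RHS]pt (bf_sym w v sL) -/b; ring.
have Qu : 0 <= qf D K x u.
  rewrite -QE /u !bfvE (bf_sym w v sQ) !QE.
  have h1 := mulr_ge0 (sqr_ge0 (1 - t)) qv; have h2 := mulr_ge0 (sqr_ge0 t) qw.
  have t1' : 0 <= 1 - t by rewrite subr_ge0.
  by have h3 := mulr_ge0 (mulr_ge0 t0 t1') b0; lra.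
have [u0|u0] := eqVneq u 0; last exact: (key u).
have tn : t != 0.
  by apply: contra v0 => /eqP t00; move: u0; rewrite /u t00 subr0 scale1r scale0r addr0 => ->.
(* the segment passes through 0, so w is a multiple of v *)
have ew : w = (- ((1 - t) / t)) *: v.
  have : t^-1 *: u = 0 by rewrite u0 scaler0.
  rewrite /u scalerDr !scalerA mulVf // scale1r => /eqP; rewrite addrC addr_eq0 => /eqP ->.
  by rewrite scaleNr [_^-1 * _]mulrC.
pose s := - ((1 - t) / t); have s0 : s != 0.
  by apply: contra w0 => /eqP h; rewrite ew -/s h scale0r.
apply: (key v) => //; move: lw; rewrite -LE ew -/s !bfvE LE => h.
have : 0 < s ^+ 2 by rewrite exprn_even_gt0.
nra.
Qed.

(** By compactness the strict inequality holds with a margin. *)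
Lemma disc_bound n (D K : 'M[R]_n.+1) :
  (forall v, v != 0 -> 4 * bf 1%:M v v * bf K v v < bf D v v ^+ 2) ->
  exists2 e, 0 < e & forall v,
    4 * bf 1%:M v v * bf K v v + e * bf 1%:M v v ^+ 2 <= bf D v v ^+ 2.
Proof.
move=> od.
have cf : continuous (fun v : 'rV[R]_n.+1 => bf D v^T v^T * bf D v^T v^T +
    (-4) * (bf 1%:M v^T v^T * bf K v^T v^T)).
  apply: add_continuous; first by apply: mul_continuous; exact: bf_continuous.
  apply: mul_continuous; first exact: cst_continuous.
  by apply: mul_continuous; exact: bf_continuous.
have [c c1 hc] := sphere_min cf.
have c0 : c^T != 0.
  by apply: contra_eq_neq c1 => ->; rewrite bf0l eq_sym oner_eq0.
eexists; first by have := od _ c0; rewrite -subr_gt0 => h; exact: h.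
move=> v; have [->|v0] := eqVneq v 0; first by rewrite !bf0l; lra.
have [k [k0 k1]] := bf1_normalize v0.
have := hc (k *: v)^T; rewrite trmxK => /(_ k1).
rewrite !bfE in k1 *; rewrite !mulrA in k1 *; move=> h.
have k4 : 0 < k ^+ 4 by rewrite exprn_gt0.
rewrite -subr_ge0 -(pmulr_rge0 _ k4).
move: h k1; set m := bf 1%:M v v; set d := bf D v v; set kk := bf K v v.
set d0 := bf D c^T c^T; set kc := bf K c^T c^T; rewrite c1 => h k1.
have -> : k ^+ 4 * (d ^+ 2 - (4 * m * kk + (d0 ^+ 2 - 4 * 1 * kc) * m * m)) =
  (k * k * d * k * k * d + -4 * k * k * m * k * k * kk)
  - (d0 ^+ 2 - 4 * kc) * (k * k * m) ^+ 2 by ring.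
rewrite k1; lra.
Qed.

(** The number g is the supremum of the smaller roots.  By crossing it does not
    exceed any larger root, which yields a weak inequality; it is applied to
    K + (e / 8) I, still overdamped by disc_bound, to make it strict. *)
Lemma hyperbolic_gap n (D K : 'M[R]_n) :
  pdmx D -> psdmx K ->
  (forall v, v != 0 -> 4 * bf 1%:M v v * bf K v v < bf D v v ^+ 2) ->
  exists2 g, g < 0 & forall v, v != 0 -> qf D K g v < 0.
Proof.
case: n D K => [|n] D K pD pK od.
  exists (-1); first lra.
  by move=> v /eqP[]; apply/matrixP => [] [].
have sD : D^T = D by case: pD.
have sK : K^T = K by case: pK.
have kge0 v : 0 <= bf K v v by case: pK => _ /(_ v).
have dpos v : v != 0 -> 0 < bf D v v by case: pD => _ /(_ v).
have [e e0 he] := disc_bound od.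
pose K' := K + (e / 8) *: 1%:M.
have sK' : K'^T = K' by rewrite /K' linearD linearZ /= trmx1 sK.
have K'E v : bf K' v v = bf K v v + e / 8 * bf 1%:M v v by rewrite /K' !bfE.
have od' v : v != 0 -> 4 * bf 1%:M v v * bf K' v v < bf D v v ^+ 2.
  move=> v0; have m0 := bf1_gt0 v0; rewrite K'E; have := he v.
  by have := mulr_gt0 e0 (exprn_gt0 2 m0); lra.
(* the real numbers that do not exceed the smaller root of some v *)
pose E := [set x : R | exists v : 'cV_n.+1, [/\ v != 0, 0 <= qf D K' x v & lf D x v <= 0]]%classic.
pose e0' : 'cV[R]_n.+1 := delta_mx 0 0.
have e0n : e0' != 0.
  by apply/eqP => /matrixP/(_ 0 0); rewrite !mxE eqxx => /eqP; rewrite oner_eq0.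
have m1 := bf1_gt0 e0n; have d1 := dpos _ e0n; have k1 := kge0 e0'.
have hsE : has_sup E.
  split.
    exists (- (bf D e0' e0' / bf 1%:M e0' e0')), e0'; split => //; rewrite ?/qf ?/lf.
      rewrite K'E.
      have -> : (- (bf D e0' e0' / bf 1%:M e0' e0')) ^+ 2 * bf 1%:M e0' e0' +
        - (bf D e0' e0' / bf 1%:M e0' e0') * bf D e0' e0' = 0 by field; rewrite gt_eqF.
      by rewrite add0r; nra.
    have -> : 2 * - (bf D e0' e0' / bf 1%:M e0' e0') * bf 1%:M e0' e0' = - 2 * bf D e0' e0'.
      by field; rewrite gt_eqF.
    by lra.
  exists 0 => x [v [v0 _]]; rewrite /lf => h; have := dpos _ v0; have := bf1_gt0 v0; nra.
pose g := sup E.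
have ubE x : E x -> x <= g by move=> Ex; apply: (sup_upper_bound hsE).
have qle v : v != 0 -> qf D K' g v <= 0.
  move=> v0; rewrite leNgt; apply/negP => q0; have m0 := bf1_gt0 v0.
  have [l0|l0|l0] := ltrgtP (lf D g v) 0.
  (* g lies to the left of both roots of v, so a slightly larger number is still in E *)
  - pose ee := Num.min (qf D K' g v / - lf D g v) (- lf D g v / (2 * bf 1%:M v v)).
    have ee0 : 0 < ee.
      by rewrite lt_min !divr_gt0 ?oppr_gt0 // mulr_gt0.
    have e1 : ee * - lf D g v <= qf D K' g v.
      by rewrite -ler_pdivlMr ?oppr_gt0 // ge_min lexx.
    have e2 : ee * (2 * bf 1%:M v v) <= - lf D g v.
      by rewrite -ler_pdivlMr ?mulr_gt0 // ge_min lexx orbT.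
    suff /ubE : E (g + ee) by lra.
    exists v; split=> //; move: e1 e2; rewrite /qf /lf.
      by have := mulr_ge0 (sqr_ge0 ee) (ltW m0); lra.
    by lra.
  (* g lies to the right of both roots of v; so does some nearby member of E, against crossing *)
  - pose ee := Num.min (qf D K' g v / lf D g v) (lf D g v / (2 * bf 1%:M v v)).
    have ee0 : 0 < ee.
      by rewrite lt_min !divr_gt0 // mulr_gt0.
    have e1 : ee * lf D g v <= qf D K' g v.
      by rewrite -ler_pdivlMr // ge_min lexx.
    have e2 : ee * (2 * bf 1%:M v v) <= lf D g v.
      by rewrite -ler_pdivlMr ?mulr_gt0 // ge_min lexx orbT.
    have [x Ex] := sup_adherent ee0 hsE; rewrite -/g => gx.
    have xg := ubE _ Ex; case: Ex => w [w0 qw lw].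
    have [dd [dd0 dde xE]] : exists dd, [/\ 0 <= dd, dd <= ee & x = g - dd].
      by exists (g - x); split; lra.
    have h1 : dd * lf D g v <= ee * lf D g v by rewrite ler_wpM2r // ltW.
    have h2 : dd * (2 * bf 1%:M v v) <= ee * (2 * bf 1%:M v v) by rewrite ler_wpM2r // mulr_ge0 // ltW.
    apply: (@crossing _ D K' x v w) => //; rewrite xE; move: e1 e2 h1 h2; rewrite /qf /lf.
      by have := mulr_ge0 (sqr_ge0 dd) (ltW m0); lra.
    by lra.
  - move: l0 q0 (od' v v0); rewrite /lf /qf.
    set m := bf 1%:M v v in m0 *; set d := bf D v v; set k := bf K' v v => l0.
    have -> : d = - (2 * g * m) by lra.
    move=> q0 h; have : 0 < m * (k - g ^+ 2 * m) by apply: mulr_gt0 => //; lra.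
    lra.
have qlt v : v != 0 -> qf D K g v < 0.
  move=> v0; have := qle v v0; rewrite /qf K'E; have := mulr_gt0 e0 (bf1_gt0 v0); lra.
exists g => //; rewrite ltNge; apply/negP => g0.
have := qlt _ e0n; rewrite /qf.
have := mulr_ge0 (sqr_ge0 g) (ltW m1); have := mulr_ge0 g0 (ltW d1); lra.
Qed.

End Gap.

(** * Signature and definite pencils *)

Section Signature.
Variable R : realType.

Lemma Smx_tr n : (Smx R n)^T = Smx R n.
Proof. by rewrite /Smx tr_block_mx !trmx0 linearN /= !trmx1. Qed.

Lemma Smx_mul n : Smx R n *m Smx R n = 1%:M.
Proof.
rewrite /Smx mulmx_block !mulmx0 !mul0mx !addr0 !add0r mulNmx mulmxN !mulmx1 opprK.
by rewrite -scalar_mx_block.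
Qed.

Lemma SmxK n p (X : 'M[R]_(n + n, p)) : Smx R n *m (Smx R n *m X) = X.
Proof. by rewrite mulmxA Smx_mul mul1mx. Qed.

Lemma mulSmx_col n p (a b : 'M[R]_(n, p)) : Smx R n *m col_mx a b = col_mx (- a) b.
Proof. by rewrite /Smx mul_block_col !mul0mx addr0 add0r mulNmx !mul1mx. Qed.

Lemma bf_Smx n (a b c d : 'cV[R]_n) :
  bf (Smx R n) (col_mx a b) (col_mx c d) = bf 1%:M b d - bf 1%:M a c.
Proof. by rewrite bf_block !bf0 bfN; ring. Qed.

Lemma Smx_diag n : Smx R n = diag_mx (row_mx (const_mx (-1)) (const_mx 1)).
Proof.
rewrite diag_mx_row /Smx; congr block_mx; apply/matrixP => i j; rewrite !mxE //.
by rewrite mulNrn.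
Qed.

(** A larger subspace would meet the negative half of the coordinates. *)
Lemma pos_dim n k (X : 'M[R]_(n + n, k)) :
  (forall y, y != 0 -> 0 < bf (X^T *m Smx R n *m X) y y) -> (k <= n)%N.
Proof.
move=> h; rewrite leqNgt; apply/negP => /(mx_ker_ex (dsubmx X))[y y0 yk].
have := h y y0; rewrite -mulmxA -bf_mull -bf_mulr -[X]vsubmxK mul_col_mx yk bf_Smx bf0l sub0r.
by rewrite oppr_gt0 ltNge bf1_ge0.
Qed.

Lemma neg_dim n k (X : 'M[R]_(n + n, k)) :
  (forall y, y != 0 -> bf (X^T *m Smx R n *m X) y y < 0) -> (k <= n)%N.
Proof.
move=> h; rewrite leqNgt; apply/negP => /(mx_ker_ex (usubmx X))[y y0 yk].
have := h y y0; rewrite -mulmxA -bf_mull -bf_mulr -[X]vsubmxK mul_col_mx yk bf_Smx bf0l subr0.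
by rewrite ltNge bf1_ge0.
Qed.

(** Otherwise the first half of the columns together with T v would span a
    nonpositive subspace of dimension r + 1, which must meet the r-dimensional
    positive half of the coordinates. *)
Lemma complement_pos r (T : 'M[R]_(r + r)) (K M : 'M[R]_r) :
  (forall x : 'cV_(r + r), T *m x = 0 -> x = 0) ->
  T^T *m Smx R r *m T = block_mx (- K) 0 0 M ->
  (forall x, x != 0 -> 0 < bf K x x) -> forall v, v != 0 -> 0 < bf M v v.
Proof.
move=> Tinj hT Kp v v0; rewrite ltNge; apply/negP => Mv.
pose Z : 'M[R]_(r + r, r + 1) := T *m block_mx 1%:M 0 0 v.
have [y y0 yk] := @mx_ker_ex R _ _ (usubmx Z) (eq_leq (esym (addn1 r))).
pose y1 := usubmx y; pose y2 := dsubmx y; have ey : y = col_mx y1 y2 by rewrite vsubmxK.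
have y2E : v *m y2 = y2 0 0 *: v.
  by rewrite [y2]mx11_scalar mul_mx_scalar -mx11_scalar.
pose x := col_mx y1 (v *m y2).
have Zy : Z *m y = T *m x by rewrite /Z -mulmxA ey mul_block_col !mul0mx mul1mx addr0 add0r.
have x0 : x != 0.
  apply: contra y0; rewrite /x -[X in _ == X]col_mx0 => /eqP/eq_col_mx[a0].
  rewrite y2E => /eqP; rewrite scaler_eq0 (negbTE v0) orbF => /eqP b0.
  by rewrite ey a0 [y2]mx11_scalar b0 raddf0 col_mx0.
have : bf (Smx R r) (T *m x) (T *m x) <= 0.
  rewrite bf_mull bf_mulr hT bf_block !bf0 bfN y2E !bfE !addr0.
  have : 0 <= bf K y1 y1 by have [->|/Kp/ltW//] := eqVneq y1 0; rewrite bf0l.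
  by have := mulr_ge0 (sqr_ge0 (y2 0 0)) (_ : 0 <= - bf M v v); rewrite oppr_ge0 => /(_ Mv); lra.
rewrite -Zy -[Z *m y]vsubmxK -mul_usub_mx yk bf_Smx bf0l subr0 => h.
have /eqP : bf 1%:M (dsubmx (Z *m y)) (dsubmx (Z *m y)) = 0.
  by apply/eqP; rewrite eq_le h bf1_ge0.
rewrite bf1_eq0 => /eqP d0.
have : Z *m y = 0 by rewrite -[Z *m y]vsubmxK -mul_usub_mx yk d0 col_mx0.
by rewrite Zy => /Tinj/eqP; rewrite (negbTE x0).
Qed.

Lemma sort_perm n (d : 'I_n -> R) : exists s : 'S_n,
  forall i j : 'I_n, (i <= j)%N -> d (s i) <= d (s j).
Proof.
pose t := [tuple d i | i < n].
have /perm.tuple_permP [p hp] : perm_eq (sort <=%R t) t by rewrite perm_sort.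
exists p => i j ij.
have nthE (k : 'I_n) : nth 0 (sort <=%R t) k = d (p k).
  rewrite hp (nth_map k) ?size_enum_ord // nth_ord_enum.
  by rewrite tnth_mktuple.
rewrite -!nthE; apply: sorted_leq_nth => //; try exact: le_trans.
- exact/sort_sorted/le_total.
- by rewrite inE size_sort size_tuple.
- by rewrite inE size_sort size_tuple.
Qed.

(** Orthonormalize with respect to H first, then rotate by the spectral
    theorem. *)
Lemma pencil_diag n (H S : 'M[R]_n) : pdmx H -> S^T = S ->
  exists (T : 'M[R]_n) (d : 'rV[R]_n),
    T^T *m H *m T = 1%:M /\ T^T *m S *m T = diag_mx d.
Proof.
move=> [sH pH] sS; have [Q [h [QQ hQ]]] := spectral sH.
have h0 i : 0 < h 0 i.
  pose e : 'cV[R]_n := delta_mx i 0.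
  have e0 : Q *m e != 0.
    apply/eqP => /(congr1 (fun x => Q^T *m x)); rewrite mulmxA QQ mul1mx mulmx0.
    by move/matrixP/(_ i 0); rewrite !mxE !eqxx => /eqP; rewrite oner_eq0.
  have := pH _ e0; rewrite -/(bf _ _ _) bf_mull bf_mulr hQ bf_diagE (bigD1 i) //= big1.
    by rewrite !mxE !eqxx !mulr1 addr0.
  by move=> j /negbTE ji; rewrite !mxE ji mulr0 mulr0.
pose E : 'M[R]_n := diag_mx (\row_i (Num.sqrt (h 0 i))^-1).
have ET : E^T = E by rewrite tr_diag_mx.
pose X := Q *m E.
have XHX : X^T *m H *m X = 1%:M.
  have -> : X^T *m H *m X = E *m (Q^T *m H *m Q) *m E.
    by rewrite /X trmx_mul ET !mulmxA.
  rewrite hQ !mulmx_diag; apply/matrixP => i j; rewrite !mxE; congr (_ *+ _).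
  rewrite mulrAC -expr2 exprVn sqr_sqrtr ?ltW // mulVf ?gt_eqF //.
have [|Q2 [d [QQ2 hd]]] := @spectral R _ (X^T *m S *m X).
  exact: sym_congr.
exists (X *m Q2), d; split.
  have -> : (X *m Q2)^T *m H *m (X *m Q2) = Q2^T *m (X^T *m H *m X) *m Q2.
    by rewrite trmx_mul !mulmxA.
  by rewrite XHX mulmx1 QQ2.
by rewrite -hd trmx_mul !mulmxA.
Qed.

Lemma scaled_cols n (T P : 'M[R]_n) (s : 'I_n -> 'I_n) (c : 'I_n -> R) i j :
  let T' : 'M[R]_n := \matrix_(k, l) (T k (s l) * c l) in
  (T'^T *m P *m T') i j = c i * c j * (T^T *m P *m T) (s i) (s j).
Proof.
move=> T'; rewrite -mulmxA [LHS]mxE.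
have cE l : col l T' = c l *: col (s l) T by apply/colP => k; rewrite !mxE mulrC.
have bE (M : 'M[R]_n) a b : (M^T *m P *m M) a b = bf P (col a M) (col b M).
  by rewrite !colE bf_mull bf_mulr /bf trmx_delta -rowE -colE !mxE.
by have := bE T' i j; rewrite -mulmxA [LHS]mxE => ->; rewrite bE !cE bfZl bfZr mulrA.
Qed.

(** Diagonalize S with respect to the definite form H = g S - S A.  A column t
    with S t = d H t satisfies A t = (g - 1/d) t, and its S-square has the sign
    of d.  Sorting the numbers d increasingly puts the negative type first and
    arranges both families of eigenvalues g - 1/d increasingly. *)
Theorem hyperbolic_canonical r (A : 'M[R]_(r + r)) g :
  (Smx R r *m A)^T = Smx R r *m A ->
  (forall x, x != 0 -> bf (Smx R r *m A) x x < g * bf (Smx R r) x x) ->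
  exists (T : 'M[R]_(r + r)) (lm lp : 'rV[R]_r),
    [/\ T^T *m Smx R r *m T = Smx R r,
        T^T *m (Smx R r *m A) *m T = block_mx (- diag_mx lm) 0 0 (diag_mx lp),
        forall i, g < lm 0 i, forall i, lp 0 i < g
      & (forall i j : 'I_r, (i <= j)%N -> lm 0 i <= lm 0 j) /\
        (forall i j : 'I_r, (i <= j)%N -> lp 0 i <= lp 0 j)].
Proof.
move=> sA neg; pose S := Smx R r; pose H := g *: S - S *m A.
have pH : pdmx H.
  split; first by rewrite /H linearB linearZ /= sA Smx_tr.
  by move=> x x0; rewrite -/(bf _ _ _) /H !bfE subr_gt0 neg.
have [T0 [d0 [hH hS]]] := pencil_diag pH (Smx_tr r).
have T0inj x : T0 *m x = 0 -> x = 0 :> 'cV_(r + r).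
  by move=> h; rewrite -[x]mul1mx -hH -mulmxA h mulmx0.
have d0n i : d0 0 i != 0.
  apply/eqP => di; pose e : 'cV[R]_(r + r) := delta_mx i 0.
  have e0 : T0 *m e != 0.
    by apply/eqP => /T0inj/matrixP/(_ i 0); rewrite !mxE !eqxx => /eqP; rewrite oner_eq0.
  have T0u : T0^T \in unitmx by rewrite unitmx_tr; apply: mx_inj_unit.
  have : T0^T *m (S *m (T0 *m e)) = 0.
    rewrite !mulmxA hS; apply/colP => k; rewrite mul_diag_mx !mxE.
    by case: eqP => [->|_]; rewrite ?di ?mul0r ?mulr0.
  move/(congr1 (mulmx (invmx T0^T))); rewrite mulKmx // mulmx0.
  by move/(congr1 (mulmx S)); rewrite SmxK mulmx0 => /eqP; rewrite (negbTE e0).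
have [s hs] := sort_perm (d0 0).
pose d i := d0 0 (s i).
have dn i : d i != 0 by exact: d0n.
pose T1 : 'M[R]_(r + r) := \matrix_(k, l) (T0 k (s l) * 1).
have T1S i j : (T1^T *m S *m T1) i j = d i *+ (i == j).
  by rewrite scaled_cols !mul1r hS mxE (inj_eq perm_inj).
have colT1 k (f : 'I_k -> 'I_(r + r)) y : injective f ->
    bf ((colsub f T1)^T *m S *m colsub f T1) y y = \sum_i d (f i) * y i 0 ^+ 2.
  move=> fi; have -> : (colsub f T1)^T *m S *m colsub f T1 = diag_mx (\row_i d (f i)).
    have -> : (colsub f T1)^T *m S *m colsub f T1 = mxsub f f (T1^T *m S *m T1).
      apply/matrixP => i j; rewrite [RHS]mxE.
      have bE p (M : 'M[R]_(r + r, p)) a b : (M^T *m S *m M) a b = bf S (col a M) (col b M).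
        by rewrite !colE bf_mull bf_mulr /bf trmx_delta -rowE -colE !mxE.
      rewrite !bE; congr bf; by apply/colP => a; rewrite !mxE.
    by apply/matrixP => i j; rewrite mxE T1S !mxE (inj_eq fi).
  by rewrite bf_diagE; apply: eq_bigr => i _; rewrite mxE expr2.
have sumpos k (c : 'I_k -> R) (y : 'cV[R]_k) : (forall i, 0 < c i) -> y != 0 ->
    0 < \sum_i c i * y i 0 ^+ 2.
  move=> cp y0; rewrite lt_def sumr_ge0 ?andbT; last first.
    by move=> i _; rewrite mulr_ge0 ?sqr_ge0 // ltW.
  apply: contra y0; rewrite psumr_eq0 => [/allP h|i _]; last first.
    by rewrite mulr_ge0 ?sqr_ge0 // ltW.
  apply/eqP/colP => i; have := h i (mem_index_enum _).
  by rewrite /= mulf_eq0 gt_eqF //= sqrf_eq0 mxE => /eqP.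
(* if d were positive here it would be positive at 1 + r places, against pos_dim *)
have dm i : d (lshift r i) < 0.
  rewrite ltNge le_eqVlt eq_sym (negbTE (dn _)) /=; apply/negP => di.
  pose f (k : 'I_(1 + r)) := match split k with inl _ => lshift r i | inr k => rshift r k end.
  have fi : injective f.
    move=> a b; rewrite /f; case: (splitP a) => a' ea; case: (splitP b) => b' eb.
    - by move=> _; apply: val_inj; rewrite /= ea eb !ord1.
    - by move/eqP; rewrite eq_lrshift.
    - by move/eqP; rewrite eq_rlshift.
    - by move/rshift_inj => e; apply: val_inj; rewrite /= ea eb e.
  suff : (1 + r <= r)%N by rewrite add1n ltnn.
  apply: (@pos_dim _ _ (colsub f T1)) => y y0; rewrite colT1 //; apply: sumpos => // k.
  rewrite /f; case: (split k) => // k'; apply: lt_le_trans di _; apply: hs => /=.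
  by rewrite (leq_trans (ltnW (ltn_ord i))) // leq_addr.
have dp i : 0 < d (rshift r i).
  rewrite ltNge le_eqVlt (negbTE (dn _)) /=; apply/negP => di.
  pose f (k : 'I_(1 + r)) := match split k with inl _ => rshift r i | inr k => lshift r k end.
  have fi : injective f.
    move=> a b; rewrite /f; case: (splitP a) => a' ea; case: (splitP b) => b' eb.
    - by move=> _; apply: val_inj; rewrite /= ea eb !ord1.
    - by move/eqP; rewrite eq_rlshift.
    - by move/eqP; rewrite eq_lrshift.
    - by move/lshift_inj => e; apply: val_inj; rewrite /= ea eb e.
  suff : (1 + r <= r)%N by rewrite add1n ltnn.
  apply: (@neg_dim _ _ (colsub f T1)) => y y0; rewrite colT1 // -oppr_gt0 -sumrN.
  under eq_bigr do rewrite -mulNr.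
  apply: sumpos => // k; rewrite oppr_gt0.
  by rewrite /f; case: (split k) => // k'; apply: dm.
pose c i := (Num.sqrt `|d i|)^-1.
have c2 i : c i * c i = `|d i|^-1 by rewrite -expr2 exprVn sqr_sqrtr.
pose T : 'M[R]_(r + r) := \matrix_(k, l) (T0 k (s l) * c l).
have TS : T^T *m S *m T = diag_mx (\row_i (d i / `|d i|)).
  apply/matrixP => i j; rewrite scaled_cols hS !mxE (inj_eq perm_inj).
  by case: eqP => [->|_]; rewrite ?mulr0 // !mulr1n c2 mulrC.
have TH : T^T *m H *m T = diag_mx (\row_i `|d i|^-1).
  apply/matrixP => i j; rewrite scaled_cols hH !mxE (inj_eq perm_inj).
  by case: eqP => [->|_]; rewrite ?mulr0 // !mulr1n c2 mulr1.
have sgl i : d (lshift r i) / `|d (lshift r i)| = -1.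
  by rewrite ltr0_norm // invrN mulrN divff.
have sgr i : d (rshift r i) / `|d (rshift r i)| = 1.
  by rewrite gtr0_norm // divff.
have TSS : T^T *m S *m T = S.
  rewrite TS /S Smx_diag; congr diag_mx; apply/rowP => k; rewrite !mxE.
  by case: (splitP k) => k' ek; rewrite mxE -?(sgl k') -?(sgr k'); congr (d _ / `|d _|); apply: val_inj.
pose lm : 'rV[R]_r := \row_i (g - (d (lshift r i))^-1).
pose lp : 'rV[R]_r := \row_i (g - (d (rshift r i))^-1).
exists T, lm, lp; split.
- exact: TSS.
- have -> : S *m A = g *: S - H by rewrite /H opprB addrC subrK.
  rewrite mulmxBr mulmxBl TH -scalemxAr -scalemxAl TSS.
  have -> : - diag_mx lm = diag_mx (- lm) by rewrite linearN.
  rewrite -diag_mx_row /S Smx_diag -linearZ -linearB; congr diag_mx.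
  apply/rowP => k; rewrite !mxE; case: (splitP k) => k' ek; rewrite !mxE.
    have -> : k = lshift r k' by apply: val_inj.
    by rewrite ltr0_norm // invrN opprK; ring.
  have -> : k = rshift r k' by apply: val_inj.
  by rewrite gtr0_norm //; ring.
- by move=> i; rewrite mxE ltrDl oppr_gt0 invr_lt0.
- by move=> i; rewrite mxE gtrDl oppr_lt0 invr_gt0.
- split=> i j ij; rewrite !mxE lerD2l lerN2.
    by rewrite lef_nV2 ?hs // negrE.
  by rewrite lef_pV2 ?posrE // hs //= leq_add2l.
Qed.

End Signature.

(** * Sign characteristic of a definite pencil *)

Section Typed.
Variable R : realType.

Lemma mx_cols0 (T : nmodType) p q (X : 'M[T]_(p, q)) : q = 0%N -> X = 0.
Proof. by move=> q0; apply/matrixP => i j; have := ltn_ord j; rewrite [X in (_ < X)%N]q0. Qed.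

Lemma sum2_0 : (\sum_(j < 0) 2 = 0)%N.
Proof. by rewrite big_ord0. Qed.

(** The equation k = size p allows T to come with another expression of its
    size. *)
Lemma canonical_pairs_diag N (S A : 'M[R]_N) (p : seq (R * R)) k
    (T : 'M[R]_(N, k)) (Ti : 'M[R]_(k, N)) : k = size p ->
  all (fun el => (el.1 == 1) || (el.1 == -1)) p ->
  T *m Ti = 1%:M -> Ti *m T = 1%:M ->
  T^T *m S *m T = diag_seq k (map fst p) ->
  Ti *m A *m T = diag_seq k (map snd p) -> canonical_pairs S A p.
Proof.
move=> ek pe T1 T2 TS TA; subst k; split=> //.
exists 0%N, (fun=> 0), (fun=> 1), (row_mx T 0), (col_mx Ti 0).
have flat (X Y : 'M[R]_(\sum_(j < 0) 2)) : X = Y.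
  by rewrite (mx_cols0 X sum2_0) (mx_cols0 Y sum2_0).
split.
- by case.
- split; first by rewrite mul_row_col mulmx0 addr0.
  rewrite mul_col_row !mul0mx !mulmx0 T2 -[LHS]/(block_mx _ _ _ _) scalar_mx_block.
  by rewrite (flat 0 1%:M).
- rewrite tr_row_mx trmx0 mul_col_mx mul_col_row !mul0mx !mulmx0 TS.
  by congr block_mx; apply: flat.
- rewrite mul_col_mx mul_col_row !mul0mx !mulmx0 TA.
  by congr block_mx; apply: flat.
Qed.

Lemma char_poly_simil N k (A : 'M[R]_N) (T : 'M[R]_(N, k)) (Ti : 'M[R]_(k, N)) :
  T *m Ti = 1%:M -> Ti *m T = 1%:M -> char_poly A = char_poly (Ti *m A *m T).
Proof.
move=> T1 T2; have e : N = k.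
  by apply/eqP; rewrite eqn_leq (mulmx1_min T1) (mulmx1_min T2).
subst k.
rewrite /char_poly; have -> : char_poly_mx (Ti *m A *m T) =
    map_mx polyC Ti *m char_poly_mx A *m map_mx polyC T.
  rewrite /char_poly_mx mulmxBr mulmxBl !map_mxM; congr (_ - _).
  by rewrite mul_mx_scalar -scalemxAl -map_mxM T2 map_mx1 scalemx1.
rewrite !det_mulmx mulrAC -det_mulmx -map_mxM T2 map_mx1 det1 mul1r //.
Qed.

(** In canonical coordinates S A - g S is block diagonal and negative definite.
    Its part belonging to nonreal eigenvalues has trace zero, hence is absent;
    its diagonal entries e (l - g) force the sign e from the side of l. *)
Lemma neg_pencil_pairs N (S A : 'M[R]_N) g p :
  (forall x, x != 0 -> bf (S *m A) x x < g * bf S x x) ->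
  canonical_pairs S A p ->
  char_poly A = \prod_(x <- map snd p) ('X - x%:P) /\
  (forall el, el \in p -> el = (if el.2 < g then 1 else -1, el.2)).
Proof.
move=> neg [pe [c [sg [tau [T [Ti [tau0 [T1 T2] TS TA]]]]]]].
have TSA : T^T *m (S *m A) *m T = (T^T *m S *m T) *m (Ti *m A *m T).
  by rewrite -!mulmxA (mulmxA T Ti) T1 mul1mx.
set B := (\mxdiag_(j < c) mx2 0 1 1 0) in TS.
set C := (\mxdiag_(j < c) _) in TA.
have negT y : y != 0 -> bf (T^T *m (S *m A) *m T) y y < g * bf (T^T *m S *m T) y y.
  move=> y0; rewrite !bf_congr; apply: neg.
  by apply: contra y0 => /eqP h; rewrite -[y]mul1mx -T2 -mulmxA h mulmx0.
have c0 : c = 0%N.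
  case: (posnP c) => // cp; exfalso.
  pose q := (\sum_(j < c) 2)%N.
  have q0 : (0 < q)%N by rewrite /q sum_nat_const card_ord muln_gt0 cp.
  have dneg (i : 'I_q) : (B *m C - g *: B) i i < 0.
    pose y : 'cV[R]_q := delta_mx i 0.
    have : col_mx (0 : 'cV[R]_(size p)) y != 0.
      apply/eqP => /matrixP/(_ (rshift _ i) 0); rewrite col_mxEd !mxE !eqxx => /eqP.
      by rewrite oner_eq0.
    move/negT; rewrite TSA TS TA mulmx_block !mul0mx !mulmx0 !addr0 !add0r.
    rewrite !bf_block !bf0 !bf0l !add0r -subr_lt0 -bfZ -bfN -bfD => h.
    by move: h; rewrite /bf trmx_delta -rowE -colE !mxE.
  have tr0 : \tr (B *m C - g *: B) = 0.
    rewrite linearB linearZ /=.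
    have -> : \tr (B *m C) = \sum_(j < c) \tr (mx2 0 1 1 0 *m mx2 (sg j) (tau j) (- tau j) (sg j)).
      rewrite /B /C [X in X *m _]/mxdiag mul_mxblock_mxdiag mxtrace_mxblock.
      by apply: eq_bigr => j _; rewrite eqxx conform_mx_id.
    rewrite mxtrace_mxdiag !big1 ?mulr0 ?subr0 // => j _.
      by rewrite /mxtrace !big_ord_recl big_ord0 !mxE /= !addr0.
    rewrite /mxtrace !big_ord_recl big_ord0 !mxE !big_ord_recl !big_ord0 !mxE /=.
    by ring.
  have : \tr (B *m C - g *: B) < 0; last by rewrite tr0 ltxx.
  rewrite /mxtrace -oppr_gt0 -sumrN (bigD1 (Ordinal q0)) //=.
  rewrite ltr_wpDr ?oppr_gt0 // sumr_ge0 // => i _.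
  by rewrite oppr_ge0 ltW.
subst c; pose T' := lsubmx T; pose Ti' := usubmx Ti.
have TT1 : T' *m Ti' = 1%:M.
  by rewrite -T1 -[T]hsubmxK -[Ti]vsubmxK mul_row_col (mx_cols0 (rsubmx T) sum2_0) mul0mx addr0.
have TT2 : Ti' *m T' = 1%:M.
  have := congr1 ulsubmx T2; rewrite -[in LHS](hsubmxK T) -[in LHS](vsubmxK Ti) mul_col_row block_mxKul.
  by rewrite scalar_mx_block block_mxKul.
have TA' : Ti' *m A *m T' = diag_seq (size p) (map snd p).
  have := congr1 ulsubmx TA; rewrite -[in LHS](hsubmxK T) -[in LHS](vsubmxK Ti).
  by rewrite mul_col_mx mul_col_row !block_mxKul.
split.
  rewrite (char_poly_simil _ TT1 TT2) TA' char_poly_trig ?diag_mx_is_trig //.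
  rewrite [RHS](big_nth 0) size_map big_mkord; apply: eq_bigr => i _.
  by rewrite !mxE eqxx.
move=> el elp; pose i0 := Ordinal (eq_ind_r is_true elp (index_mem el p)).
have nthi : nth (0, 0) p i0 = el by rewrite nth_index.
pose y : 'cV[R]_(size p) := delta_mx i0 0.
have : col_mx y (0 : 'cV[R]_(\sum_(j < 0) 2)) != 0.
  apply/eqP => /matrixP/(_ (lshift _ i0) 0); rewrite col_mxEu !mxE !eqxx => /eqP.
  by rewrite oner_eq0.
move/negT; rewrite TSA TS TA mulmx_block !mul0mx !mulmx0 !addr0 !add0r.
rewrite !bf_block ?bf0 ?bf0r ?bf0l ?addr0 ?mulmx_diag.
have bfd (d : 'rV[R]_(size p)) : bf (diag_mx d) y y = d 0 i0.
  by rewrite /bf trmx_delta -rowE -colE !mxE eqxx.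
rewrite !bfd !mxE !(nth_map (0, 0)) // nthi.
have := allP pe _ elp; case: el {elp nthi i0 y bfd} => e l /= /orP[] /eqP -> h.
  by rewrite ifT //; lra.
by rewrite ifF //; apply/negbTE; rewrite -leNgt; lra.
Qed.

(** The list of pairs is unique: the eigenvalues are the roots of the
    characteristic polynomial, and each one determines its sign. *)
Theorem hyperbolic_typed r (A T : 'M[R]_(r + r)) (lm lp : 'rV[R]_r) g :
  (forall x, x != 0 -> bf (Smx R r *m A) x x < g * bf (Smx R r) x x) ->
  T^T *m Smx R r *m T = Smx R r ->
  T^T *m (Smx R r *m A) *m T = block_mx (- diag_mx lm) 0 0 (diag_mx lp) ->
  (forall i, g < lm 0 i) -> (forall i, lp 0 i < g) ->
  (forall i j : 'I_r, (i <= j)%N -> lm 0 i <= lm 0 j) ->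
  (forall i j : 'I_r, (i <= j)%N -> lp 0 i <= lp 0 j) ->
  (forall z : R[i], eigenvalue (cmx A) z -> z \is Num.real) /\
  exists lm lp : r.-tuple R,
        [/\ typed_eigenvalues (Smx R r) A lm lp,
            sorted <=%R lp, sorted <=%R lm
          & forall i j : 'I_r, tnth lp i < tnth lm j].
Proof.
move=> neg TS TA lmg lpg slm slp; pose S := Smx R r.
pose tm := [tuple lm 0 i | i < r]; pose tp := [tuple lp 0 i | i < r].
pose p := [seq (-1 : R, x) | x <- tm] ++ [seq (1 : R, x) | x <- tp].
have sp : (r + r)%N = size p by rewrite size_cat 2!size_map !size_tuple.
pose Ti := S *m T^T *m S.
have Ti1 : Ti *m T = 1%:M by rewrite /Ti -!mulmxA [X in S *m X]mulmxA TS Smx_mul.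
have Ti2 := mulmx1C Ti1.
have nthm (i : 'I_r) : nth 0 (tval tm) i = lm 0 i by rewrite -tnth_nth tnth_mktuple.
have nthp (i : 'I_r) : nth 0 (tval tp) i = lp 0 i by rewrite -tnth_nth tnth_mktuple.
have sz : size [seq (-1 : R, x) | x <- tm] = r by rewrite size_map size_tuple.
have nth1 (i : 'I_r) : nth (0, 0) p (lshift r i) = (-1, lm 0 i).
  have li : (lshift r i < r)%N by exact: ltn_ord i.
  by rewrite nth_cat sz li (nth_map 0) ?size_tuple // nthm.
have nth2 (i : 'I_r) : nth (0, 0) p (rshift r i) = (1, lp 0 i).
  have li : (rshift r i < r)%N = false by rewrite /= ltnNge leq_addr.
  have si : (rshift r i - r)%N = i by rewrite /= addKn.
  by rewrite nth_cat sz li si (nth_map 0) ?size_tuple // nthp.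
have dS (f : R * R -> R) : diag_seq (r + r) (map f p) =
    diag_mx (row_mx (\row_i f (-1, lm 0 i)) (\row_i f (1, lp 0 i))).
  congr diag_mx; apply/rowP => k; rewrite !mxE (nth_map (0, 0)) -?sp //.
  case: (splitP k) => k' ek; rewrite mxE.
    by have -> : k = lshift r k' by [apply: val_inj]; rewrite nth1.
  by have -> : k = rshift r k' by [apply: val_inj]; rewrite nth2.
have cp : canonical_pairs S A p.
  apply: (canonical_pairs_diag sp _ Ti2 Ti1).
  - by rewrite all_cat !all_map; apply/andP; split; apply/allP => x _ /=; rewrite eqxx ?orbT.
  - rewrite TS dS Smx_diag; congr (diag_mx (row_mx _ _)); by apply/rowP => i; rewrite !mxE.
  - have -> : Ti *m A *m T = S *m (T^T *m (S *m A) *m T) by rewrite /Ti !mulmxA.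
    rewrite TA dS diag_mx_row /S /Smx mulmx_block !mulmx0 !mul0mx !addr0 !add0r.
    rewrite mulNmx mulmxN opprK !mul1mx.
    by congr block_mx; congr diag_mx; apply/rowP => i; rewrite mxE.
have [cA _] := neg_pencil_pairs neg cp.
split.
  move=> z; rewrite eigenvalue_root_char -map_char_poly cA rmorph_prod /root horner_prod.
  rewrite prodf_seq_eq0 => /hasP[x _]; rewrite /= rmorphB /= map_polyX map_polyC /= hornerXsubC subr_eq0 => /eqP ->.
  by rewrite complex_real.
exists tm, tp; split.
- split; first exact: cp.
  move=> p' cp'; have [cA' hp'] := neg_pencil_pairs neg cp'; have [_ hp] := neg_pencil_pairs neg cp.
  have /prod_XsubC_eq e : \prod_(x <- map snd p') ('X - x%:P) = \prod_(x <- map snd p) ('X - x%:P).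
    by rewrite -cA.
  have fE (q : seq (R * R)) : (forall el, el \in q -> el = (if el.2 < g then 1 else -1, el.2)) ->
      q = map (fun x => (if x < g then 1 else -1, x)) (map snd q).
    by move=> h; rewrite -map_comp -[LHS]map_id; apply/eq_in_map => el /h.
  change (perm_eq p' p); rewrite (fE _ hp') (fE _ hp); exact: perm_map.
- apply/(sortedP 0) => i; rewrite size_tuple => hi.
  have hi' := ltnW hi; rewrite (nthp (Ordinal hi)) (nthp (Ordinal hi')).
  by apply: slp => /=.
- apply/(sortedP 0) => i; rewrite size_tuple => hi.
  have hi' := ltnW hi; rewrite (nthm (Ordinal hi)) (nthm (Ordinal hi')).
  by apply: slm => /=.
- by move=> i j; rewrite !tnth_mktuple (lt_trans (lpg i)).
Qed.

End Typed.

(** * The minimal solution of the KYP inequality *)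

Section KYP.
Variable R : realType.

(** The columns of F are the minimizers u of the form of Z at x + Y u, where x
    runs through the columns of X; the kernel of Y^T Z Y is annihilated by Z Y,
    so the normal equation is solvable. *)
Lemma psd_factor N m k (Z : 'M[R]_N) (Y : 'M[R]_(N, m)) (X : 'M[R]_(N, k)) :
  psdmx Z -> exists F : 'M[R]_(m, k), Y^T *m Z *m (X + Y *m F) = 0.
Proof.
move=> pZ; have sZ : Z^T = Z by case: pZ.
pose K := cokermx (Y^T *m Z *m Y).
have ZYK : Z *m (Y *m K) = 0.
  apply: psd_ker_mx => //.
  have -> : (Y *m K)^T *m Z *m (Y *m K) = K^T *m (Y^T *m Z *m Y *m K) by rewrite trmx_mul !mulmxA.
  by rewrite mulmx_coker mulmx0.
have /submxP[F hF] : (X^T *m Z *m Y <= Y^T *m Z *m Y)%MS.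
  by rewrite submxE -/K -!mulmxA ZYK mulmx0.
exists (- F^T); rewrite mulmxDr mulmxN mulmxN.
have -> : Y^T *m Z *m (Y *m F^T) = Y^T *m Z *m X; last by rewrite subrr.
have := congr1 trmx hF; rewrite !trmx_mul !trmxK sZ !mulmxA => ->.
by [].
Qed.

Section General.
Variables (N m : nat) (A : 'M[R]_N) (B : 'M[R]_(N, m)) (C : 'M[R]_(m, N)).

Lemma kyp_sym Q : Q^T = Q -> (- KYPmx A B C Q)^T = - KYPmx A B C Q.
Proof.
move=> sQ; rewrite linearN /= /KYPmx tr_block_mx trmx0.
rewrite linearD /= !trmx_mul trmxK sQ addrC; congr (- block_mx _ _ _ _).
  by rewrite linearB /= trmx_mul trmxK sQ.
by rewrite linearB /= trmx_mul trmxK sQ.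
Qed.

Lemma kyp_form Q x u : Q^T = Q ->
  bf (- KYPmx A B C Q) (col_mx x u) (col_mx x u) =
  2 * (bf C u x - bf Q x (A *m x + B *m u)).
Proof.
move=> sQ; rewrite bfN bf_block bf0 !bfE !bf_mulr.
rewrite -(bf_tr (_ *m B)) trmx_mul sQ.
have -> : bf (A^T *m Q) x x = bf (Q *m A) x x by rewrite -bf_tr trmx_mul sQ trmxK.
by rewrite bf_tr; ring.
Qed.

Lemma kypP Q : KYP_psd_solution A B C Q <->
  psdmx Q /\ forall x u, bf Q x (A *m x + B *m u) <= bf C u x.
Proof.
split=> [[pQ [_ h]]|[pQ h]]; split=> //; have sQ : Q^T = Q by case: pQ.
  move=> x u; have := h (col_mx x u); rewrite -/(bf _ _ _) kyp_form //; lra.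
split; first exact: kyp_sym.
move=> y; rewrite -/(bf _ _ _) -[y]vsubmxK kyp_form //.
have := h (usubmx y) (dsubmx y); lra.
Qed.

Lemma kyp_facts Q : KYP_psd_solution A B C Q ->
  [/\ psdmx Q, Q *m B = C^T & psdmx (- (A^T *m Q + Q *m A))].
Proof.
move=> [pQ pK]; have sQ : Q^T = Q by case: pQ.
split=> //.
  apply/eqP; rewrite -subr_eq0; apply/eqP.
  apply: bf_inj => x u; rewrite bf0.
  have /(psd_ker pK) : bf (- KYPmx A B C Q) (col_mx 0 u) (col_mx 0 u) = 0.
    by rewrite kyp_form // bf0r bf0l subrr mulr0.
  rewrite /KYPmx mulNmx mul_block_col !mulmx0 mul0mx !add0r => /eqP.
  rewrite oppr_eq0 -[X in _ == X]col_mx0 => /eqP/eq_col_mx[h _].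
  by rewrite /bf -mulmxA h mulmx0 mxE.
split; first by rewrite linearN linearD /= !trmx_mul trmxK sQ addrC.
move=> x; rewrite -/(bf _ _ _); have := pK.2 (col_mx x 0); rewrite -/(bf _ _ _).
by rewrite /KYPmx !bfN bf_block !(bf0r, bf0l) !addr0.
Qed.

(** Discretize by the midpoint rule, x = (1 - A) xi - B u and
    x' = (1 + A) xi + B u.  Solutions of the KYP inequality are exactly the
    storage functions of the discrete system, and x'^T P x' - x^T P x differs
    from the supply by twice the dissipation xi^T Th xi.  The dynamic
    programming step, which replaces P by P - 2 Xi where x^T Xi x is the least
    dissipation over all u, produces another storage function.  By minimality
    Xi = 0: every x has a control without dissipation. *)
Lemma minimal_fixpoint P : KYP_minimal_solution A B C P -> 1%:M - A \in unitmx ->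
  exists (X : 'M[R]_N) (F : 'M[R]_(m, N)),
    (A^T *m P + P *m A) *m X = 0 /\ (1%:M - A) *m X = 1%:M + B *m F.
Proof.
move=> [kP minP] uA; have [pP PB pTh] := kyp_facts kP; have sP : P^T = P by case: pP.
set Th := - _ in pTh.
pose Phi := invmx (1%:M - A).
have [F hF] := psd_factor (Phi *m B) Phi pTh.
pose X := Phi *m (1%:M + B *m F).
have eX : Phi + Phi *m B *m F = X by rewrite /X mulmxDr mulmx1 mulmxA.
rewrite eX in hF.
have AX : (1%:M - A) *m X = 1%:M + B *m F by rewrite /X mulmxA mulmxV // mul1mx.
exists X, F; split=> //.
pose Xi := X^T *m Th *m X.
have pXi : psdmx Xi.
  split; first by apply: sym_congr; case: pTh.
  by move=> x; rewrite -/(bf _ _ _) bf_congr; case: pTh => _ /(_ (X *m x)).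
have sXi : Xi^T = Xi by case: pXi.
have ThE x u : bf P x (A *m x + B *m u) = bf C u x - bf Th x x / 2.
  rewrite /Th bfN bfD bfDr !bf_mulr PB bf_tr.
  have -> : bf (A^T *m P) x x = bf (P *m A) x x by rewrite -bf_tr trmx_mul sP trmxK.
  by field.
have quad (Q : 'M[R]_N) x y : Q^T = Q -> bf Q (x + y) (x + y) - bf Q (x - y) (x - y) = 4 * bf Q x y.
  by move=> sQ; rewrite !bfvE (bf_sym y x sQ); ring.
have xiE x u : x - (A *m x + B *m u) = (1%:M - A) *m x - B *m u.
  by rewrite mulmxBl mul1mx opprD addrA.
(* Xi is the least dissipation *)
have minXi x u : bf Xi (x - (A *m x + B *m u)) (x - (A *m x + B *m u)) <= bf Th x x.
  set y := x - _.
  have ex : x = X *m y + Phi *m B *m (u - F *m y).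
    have -> : x = Phi *m (y + B *m u) by rewrite /y xiE subrK mulKmx.
    by rewrite -eX mulmxDl -!mulmxA -[RHS]addrA -!mulmxDr [F *m y + _]addrC subrK.
  clearbody y; rewrite [X in _ <= bf Th X X]ex !bfvE.
  have c1 : bf Th (X *m y) (Phi *m B *m (u - F *m y)) = 0.
    rewrite bf_sym; last by case: pTh.
    by rewrite -bf_congr hF bf0.
  have c2 : bf Th (Phi *m B *m (u - F *m y)) (X *m y) = 0 by rewrite -bf_congr hF bf0.
  have -> : bf Xi y y = bf Th (X *m y) (X *m y) by exact: bf_congr.
  have : 0 <= bf Th (Phi *m B *m (u - F *m y)) (Phi *m B *m (u - F *m y)).
    by case: pTh => _ /(_ (Phi *m B *m (u - F *m y))).
  by rewrite c1 c2; lra.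
have kQ : KYP_psd_solution A B C (P - 2 *: Xi).
  have sQ : (P - 2 *: Xi)^T = P - 2 *: Xi by rewrite linearB linearZ /= sP sXi.
  apply/kypP; split.
    split=> // x; rewrite -/(bf _ _ _) !bfE.
    (* the choice u = 0 has supply 0, so P - 2 Xi is at least the form of P at x' *)
    pose y := Phi *m x; have yx : y - (A *m y + B *m 0) = x.
      by rewrite xiE mulmx0 subr0 /y mulKVmx.
    have h1 := minXi y 0; rewrite yx in h1.
    have := quad P y (A *m y + B *m 0) sP; rewrite yx ThE bf0l.
    have : 0 <= bf P (y + (A *m y + B *m 0)) (y + (A *m y + B *m 0)).
      by case: pP => _ /(_ (y + (A *m y + B *m 0))).
    by lra.
  move=> x u; have hy := ThE x u; have hm := minXi x u.
  set y := A *m x + B *m u in hy hm *; clearbody y.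
  have q1 := quad P x y sP; have q2 := quad Xi x y sXi.
  have h0 : 0 <= bf Xi (x + y) (x + y) by case: pXi => _ /(_ (x + y)).
  by rewrite bfD bfN bfZ; lra.
have [_ h] := minP _ kQ.
have Xi0 x : bf Xi x x = 0.
  apply: le_anti; rewrite andbC; case: pXi => _ /(_ x); rewrite -/(bf _ _ _) => -> /=.
  by have := h x; rewrite -/(bf _ _ _) !bfE; lra.
have : Th *m X = 0.
  apply: psd_ker_mx => //; apply: bf_inj => x y; rewrite bf0.
  have := Xi0 (x + y); rewrite !bfvE !Xi0 (bf_sym y x sXi); lra.
by rewrite /Th mulNmx => /eqP; rewrite oppr_eq0 => /eqP.
Qed.

End General.

(** From 0 <= P <= 1 one gets |P x|^2 <= x^T P x <= |x|^2, and equality on the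
    right puts x in the kernel of 1 - P. *)
Lemma contraction_fixed N (P : 'M[R]_N) x : psdmx P -> psdmx (1%:M - P) ->
  bf 1%:M (P *m x) (P *m x) = bf 1%:M x x -> P *m x = x.
Proof.
move=> pP pI hx; have sP : P^T = P by case: pP.
have PPe : bf 1%:M (P *m x) (P *m x) = bf P x (P *m x) by rewrite bf_mull mulmx1 sP.
have h1 : 0 <= bf (1%:M - P) (P *m x) (P *m x) by case: pI => _ /(_ (P *m x)).
have h2 : 0 <= bf P (x - P *m x) (x - P *m x) by case: pP => _ /(_ (x - P *m x)).
have h3 : 0 <= bf (1%:M - P) x x by case: pI => _ /(_ x).
have sI : (1%:M - P)^T = 1%:M - P by case: pI.
have h4 : bf P (P *m x) x = bf P x (P *m x) by rewrite bf_sym.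
have : bf (1%:M - P) x x = 0.
  move: h1 h2 h3; rewrite !bfE h4 hx -PPe hx; lra.
move/(psd_ker pI); rewrite mulmxBl mul1mx => /eqP; rewrite subr_eq0 => /eqP h.
by rewrite -h.
Qed.

End KYP.

(** * The given system *)

Section System.
Variables (R : realType) (n m : nat) (G D : 'M[R]_n) (B : 'M[R]_(n, m)).
Let A := Asys G D.
Let Bc := Bsys B.
Let S := Smx R n.

Lemma Asys_col p (a b : 'M[R]_(n, p)) : A *m col_mx a b = col_mx (G^T *m b) (- (G *m a) - D *m b).
Proof. by rewrite /A /Asys mul_block_col mul0mx add0r !mulNmx. Qed.

Lemma SBc : S *m Bc = Bc.
Proof. by rewrite /S /Bc /Bsys mulSmx_col oppr0. Qed.

Lemma SA_sym : D^T = D -> (S *m A)^T = S *m A.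
Proof.
move=> sD; rewrite /S /A /Smx /Asys mulmx_block !mul0mx !mulmx0 !addr0 !add0r.
by rewrite !mulNmx !mul1mx tr_block_mx !linearN /= trmx0 sD trmxK.
Qed.

Lemma Asys_inj p (x : 'M[R]_(n + n, p)) : G \in unitmx -> A *m x = 0 -> x = 0.
Proof.
move=> uG; rewrite -[x]vsubmxK Asys_col -[X in _ = X]col_mx0 => /eq_col_mx[h1].
have uGT : G^T \in unitmx by rewrite unitmx_tr.
have -> : dsubmx x = 0 by rewrite -[dsubmx x](mulKmx uGT) h1 mulmx0.
rewrite mulmx0 subr0 => /eqP; rewrite oppr_eq0 => /eqP h2.
have -> : usubmx x = 0 by rewrite -[usubmx x](mulKmx uG) h2 mulmx0.
by rewrite col_mx0.
Qed.

Lemma Asys_diss x y : bf A (col_mx x y) (col_mx x y) = - bf D y y.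
Proof. by rewrite bf_block bf0 !bfN bf_tr; ring. Qed.

(** The physical energy is a storage function. *)
Lemma one_kyp : pdmx D -> KYP_psd_solution A Bc Bc^T 1%:M.
Proof.
move=> pD; apply/kypP; split.
  by split=> [|x]; [exact: trmx1|exact: bf1_ge0].
move=> x u; rewrite bfDr !bf_mulr !mul1mx bf_tr gerDr -[x]vsubmxK Asys_diss oppr_le0.
exact: pdmx_ge0.
Qed.

Lemma one_sub_unit : pdmx D -> 1%:M - A \in unitmx.
Proof.
move=> pD; apply: mx_inj_unit => x h.
have : bf 1%:M x x - bf A x x = 0 by rewrite -bfN -bfD /bf -mulmxA h mulmx0 mxE.
rewrite -{3 4}[x]vsubmxK Asys_diss => h2; apply/eqP; rewrite -bf1_eq0; apply/eqP.
by have := bf1_ge0 x; have := pdmx_ge0 (dsubmx x) pD; lra.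
Qed.

(** Completing the square in the first component leaves the quadratic polynomial
    of the second component, evaluated at g. *)
Lemma SA_neg g : g < 0 ->
  (forall v, v != 0 -> g ^+ 2 * bf 1%:M v v + g * bf D v v + bf (G *m G^T) v v < 0) ->
  forall x, x != 0 -> bf (S *m A) x x < g * bf S x x.
Proof.
move=> g0 hg x; rewrite -[x]vsubmxK; set p := usubmx x; set v := dsubmx x => x0.
rewrite -bf_mulr Asys_col !bf_Smx !bfvE !bf_mulr !mul1mx.
have GT : bf G v p = bf G^T p v by rewrite bf_tr.
rewrite GT; clear GT.
have [v0|v0] := eqVneq v 0.
  rewrite v0 !(bf0l, bf0r); have p0 : p != 0.
    by apply: contra x0 => /eqP ->; rewrite v0 col_mx0.
  by have := bf1_gt0 p0; nra.
have := hg v v0.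
have -> : bf (G *m G^T) v v = bf 1%:M (G^T *m v) (G^T *m v).
  by rewrite bf_mull bf_mulr trmxK mulmx1.
have -> : bf G^T p v = bf 1%:M p (G^T *m v) by rewrite bf_mulr mul1mx.
set w := G^T *m v; clearbody w.
have := bf1_ge0 (g *: p - w); rewrite !bfvE (@bf_sym _ _ _ w p) ?trmx1 //.
set pp := bf _ p p; set pw := bf _ p w; set ww := bf _ w w.
set vv := bf _ v v; set d := bf D v v => h1 h2.
have : 0 < - g * (g * (vv - pp) - (- pw - d - pw)).
  by lra.
by rewrite pmulr_rgt0 ?oppr_gt0 // subr_gt0.
Qed.

Hypothesis uG : G \in unitmx.
Hypothesis pD : pdmx D.
Hypothesis rB : \rank B = m.

Variable P : 'M[R]_(n + n).
Hypothesis minP : KYP_minimal_solution A Bc Bc^T P.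
Let Th := - (A^T *m P + P *m A).

Let sD : D^T = D. Proof. by case: pD. Qed.

Lemma P_facts : [/\ psdmx P, P *m Bc = Bc, psdmx Th & psdmx (1%:M - P)].
Proof.
have [kP h] := minP; have [pP PB pT] := kyp_facts kP; split=> //; first by rewrite PB trmxK.
exact: h (one_kyp pD).
Qed.

Lemma ATS : A^T *m S = S *m A.
Proof. by rewrite -(SA_sym sD) trmx_mul Smx_tr. Qed.

Lemma B_inj (u : 'cV_m) : B *m u = 0 -> u = 0.
Proof. by apply: mx_inj_col; rewrite rB. Qed.

Lemma BcThBc : pdmx (Bc^T *m Th *m Bc).
Proof.
have [pP PB pT _] := P_facts; split; first by apply: sym_congr; case: pT.
move=> u u0; rewrite -/(bf _ _ _) bf_congr /Th bfN bfD.
have -> : bf (A^T *m P) (Bc *m u) (Bc *m u) = bf A (Bc *m u) (Bc *m u).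
  by rewrite -bf_mulr mulmxA PB bf_tr.
have -> : bf (P *m A) (Bc *m u) (Bc *m u) = bf A (Bc *m u) (Bc *m u).
  have PB' : Bc^T *m P = Bc^T.
    by rewrite -[in RHS]PB trmx_mul; case: pP => ->.
  by rewrite bf_mull mulmxA PB' -bf_mull.
rewrite /Bc /Bsys mul_col_mx mul0mx Asys_diss.
have : 0 < bf D (B *m u) (B *m u); last lra.
by case: pD => _; apply; apply: contra u0 => /eqP/B_inj ->.
Qed.

End System.

(** * The reduced system is minimal *)

Section Reduced.
Variables (R : realType) (n m r : nat) (G D : 'M[R]_n) (B : 'M[R]_(n, m)).
Let A := Asys G D.
Let Bc := Bsys B.
Let S := Smx R n.
Let Sr := Smx R r.
Variable P : 'M[R]_(n + n).
Let Th : 'M[R]_(n + n) := - (A^T *m P + P *m A).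
Variable V : 'M[R]_(n + n, r + r).
Variable sig : 'rV[R]_(r + r).
Let Sig := diag_mx sig.
Let sgn : 'rV[R]_(r + r) := row_mx (const_mx (-1)) (const_mx 1).
Variable W : 'M[R]_(r + r, n + n).
Hypothesis WE : W = Sr *m V^T *m S.

Hypothesis uG : G \in unitmx.
Hypothesis pD : pdmx D.
Hypothesis rB : \rank B = m.
Hypothesis minP : KYP_minimal_solution A Bc Bc^T P.
Hypothesis VSV : V^T *m S *m V = Sr.
Hypothesis PV : P *m V = S *m V *m Sr *m Sig.
Hypothesis sig_gt0 : forall i, 0 < sig 0 i.
Hypothesis sig_le1 : forall i, sig 0 i <= 1.
Hypothesis keep1 : forall w : 'cV_(n + n), S *m (P *m w) = w -> V *m (W *m w) = w.
Hypothesis keepN1 : forall w : 'cV_(n + n), S *m (P *m w) = - w -> V *m (W *m w) = w.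
Hypothesis keep_opp : forall i (w : 'cV_(n + n)),
  S *m (P *m w) = (- (sgn 0 i * sig 0 i)) *: w -> V *m (W *m w) = w.

Variables (At Tht : 'M[R]_(r + r)) (Bt : 'M[R]_(r + r, m)) (Ct : 'M[R]_(m, r + r)).
Hypotheses (AtE : At = W *m A *m V) (BtE : Bt = W *m Bc) (CtE : Ct = Bc^T *m V).
Hypothesis ThtE : Tht = V^T *m Th *m V.

Let sD : D^T = D. Proof. by case: pD. Qed.
Let pP : psdmx P. Proof. by case: (P_facts pD minP). Qed.
Let sP : P^T = P. Proof. by case: pP. Qed.
Let PB : P *m Bc = Bc. Proof. by case: (P_facts pD minP). Qed.
Let pTh : psdmx Th. Proof. by case: (P_facts pD minP). Qed.
Let pI : psdmx (1%:M - P). Proof. by case: (P_facts pD minP). Qed.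
Let AS : A^T *m S = S *m A. Proof. exact: ATS. Qed.

Lemma red_SA : Sr *m At = V^T *m (S *m A) *m V.
Proof. by rewrite AtE WE !mulmxA Smx_mul mul1mx. Qed.

Lemma red_SA_sym : (Sr *m At)^T = Sr *m At.
Proof. by rewrite red_SA; apply: sym_congr; exact: SA_sym. Qed.

Lemma red_ATS : At^T *m Sr = Sr *m At.
Proof. by rewrite -red_SA_sym trmx_mul Smx_tr. Qed.

Lemma red_AT : At^T = Sr *m At *m Sr.
Proof. by rewrite -red_ATS -mulmxA Smx_mul mulmx1. Qed.

Lemma red_WV : W *m V = 1%:M.
Proof. by rewrite WE -!mulmxA (mulmxA V^T) VSV Smx_mul. Qed.

Lemma V_inj p (x : 'M[R]_(r + r, p)) : V *m x = 0 -> x = 0.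
Proof. by move=> h; rewrite -[x]mul1mx -red_WV -mulmxA h mulmx0. Qed.

Lemma keep_mx p (w : 'M[R]_(n + n, p)) :
  (forall w : 'cV_(n + n), S *m (P *m w) = w -> V *m (W *m w) = w) -> S *m (P *m w) = w -> V *m (W *m w) = w.
Proof.
move=> keep h; apply/matrixP => i j.
have := keep (col j w); rewrite !colE !mulmxA; rewrite !mulmxA in h; rewrite h => /(_ erefl).
by move/matrixP/(_ i 0); rewrite -!colE !mxE.
Qed.

Lemma VBt : V *m Bt = Bc.
Proof. by rewrite BtE; apply: keep_mx => //; rewrite PB SBc. Qed.

Lemma CtT : Ct^T = Sr *m Bt.
Proof.
by rewrite CtE trmx_mul trmxK BtE WE -(mulmxA _ S) SBc -mulmxA SmxK.
Qed.

Lemma red_CtE : Ct = Bt^T *m Sr.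
Proof. by rewrite -[Ct]trmxK CtT trmx_mul Smx_tr. Qed.

Lemma SigSr : Sig *m Sr = Sr *m Sig.
Proof. by rewrite /Sr Smx_diag /Sig !mulmx_diag; congr diag_mx; apply/rowP => i; rewrite !mxE mulrC. Qed.

Lemma VTP : V^T *m P = Sig *m W.
Proof.
rewrite -[P]sP -trmx_mul PV !trmx_mul !Smx_tr tr_diag_mx.
by rewrite WE !mulmxA.
Qed.

Lemma red_Lyap : Tht = - (At^T *m Sig + Sig *m At).
Proof.
rewrite ThtE /Th mulmxN mulNmx mulmxDr mulmxDl; congr (- (_ + _)).
  rewrite -[LHS]trmxK -[RHS]trmxK; congr trmx.
  by rewrite !trmx_mul !trmxK tr_diag_mx sP !mulmxA VTP AtE !mulmxA.
by rewrite !mulmxA VTP AtE !mulmxA.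
Qed.

Lemma SigBt : Sig *m Bt = Ct^T.
Proof. by rewrite BtE mulmxA -VTP -mulmxA PB CtE trmx_mul trmxK. Qed.

Lemma pTht : psdmx Tht.
Proof.
rewrite ThtE; split; first by apply: sym_congr; case: pTh.
by move=> x; rewrite -/(bf _ _ _) bf_congr; case: pTh => _ /(_ (V *m x)).
Qed.

Lemma Tht_lift (x : 'cV_(r + r)) : Tht *m x = 0 -> Th *m (V *m x) = 0.
Proof.
move=> h; apply: psd_ker => //; rewrite -bf_congr -ThtE /bf -mulmxA h mulmx0.
by rewrite mxE.
Qed.

Lemma Th_ker (w : 'cV[R]_(n + n)) : Th *m w = 0 -> A^T *m (P *m w) = - (P *m (A *m w)).
Proof.
rewrite /Th mulNmx mulmxDl -!mulmxA => /eqP; rewrite oppr_eq0 addr_eq0 => /eqP.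
by [].
Qed.

Lemma bf_Sig_pos (x : 'cV_(r + r)) : x != 0 -> 0 < bf Sig x x.
Proof.
have p i : 0 <= sig 0 i * (x i 0 * x i 0).
  by apply: mulr_ge0; [exact: ltW|rewrite -expr2 sqr_ge0].
move=> x0; rewrite bf_diagE lt_def sumr_ge0 ?andbT //.
apply: contra x0; rewrite psumr_eq0 // => /allP h.
apply/eqP/colP => i; have := h i (mem_index_enum _).
by rewrite /= mulf_eq0 gt_eqF //= -expr2 sqrf_eq0 mxE => /eqP.
Qed.

Let Sigi := diag_mx (\row_i (sig 0 i)^-1).

Lemma SigK : Sig *m Sigi = 1%:M.
Proof.
rewrite /Sig /Sigi mulmx_diag -diag_const_mx; congr diag_mx; apply/rowP => i.
by rewrite !mxE mulfV // gt_eqF.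
Qed.

(** A row of Bt with a nonzero entry has sigma = 1, since Sig Bt = Sr Bt. *)
Lemma SigiBt : Sigi *m Bt = Ct^T.
Proof.
have := SigBt; rewrite CtT => h.
rewrite -h; apply/matrixP => i j.
have := congr1 (fun M : 'M_(r + r, m) => M i j) h.
rewrite /Sr Smx_diag /Sig /Sigi !mul_diag_mx !mxE.
have s0 := sig_gt0 i; set b := Bt i j; set s := sig 0 i in s0 *.
have bE c : s * b = c * b -> c ^+ 2 = 1 -> s^-1 * b = s * b.
  move=> e1 e2; have : s * (s * b) = b by rewrite e1 mulrCA e1 mulrA -expr2 e2 mul1r.
  by move=> e3; rewrite -[in LHS]e3 mulKf // gt_eqF.
case: (splitP i) => k _; rewrite mxE => /bE; apply; first by rewrite sqrrN expr1n.
by rewrite expr1n.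
Qed.

(** Each 1/sigma - sigma is nonnegative and vanishes only for sigma = 1. *)
Lemma Sig_fixed (x : 'cV_(r + r)) : bf Sigi x x <= bf Sig x x -> Sig *m x = x.
Proof.
have p i : 0 <= (sig 0 i)^-1 - sig 0 i.
  by rewrite subr_ge0 (le_trans (sig_le1 i)) // invr_ge1 // unitfE gt_eqF.
rewrite -subr_le0 !bf_diagE -sumrB => h.
have q i : true -> 0 <= (\row_i (sig 0 i)^-1) 0 i * (x i 0 * x i 0) - sig 0 i * (x i 0 * x i 0).
  by move=> _; rewrite mxE -mulrBl mulr_ge0 // -expr2 sqr_ge0.
have /eqP : \sum_i ((\row_i (sig 0 i)^-1) 0 i * (x i 0 * x i 0) - sig 0 i * (x i 0 * x i 0)) = 0.
  by apply: le_anti; rewrite h sumr_ge0.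
rewrite psumr_eq0 // => /allP hh; apply/colP => i.
have := hh i (mem_index_enum _); rewrite mxE -mulrBl /= mulf_eq0 mul_diag_mx !mxE.
case/orP; last by rewrite -expr2 sqrf_eq0 => /eqP ->; rewrite mulr0.
rewrite subr_eq0 => /eqP e; have s0 := sig_gt0 i.
have : sig 0 i * sig 0 i = 1 by rewrite -{1}e mulVf // gt_eqF.
by have := sig_le1 i; move=> s1 s2; have -> : sig 0 i = 1; [nra|rewrite mul1r].
Qed.


Lemma SigiSrSig p (x : 'M_(r + r, p)) : Sigi *m (Sr *m (Sig *m x)) = Sr *m x.
Proof. by rewrite (mulmxA Sr) -SigSr !mulmxA (mulmx1C SigK) mul1mx. Qed.

Lemma Tht_form (x : 'cV_(r + r)) : bf Tht x x = -2 * bf (Sig *m At) x x.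
Proof.
rewrite red_Lyap bfN bfD.
have -> : bf (At^T *m Sig) x x = bf (Sig *m At) x x.
  by rewrite -bf_tr trmx_mul trmxK tr_diag_mx.
by ring.
Qed.

(** The closed loop matrix of the reduced Riccati equation has no positive
    eigenvalue a.  The solutions Sig and Sig^-1 of the KYP inequality are
    compared along the eigenvector x, which confines x to the directions with
    sigma = 1.  There P maps V x to S V Sr x, and V Sr x to S V x.  As P is a
    contraction, the two combinations of V x and V Sr x are a pure velocity and
    a pure position; D > 0 makes the velocity vanish, and the state equation
    then makes the position vanish. *)
Lemma closed_loop_inj (x : 'cV_(r + r)) (u : 'cV[R]_m) (a : R) : 0 < a ->
  Tht *m x = 0 -> At *m x = a *: x + Bt *m u -> x = 0.
Proof.
move=> a0 hT hA.
have e1 : bf Sig x (At *m x) = 0.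
  have : bf Tht x x = 0 by rewrite /bf -mulmxA hT mulmx0 mxE.
  by rewrite Tht_form bf_mulr; lra.
pose z := Sr *m (Sigi *m x).
(* the residual of the dual solution Sig^-1 at x *)
have zT : bf Tht z z = -2 * bf Sigi x (At *m x).
  rewrite Tht_form; congr (_ * _).
  have -> : bf (Sig *m At) z z = bf (Sigi *m Sr *m Sig *m At *m Sr *m Sigi) x x.
    rewrite /z mulmxA bf_mull bf_mulr trmx_mul tr_diag_mx Smx_tr.
    by rewrite !mulmxA.
  have -> : Sigi *m Sr *m Sig = Sr.
    by rewrite -[LHS]mulmx1 -!mulmxA SigiSrSig mulmx1.
  by rewrite -red_AT -bf_tr trmx_mul trmxK tr_diag_mx bf_mulr.
have bu (Q : 'M[R]_(r + r)) : Q *m Bt = Ct^T -> bf Q x (At *m x) = a * bf Q x x + bf Ct^T x u.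
  by move=> hQ; rewrite hA bfDr bfZr bf_mulr hQ.
have z0 : 0 <= bf Tht z z by case: pTht => _ /(_ z).
have xx : Sig *m x = x.
  apply: Sig_fixed; move: e1 zT z0; rewrite (bu _ SigBt) (bu _ SigiBt) => e1 -> h.
  by rewrite -(ler_pM2l a0); lra.
have xxi : Sigi *m x = x by rewrite -{1}xx mulmxA (mulmx1C SigK) mul1mx.
have bx : bf Sigi x x = bf Sig x x.
  by rewrite -[Sigi]mul1mx -[Sig]mul1mx -!bf_mulr xx xxi.
have zx : z = Sr *m x by rewrite /z xxi.
have Tz : Tht *m (Sr *m x) = 0.
  rewrite -zx; apply: psd_ker pTht _; rewrite zT.
  by move: e1; rewrite (bu _ SigBt) (bu _ SigiBt) bx; lra.
pose y := V *m x; pose y' := V *m (Sr *m x).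
have Py : P *m y = S *m y' by rewrite /y mulmxA PV -!mulmxA xx.
have Py' : P *m y' = S *m y.
  by rewrite /y' mulmxA PV -!mulmxA (mulmxA Sig) SigSr -mulmxA xx SmxK.
have Ty : Th *m y = 0 by apply: Tht_lift.
have Ty' : Th *m y' = 0 by apply: Tht_lift.
have Pp : P *m (y + y') = S *m (y + y') by rewrite !mulmxDr Py Py' addrC.
have isoS (w : 'cV[R]_(n + n)) : bf 1%:M (S *m w) (S *m w) = bf 1%:M w w.
  by rewrite bf_mull bf_mulr Smx_tr mulmx1 Smx_mul.
have fixp (w : 'cV[R]_(n + n)) : P *m w = S *m w -> S *m w = w.
  by move=> h; rewrite -h; apply: contraction_fixed => //; rewrite h isoS.
have fixm (w : 'cV[R]_(n + n)) : P *m w = - (S *m w) -> S *m w = - w.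
  move=> h; have -> : S *m w = - (P *m w) by rewrite h opprK.
  congr (- _); apply: contraction_fixed => //; rewrite h.
  by rewrite bfNl bfNr opprK isoS.
have up0 (w : 'cV[R]_(n + n)) : S *m w = w -> usubmx w = 0.
  rewrite -[w]vsubmxK mulSmx_col => /eq_col_mx[h _]; rewrite col_mxKu; move: h.
  by move/eqP; rewrite eq_sym -addr_eq0 -mulr2n -scaler_nat scaler_eq0 pnatr_eq0 => /eqP.
have down0 (w : 'cV[R]_(n + n)) : S *m w = - w -> dsubmx w = 0.
  rewrite -[w]vsubmxK mulSmx_col opp_col_mx => /eq_col_mx[_ h]; rewrite col_mxKd; move: h.
  by move/eqP; rewrite -addr_eq0 -mulr2n -scaler_nat scaler_eq0 pnatr_eq0 => /eqP.
have AP (w : 'cV[R]_(n + n)) : Th *m w = 0 -> P *m w = S *m w -> P *m (A *m w) = - (S *m (A *m w)).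
  move=> Tw Pw; have := Th_ker Tw; rewrite Pw mulmxA AS -mulmxA => ->.
  by rewrite opprK.
(* A (0, v) = (G^T v, - D v) must be a pure position, so D v = 0 *)
have yp0 : y + y' = 0.
  have Tp : Th *m (y + y') = 0 by rewrite mulmxDr Ty Ty' addr0.
  have u0 := up0 _ (fixp _ Pp).
  have := down0 _ (fixm _ (AP _ Tp Pp)).
  rewrite -[y + y']vsubmxK u0 Asys_col mulmx0 oppr0 add0r col_mxKd => /eqP.
  rewrite oppr_eq0 => /eqP h.
  have := congr1 (mulmx (invmx D)) h; rewrite mulKmx ?pd_unit // mulmx0 => ->.
  by rewrite col_mx0.
have ey : y' = - y by apply/eqP; rewrite -addr_eq0 addrC yp0.
have Py2 : P *m y = - (S *m y) by rewrite Py ey mulmxN.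
have d0 := down0 _ (fixm _ Py2).
have PA : P *m (A *m y) = S *m (A *m y).
  have := Th_ker Ty; rewrite Py2 mulmxN [A^T *m _]mulmxA AS -mulmxA => /oppr_inj ->.
  by [].
(* S P fixes A y, so the reduced state equation lifts *)
have : A *m y = a *: y + Bc *m u.
  rewrite -(keep1 (w := A *m y)); last by rewrite PA SmxK.
  by rewrite /y !mulmxA -(mulmxA _ W) -(mulmxA _ _ V) -AtE -mulmxA hA mulmxDr -scalemxAr mulmxA VBt.
rewrite -[y]vsubmxK d0 Asys_col mulmx0 /Bc /Bsys mul_col_mx mul0mx scale_col_mx scaler0.
rewrite add_col_mx add0r => /eq_col_mx[h _].
have y0 : usubmx y = 0.
  move: h; rewrite addr0 => /eqP; rewrite eq_sym scaler_eq0 gt_eqF //= => /eqP.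
  by [].
by apply: V_inj; rewrite -/y -[y]vsubmxK d0 y0 col_mx0.
Qed.

(** The kernel of At is stable under Sr Sig, so a nonzero element of minimal
    support is an eigenvector of Sr Sig, to a retained signed value d.  For its
    lift y, the vector A y is an eigenvector of S P to - d, a value which
    admissibility forbids among the discarded ones; hence A y is reproduced by
    the reduction, and A y = V At x = 0. *)
Lemma red_inj (x : 'cV_(r + r)) : At *m x = 0 -> x = 0.
Proof.
have [k] := ubnP #|[set i | x i 0 != 0]|; elim: k x => // k IH x cx hx.
apply/eqP; apply: contraT => x0.
have [i xi] : exists i, x i 0 != 0.
  apply/existsP; apply: contraNT x0; rewrite negb_exists => /forallP h.
  by apply/eqP/colP => i; have := h i; rewrite negbK mxE => /eqP.
pose d := sgn 0 i * sig 0 i.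
have Tx : Tht *m x = 0.
  by apply: psd_ker pTht _; rewrite Tht_form -bf_mulr hx bf0r mulr0.
have hd : At *m (Sr *m (Sig *m x)) = 0.
  have h : At^T *m (Sig *m x) = 0.
    move: Tx; rewrite red_Lyap mulNmx mulmxDl -!mulmxA hx mulmx0 addr0 => /eqP.
    by rewrite oppr_eq0 => /eqP.
  have := congr1 (mulmx Sr) h; rewrite mulmx0 red_AT !mulmxA Smx_mul mul1mx.
  by [].
have E j : (Sr *m (Sig *m x)) j 0 = sgn 0 j * sig 0 j * x j 0.
  by rewrite /Sr Smx_diag /Sig !mul_diag_mx !mxE mulrA.
pose y := Sr *m (Sig *m x) - d *: x.
have Ay : At *m y = 0 by rewrite mulmxBr hd -scalemxAr hx scaler0 subr0.
have yE j : y j 0 = (sgn 0 j * sig 0 j - d) * x j 0 by rewrite mulrBl -E !mxE.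
have y0 : y = 0.
  apply: IH Ay; rewrite -ltnS; apply: leq_trans cx; rewrite ltnS; apply: proper_card.
  apply/properP; split.
    by apply/fintype.subsetP => j; rewrite !inE yE mulf_eq0 negb_or => /andP[].
  by exists i; rewrite !inE // yE subrr mul0r eqxx.
have Dx : Sr *m (Sig *m x) = d *: x by apply/eqP; rewrite -subr_eq0 -/y y0.
have Tv := Tht_lift Tx.
have Pv : P *m (V *m x) = d *: (S *m (V *m x)).
  by rewrite mulmxA PV -!mulmxA Dx -!scalemxAr.
have PA : S *m (P *m (A *m (V *m x))) = (- d) *: (A *m (V *m x)).
  have := Th_ker Tv; rewrite Pv -scalemxAr [A^T *m _]mulmxA AS -mulmxA.
  move/(congr1 (mulmx S)); rewrite -scalemxAr SmxK mulmxN => h.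
  by rewrite scaleNr h opprK.
have Av0 : A *m (V *m x) = 0.
  rewrite -(keep_opp PA); have -> : W *m (A *m (V *m x)) = 0 by rewrite !mulmxA -AtE.
  by rewrite mulmx0.
by move: x0; rewrite (V_inj (Asys_inj uG Av0)) eqxx.
Qed.

(** Dissipation excludes l > 0. *)
Lemma red_stable (x : 'cV_(r + r)) (l : R) : At *m x = l *: x -> 0 <= l -> x = 0.
Proof.
move=> hx; rewrite le_eqVlt => /orP[/eqP l0|l0].
  by apply: red_inj; rewrite hx -l0 scale0r.
apply/eqP; apply: contraT => /bf_Sig_pos h.
have : 0 <= bf Tht x x by case: pTht => _ /(_ x).
by rewrite Tht_form -bf_mulr hx bfZr; have := mulr_gt0 l0 h; lra.
Qed.

(** minimal_fixpoint supplies a kernel of Th of dimension at least 2 n - m. *)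
Lemma rank_Th : (\rank Th <= m)%N.
Proof.
have [X [F [TX AX]]] := minimal_fixpoint minP (one_sub_unit G pD).
have TX0 : Th *m X = 0 by rewrite /Th mulNmx TX oppr0.
have := mulmx0_rank_max TX0 => h1.
have h2 : (n + n <= \rank X + m)%N.
  rewrite -[leqLHS](mxrank1 R (n + n)).
  have -> : 1%:M = (1%:M - A) *m X + Bc *m (- F) :> 'M[R]_(n + n).
    by rewrite AX mulmxN addrK.
  rewrite (leq_trans (mxrank_add _ _)) // leq_add ?mulmx_max_rank //.
  exact: mxrankM_maxr.
by rewrite -(leq_add2r (\rank X)) (leq_trans h1) // addnC.
Qed.

Let R0 := Bc^T *m Th *m Bc.

Lemma R0_unit : R0 \in unitmx.
Proof. by apply: pd_unit; apply: BcThBc. Qed.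

(** Th Bc already has the rank m of Th, so Th factors through it. *)
Lemma Riccati : Th = Th *m Bc *m invmx R0 *m (Bc^T *m Th).
Proof.
have sub : (Bc^T *m Th <= Th)%MS by apply: submxMl.
have rk : (m <= \rank (Bc^T *m Th))%N.
  by rewrite -{1}(mxrank_unit R0_unit) mxrankM_maxl.
have /submxP[X hX] : (Th <= Bc^T *m Th)%MS.
  have [h1 h2] := mxrank_leqif_sup sub.
  by rewrite -h2 eqn_leq h1 (leq_trans rank_Th rk).
have -> : Th *m Bc = X *m R0 by rewrite {1}hX /R0 !mulmxA.
by rewrite mulmxK ?R0_unit.
Qed.

Lemma ThtBt : Tht *m Bt = V^T *m Th *m Bc.
Proof. by rewrite ThtE -mulmxA VBt. Qed.

Lemma BtTht : Bt^T *m Tht = Bc^T *m Th *m V.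
Proof. by rewrite ThtE !mulmxA -trmx_mul VBt. Qed.

Lemma red_Riccati : Tht = Tht *m Bt *m invmx R0 *m (Bt^T *m Tht).
Proof. by rewrite ThtBt BtTht {1}ThtE {1}Riccati !mulmxA. Qed.

(** Let a = - l > 0.  The vector Sig x annihilates Bt, and it annihilates
    (a - At) xi whenever Tht xi = 0.  By the Riccati equation the kernel of Tht
    is a complement of the range of Bt, and by closed_loop_inj these vectors
    span the whole space. *)
Lemma red_observable (x : 'cV_(r + r)) (l : R) : At *m x = l *: x -> Ct *m x = 0 -> x = 0.
Proof.
move=> hx hC; have [/(red_stable hx) //|l0] := lerP 0 l.
pose a := - l; have a0 : 0 < a by rewrite oppr_gt0.
pose K := Bt *m invmx R0 *m (Bt^T *m Tht).
have TK : Tht *m (1%:M - K) = 0.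
  by rewrite mulmxBr mulmx1 /K !mulmxA -(mulmxA _ Bt^T) -red_Riccati subrr.
(* 1 - K projects onto the kernel of Tht along the range of Bt *)
pose Z := (a%:M - At) *m (1%:M - K) + K.
have uZ : Z \in unitmx.
  apply: mx_inj_unit => y; rewrite /Z mulmxDl -mulmxA => h.
  have hy : (1%:M - K) *m y = 0.
    apply: (@closed_loop_inj _ (invmx R0 *m (Bt^T *m Tht) *m y) a) => //.
      by rewrite mulmxA TK mul0mx.
    move: h; rewrite mulmxBl mul_scalar_mx addrAC => /eqP; rewrite subr_eq0 => /eqP <-.
    by rewrite /K !mulmxA.
  move: h; rewrite hy mulmx0 add0r => Ky.
  by move: hy; rewrite mulmxBl Ky subr0 mul1mx.
have Te : (a%:M - At^T) *m (Sig *m x) = Tht *m x.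
  rewrite red_Lyap mulNmx [in RHS]mulmxDl -(mulmxA Sig) hx -scalemxAr opprD.
  by rewrite mulmxBl mul_scalar_mx -(mulmxA At^T) /a scaleNr addrC.
have eZ : (Sig *m x)^T *m Z = 0.
  rewrite /Z mulmxDr mulmxA.
  have -> : (Sig *m x)^T *m (a%:M - At) = (Tht *m x)^T.
    by rewrite -Te [RHS]trmx_mul [in RHS]linearB /= trmxK tr_scalar_mx.
  have -> : (Tht *m x)^T *m (1%:M - K) = 0.
    by rewrite trmx_mul; case: pTht => -> _; rewrite -mulmxA TK mulmx0.
  have -> : (Sig *m x)^T *m K = 0.
    have -> : (Sig *m x)^T *m K = (Sig *m x)^T *m Bt *m invmx R0 *m (Bt^T *m Tht).
      by rewrite /K !mulmxA.
    have -> : (Sig *m x)^T *m Bt = (Ct *m x)^T.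
      by rewrite !trmx_mul tr_diag_mx -mulmxA SigBt.
    by rewrite hC trmx0 !mul0mx.
  by rewrite addr0.
have : (Sig *m x)^T = 0 by rewrite -[LHS](mulmxK uZ) eZ mul0mx.
move/(congr1 trmx); rewrite trmxK trmx0 => /(congr1 (mulmx Sigi)).
by rewrite mulmxA (mulmx1C SigK) mul1mx mulmx0.
Qed.

(** The columns of z = A^-1 Bc satisfy S P z = - z: the dissipation of P at z is
    the output energy - 2 z^T C^T = 0, so Th z = 0. *)
Lemma red_static : exists2 z : 'M[R]_(r + r, m), At *m z = Bt & Ct *m z = 0.
Proof.
pose z := col_mx (- (invmx G *m B)) 0 : 'M[R]_(n + n, m).
have Az : A *m z = Bc.
  by rewrite /z Asys_col !mulmx0 subr0 mulmxN opprK mulKVmx.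
have Cz : Bc^T *m z = 0.
  by rewrite /z /Bc /Bsys tr_col_mx mul_row_col trmx0 mul0mx mulmx0 addr0.
have Tz : Th *m z = 0.
  apply: psd_ker_mx => //; rewrite /Th mulmxN mulNmx mulmxDr mulmxDl.
  have BP : Bc^T *m P = Bc^T by rewrite -[in RHS]PB trmx_mul sP.
  have -> : z^T *m (A^T *m P) *m z = 0.
    by rewrite mulmxA -trmx_mul Az BP Cz.
  have -> : z^T *m (P *m A) *m z = 0.
    rewrite -!mulmxA Az PB -[z^T *m Bc]trmxK trmx_mul trmxK Cz.
    by rewrite trmx0.
  by rewrite addr0 oppr0.
have SPz : S *m (P *m z) = - z.
  apply/eqP; rewrite -addr_eq0; apply/eqP; apply: (@Asys_inj _ _ G D _ _ uG); rewrite mulmxDr.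
  rewrite Az; apply: (can_inj (@SmxK R n m)); rewrite mulmx0 mulmxDr SBc.
  rewrite mulmxA -AS -mulmxA SmxK.
  move: Tz; rewrite /Th mulNmx mulmxDl -!mulmxA Az PB => /eqP; rewrite oppr_eq0 => /eqP.
  by [].
have VWz : V *m (W *m z) = z.
  apply/matrixP => i j.
  have := keepN1 (w := col j z); rewrite !colE !mulmxA; rewrite !mulmxA in SPz.
  rewrite SPz mulNmx => /(_ erefl)/matrixP/(_ i 0).
  by rewrite -!colE !mxE.
exists (W *m z).
  by rewrite AtE -!mulmxA VWz Az BtE.
by rewrite CtE -mulmxA VWz Cz.
Qed.

End Reduced.

(** * Balancing and truncation *)

Section Expand.
Variable R : realType.
Implicit Types (s : nat -> R) (k : nat -> nat).

Lemma size_expand s k h : size (expand s k h) = (\sum_(1 <= j < h.+1) k j)%N.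
Proof.
rewrite /expand size_flatten /shape -map_comp sumnE big_map /index_iota subn1 /=.
by under eq_bigr do rewrite size_nseq.
Qed.

Lemma mem_expand s k h x : x \in expand s k h -> exists2 j, (1 <= j <= h)%N & x = s j.
Proof.
case/flattenP => t /mapP[j]; rewrite mem_iota add1n ltnS => hj ->.
by rewrite mem_nseq => /andP[_ /eqP ->]; exists j.
Qed.

Lemma expand_cat s k q h : (q <= h)%N -> exists2 rest,
  expand s k h = expand s k q ++ rest &
  forall x, x \in rest -> exists2 j, (1 <= j <= h - q)%N & x = s (q + j)%N.
Proof.
move=> qh; exists (flatten [seq nseq (k j) (s j) | j <- iota (1 + q) (h - q)]).
  by rewrite /expand -flatten_cat -map_cat -iotaD subnKC.
move=> x /flattenP[t /mapP[j]]; rewrite mem_iota => /andP[j1 j2] ->.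
rewrite mem_nseq => /andP[_ /eqP ->]; exists (j - q)%N.
  by rewrite subn_gt0 -add1n j1 leq_sub2r //; rewrite -addnA subnKC // add1n ltnS in j2.
by rewrite subnKC // (leq_trans _ j1) // leq_addl.
Qed.

Lemma graded_pos n s k h q j : graded n s k h -> (q <= h)%N -> 0 < s q -> (1 <= j <= q)%N ->
  0 < s j <= 1.
Proof.
move=> [_ _ dec bnd] qh sq /andP[j1 jq].
have /andP[_ ->] : 0 <= s j <= 1 by apply: bnd; rewrite j1 (leq_trans jq qh).
rewrite andbT; move: jq; rewrite leq_eqVlt => /orP[/eqP -> //|jq].
by apply: lt_trans sq _; apply: dec => //; rewrite jq.
Qed.

Lemma graded_dropped n s k h q j : graded n s k h -> (1 <= q <= h)%N -> (1 <= j <= h - q)%N ->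
  0 <= s (q + j)%N < 1.
Proof.
move=> [_ _ dec bnd] /andP[q1 qh] /andP[j1 jh].
have qjh : (q + j <= h)%N by rewrite -leq_subRL.
have /andP[-> _] /= : 0 <= s (q + j)%N <= 1.
  by apply: bnd; rewrite qjh andbT (leq_trans q1) // leq_addr.
have /andP[_ h1] : 0 <= s q <= 1 by apply: bnd; rewrite q1.
apply: lt_le_trans h1; apply: dec => //.
by rewrite qjh andbT -[ltnLHS]addn0 ltn_add2l.
Qed.

End Expand.

Section InvSqrt.
Variables (R : realType) (r : nat) (d : 'rV[R]_(r + r)).
Hypothesis d0 : forall i, 0 < d 0 i.

Lemma invsqrt_diag_Smx : invsqrt_diag d *m Smx R r = Smx R r *m invsqrt_diag d.
Proof. by rewrite /invsqrt_diag Smx_diag diag_mxC. Qed.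

Lemma invsqrt_diag_sqr p (y : 'M[R]_(r + r, p)) i j :
  (invsqrt_diag d *m (invsqrt_diag d *m y)) i j = (d 0 i)^-1 * y i j.
Proof.
by rewrite !mul_diag_mx !mxE mulrA -expr2 exprVn sqr_sqrtr ?ltW.
Qed.

Lemma invsqrt_diag_sandwich :
  invsqrt_diag d *m (Smx R r *m diag_mx d) *m invsqrt_diag d = Smx R r.
Proof.
rewrite -!mulmxA /invsqrt_diag diag_mxC -/(invsqrt_diag d) (mulmxA _ (Smx R r)).
rewrite invsqrt_diag_Smx -mulmxA -[RHS]mulmx1; congr (_ *m _).
apply/matrixP => i j; rewrite invsqrt_diag_sqr !mxE.
by case: eqP => _; rewrite ?mulr0 // !mulr1n mulVf // gt_eqF.
Qed.

End InvSqrt.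

Section Selection.
Variables (R : realType) (n r : nat).
Hypothesis rn : (r <= n)%N.

Lemma keep_index_proof (j : 'I_r) : (n - r + j < n)%N.
Proof. by rewrite -[ltnRHS](subnK rn) ltn_add2l. Qed.

(** The retained eigenvectors are the first r of negative type and the last r of
    positive type. *)
Definition keep_index (k : 'I_(r + r)) : 'I_(n + n) :=
  match split k with
  | inl j => lshift n (widen_ord rn j)
  | inr j => rshift n (Ordinal (keep_index_proof j))
  end.

Lemma keep_index_l j : keep_index (lshift r j) = lshift n (widen_ord rn j).
Proof. by rewrite /keep_index (unsplitK (inl j)). Qed.

Lemma keep_index_r j : keep_index (rshift r j) = rshift n (Ordinal (keep_index_proof j)).
Proof. by rewrite /keep_index (unsplitK (inr j)). Qed.

Lemma keep_index_inj : injective keep_index.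
Proof.
move=> a b; rewrite -[a]splitK -[b]splitK; case: (split a) => i; case: (split b) => j /=;
  rewrite ?keep_index_l ?keep_index_r.
- by move/lshift_inj/(congr1 val) => /= e; congr lshift; apply: val_inj.
- by move/eqP; rewrite eq_lrshift.
- by move/eqP; rewrite eq_rlshift.
- by move/rshift_inj/(congr1 val) => /= /addnI e; congr rshift; apply: val_inj.
Qed.

Lemma trunc_basisE (U : 'M[R]_(n + n)) : trunc_basis r U = colsub keep_index U.
Proof.
rewrite /trunc_basis; apply/matrixP => i k; rewrite -[k]splitK.
case: (split k) => j /=; rewrite ?row_mxEl ?row_mxEr [RHS]mxE ?keep_index_l ?keep_index_r.
  rewrite mxE; case: insubP => [j' _ ej|]; last by rewrite (leq_trans (ltn_ord j) rn).
  by rewrite /= mxE; congr (U i (lshift _ _)); apply: val_inj.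
rewrite mxE; case: insubP => [j' _ ej|]; last by rewrite keep_index_proof.
by rewrite /= mxE; congr (U i (rshift _ _)); apply: val_inj.
Qed.

Lemma dropped_index (k : 'I_(n + n)) : k \notin codom keep_index ->
  (exists2 j : 'I_n, k = lshift n j & (r <= j)%N) \/
  (exists2 j : 'I_n, k = rshift n j & (j < n - r)%N).
Proof.
rewrite -[k]splitK; case: (split k) => j /= hk; [left|right]; exists j => //.
  rewrite leqNgt; apply/negP => jr; case/negP: hk; apply/codomP.
  by exists (lshift r (Ordinal jr)); rewrite keep_index_l; congr lshift; apply: val_inj.
rewrite ltnNge; apply/negP => jr; case/negP: hk; apply/codomP.
have jr' : (j - (n - r) < r)%N by rewrite ltn_subLR // subnK.
exists (rshift r (Ordinal jr')); rewrite keep_index_r; congr rshift; apply: val_inj => /=.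
by rewrite subnKC.
Qed.

Variables (sm sp : nat -> R) (km kp : nat -> nat) (hm hp qm qp : nat).
Hypotheses (gm : graded n sm km hm) (gp : graded n sp kp hp).
Hypothesis adm : admissible sm sp hm hp qm qp.
Hypotheses (rm : (\sum_(1 <= j < qm.+1) km j = r)%N) (rp : (\sum_(1 <= j < qp.+1) kp j = r)%N).

Let dn := sigma_row n sm sp km kp hm hp.
Let dr := sigma_row r sm sp km kp qm qp.

Let qmh : (qm <= hm)%N. Proof. by case: adm => [[/andP[]]]. Qed.
Let qph : (qp <= hp)%N. Proof. by case: adm => [[_ /andP[]]]. Qed.

Lemma sz_hm : size (expand sm km hm) = n. Proof. by rewrite size_expand; case: gm. Qed.
Lemma sz_hp : size (expand sp kp hp) = n. Proof. by rewrite size_expand; case: gp. Qed.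
Lemma sz_qm : size (expand sm km qm) = r. Proof. by rewrite size_expand. Qed.
Lemma sz_qp : size (expand sp kp qp) = r. Proof. by rewrite size_expand. Qed.

Lemma sigma_rowl N s1 s2 k1 k2 h1 h2 (j : 'I_N) :
  sigma_row N s1 s2 k1 k2 h1 h2 0 (lshift N j) = (expand s1 k1 h1)`_j :> R.
Proof. by rewrite /sigma_row row_mxEl mxE. Qed.

Lemma sigma_rowr N s1 s2 k1 k2 h1 h2 (j : 'I_N) :
  sigma_row N s1 s2 k1 k2 h1 h2 0 (rshift N j) = (rev (expand s2 k2 h2))`_j :> R.
Proof. by rewrite /sigma_row row_mxEr mxE. Qed.

Lemma sigma_keep k : dn 0 (keep_index k) = dr 0 k.
Proof.
rewrite -[k]splitK; case: (split k) => j /=.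
  rewrite keep_index_l !sigma_rowl; have [rest -> _] := expand_cat sm km qmh.
  by rewrite nth_cat sz_qm /= ltn_ord.
rewrite keep_index_r !sigma_rowr; have [rest e _] := expand_cat sp kp qph.
have sr : size rest = (n - r)%N by rewrite -sz_hp e size_cat sz_qp addKn.
by rewrite e rev_cat nth_cat size_rev sr /= ltnNge leq_addr /= addKn.
Qed.

Lemma sigma_kept k :
  (exists2 j, (1 <= j <= qm)%N & dr 0 k = sm j) /\ (exists j, k = lshift r j) \/
  (exists2 j, (1 <= j <= qp)%N & dr 0 k = sp j) /\ (exists j, k = rshift r j).
Proof.
rewrite -[k]splitK; case: (split k) => j /=; [left|right]; (split; last by exists j).
  rewrite /dr sigma_rowl; have [|i hi ->] := @mem_expand _ sm km qm (expand sm km qm)`_j.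
    by rewrite mem_nth ?sz_qm.
  by exists i.
rewrite /dr sigma_rowr; have [|i hi ->] := @mem_expand _ sp kp qp (rev (expand sp kp qp))`_j.
  by rewrite -mem_rev mem_nth ?size_rev ?sz_qp.
by exists i.
Qed.

(** The retained values are a prefix of each list; the list for the positive
    type is stored in reverse order. *)
Lemma sigma_dropped k : k \notin codom keep_index ->
  (exists2 i, (1 <= i <= hm - qm)%N & dn 0 k = sm (qm + i)%N) /\ (exists j, k = lshift n j) \/
  (exists2 i, (1 <= i <= hp - qp)%N & dn 0 k = sp (qp + i)%N) /\ (exists j, k = rshift n j).
Proof.
move/dropped_index => [] [j -> hj]; [left|right]; (split; last by exists j).
  rewrite /dn sigma_rowl; have [rest e he] := expand_cat sm km qmh.
  apply: he; have sr : (size rest + r)%N = n by rewrite -sz_hm e size_cat sz_qm addnC.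
  rewrite e nth_cat sz_qm ltnNge hj /=.
  by rewrite mem_nth // ltn_subLR // addnC sr.
rewrite /dn sigma_rowr; have [rest e he] := expand_cat sp kp qph.
have sr : size rest = (n - r)%N by rewrite -sz_hp e size_cat sz_qp addKn.
apply: he; rewrite e rev_cat nth_cat size_rev sr hj.
by rewrite -mem_rev mem_nth // size_rev sr.
Qed.

Lemma sigma_kept_bnd k : 0 < dr 0 k <= 1.
Proof.
case: adm => [_ [s1 s2] _ _].
case: (sigma_kept k) => [[[j hj ->] _]|[[j hj ->] _]].
  exact: (graded_pos gm qmh s1 hj).
exact: (graded_pos gp qph s2 hj).
Qed.

Let sgn N : 'rV[R]_(N + N) := row_mx (const_mx (-1)) (const_mx 1).

Lemma sgn_l N j : sgn N 0 (lshift N j) = -1. Proof. by rewrite row_mxEl mxE. Qed.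
Lemma sgn_r N j : sgn N 0 (rshift N j) = 1. Proof. by rewrite row_mxEr mxE. Qed.

Lemma sgn_keep k : sgn n 0 (keep_index k) = sgn r 0 k.
Proof.
rewrite -[k]splitK; case: (split k) => j /=.
  by rewrite keep_index_l !sgn_l.
by rewrite keep_index_r !sgn_r.
Qed.

Lemma dropped_ne1 k : k \notin codom keep_index ->
  sgn n 0 k * dn 0 k != 1 /\ sgn n 0 k * dn 0 k != -1.
Proof.
case: adm => [[a1 a2] _ _ _].
case/sigma_dropped => [[[i hi ->] [j ->]]|[[i hi ->] [j ->]]].
  have := graded_dropped gm a1 hi; rewrite sgn_l => h.
  by split; apply/eqP; lra.
have := graded_dropped gp a2 hi; rewrite sgn_r => h.
by split; apply/eqP; lra.
Qed.

Lemma dropped_ne_opp k l : k \notin codom keep_index ->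
  sgn n 0 k * dn 0 k != - (sgn r 0 l * dr 0 l).
Proof.
case: adm => [[a1 a2] _ a3 a4] hk; have lb := sigma_kept_bnd l.
case: (sigma_dropped hk) => [[[i hi ->] [j ->]]|[[i hi ->] [j ->]]].
  have b := graded_dropped gm a1 hi; rewrite sgn_l.
  move: lb; case: (sigma_kept l) => [[[a ha ->] [b' ->]]|[[a ha ->] [b' ->]]] lb.
    by rewrite sgn_l; apply/eqP; lra.
  by rewrite sgn_r; have := a3 a i ha hi; apply: contra => /eqP h; apply/eqP; lra.
have b := graded_dropped gp a2 hi; rewrite sgn_r.
move: lb; case: (sigma_kept l) => [[[a ha ->] [b' ->]]|[[a ha ->] [b' ->]]] lb.
  by rewrite sgn_l; have := a4 a i ha hi; apply: contra => /eqP h; apply/eqP; lra.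
by rewrite sgn_r; apply/eqP; lra.
Qed.

Variables (P L U : 'M[R]_(n + n)).
Hypotheses (PL : P = L^T *m L) (UU : U^T *m U = 1%:M).
Hypothesis eig : L *m Smx R n *m L^T = U *m Smx R n *m diag_mx dn *m U^T.

Let S := Smx R n.
Let Sr := Smx R r.
Let Sig := diag_mx dr.
Let V := projV L U dr.
Let W := (projW L U dr)^T.
Let U1 := trunc_basis r U.
Let isd := invsqrt_diag dr.
Let sg k := sgn n 0 k * dn 0 k.

Lemma isd_tr : isd^T = isd. Proof. by rewrite /isd /invsqrt_diag tr_diag_mx. Qed.

Lemma VE : V = S *m (L^T *m U1 *m isd).
Proof. by rewrite /V /projV !mulmxA. Qed.

Lemma isd_Sr : isd *m Sr = Sr *m isd.
Proof. exact: invsqrt_diag_Smx. Qed.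

Lemma proj_WE : W = Sr *m V^T *m S.
Proof.
rewrite /W /projW trmxK VE trmx_mul Smx_tr -!mulmxA Smx_mul mulmx1.
by rewrite !trmx_mul trmxK isd_tr !mulmxA -isd_Sr.
Qed.

Lemma eigM : L *m S *m L^T *m U = U *m diag_mx (\row_k sg k).
Proof.
rewrite eig -!mulmxA UU mulmx1; congr (_ *m _).
by rewrite Smx_diag mulmx_diag.
Qed.

Lemma eigM1 : L *m S *m L^T *m U1 = U1 *m (Sr *m Sig).
Proof.
rewrite /U1 trunc_basisE.
have -> : L *m S *m L^T *m colsub keep_index U = colsub keep_index (L *m S *m L^T *m U).
  by apply/matrixP => i j; rewrite !mxE; apply: eq_bigr => k _; rewrite !mxE.
rewrite eigM /Sr Smx_diag /Sig mulmx_diag; apply/matrixP => i j.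
rewrite [LHS]mxE mul_mx_diag [LHS]mxE mul_mx_diag [RHS]mxE.
rewrite [X in _ * X = _]mxE [X in _ = X * _]mxE [X in _ = _ * X]mxE.
by rewrite /sg sgn_keep sigma_keep.
Qed.

Lemma U1U1 : U1^T *m U1 = 1%:M.
Proof.
have -> : U1^T *m U1 = mxsub keep_index keep_index (U^T *m U).
  by apply/matrixP => i j; rewrite /U1 trunc_basisE !mxE; apply: eq_bigr => k _; rewrite !mxE.
by rewrite UU; apply/matrixP => i j; rewrite !mxE (inj_eq keep_index_inj).
Qed.

Lemma proj_VSV : V^T *m S *m V = Sr.
Proof.
rewrite VE trmx_mul Smx_tr -[_ *m S *m S]mulmxA Smx_mul mulmx1.
rewrite !trmx_mul trmxK isd_tr.
have -> : isd *m (U1^T *m L) *m (S *m (L^T *m U1 *m isd)) =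
    isd *m (U1^T *m (L *m S *m L^T *m U1)) *m isd by rewrite !mulmxA.
rewrite eigM1 (mulmxA U1^T) U1U1 mul1mx.
by apply: invsqrt_diag_sandwich => i; case/andP: (sigma_kept_bnd i).
Qed.

Lemma proj_PV : P *m V = S *m V *m Sr *m Sig.
Proof.
have -> : S *m V = L^T *m U1 *m isd by rewrite VE SmxK.
have -> : P *m V = L^T *m (L *m S *m L^T *m U1) *m isd by rewrite VE PL !mulmxA.
rewrite eigM1; rewrite -!mulmxA; congr (_ *m (_ *m _)).
by rewrite [RHS]mulmxA isd_Sr -[RHS]mulmxA; congr (_ *m _); apply: diag_mxC.
Qed.

(** In the orthonormal basis U the vector L w is an eigenvector of S Sigma to mu,
    so its coordinates vanish at the discarded indices. *)
Lemma proj_keep mu (w : 'cV[R]_(n + n)) : mu != 0 ->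
  (forall k, k \notin codom keep_index -> sg k != mu) ->
  S *m (P *m w) = mu *: w -> V *m (W *m w) = w.
Proof.
move=> mu0 hmu hw; pose y := U^T *m (L *m w).
have UUt := mulmx1C UU.
have LL : L^T *m (L *m w) = P *m w by rewrite PL mulmxA.
have yE k : sg k * y k 0 = mu * y k 0.
  have h : U *m diag_mx (\row_k sg k) *m U^T *m (L *m w) = mu *: (L *m w).
    rewrite -eigM -!mulmxA (mulmxA U) UUt mul1mx.
    by rewrite LL hw -scalemxAr.
  have h2 : diag_mx (\row_k sg k) *m y = mu *: y.
    by have := congr1 (mulmx U^T) h; rewrite -scalemxAr /y !mulmxA UU mul1mx.
  have := congr1 (fun M : 'cV_(n + n) => M k 0) h2.
  by rewrite mul_diag_mx [LHS]mxE [RHS]mxE [X in X * _ = _]mxE.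
have y0 k : k \notin codom keep_index -> y k 0 = 0.
  move=> hk; have := yE k; move/eqP; rewrite -subr_eq0 -mulrBl mulf_eq0 subr_eq0.
  by rewrite (negbTE (hmu _ hk)) /= => /eqP.
pose y1 : 'cV[R]_(r + r) := \col_j y (keep_index j) 0.
have U1y : U1 *m y1 = L *m w.
  have -> : L *m w = U *m y by rewrite /y mulmxA UUt mul1mx.
  apply/colP => i; rewrite [LHS]mxE [RHS]mxE.
  rewrite [RHS](bigID (mem (codom keep_index))) /= [X in _ + X]big1 ?addr0; last first.
    by move=> k /y0 ->; rewrite mulr0.
  rewrite (eq_bigl (mem [set keep_index j | j in [set: 'I_(r + r)]])); last first.
    move=> k; rewrite !inE; apply/codomP/imsetP => [[j ->]|[j _ ->]]; by exists j.
  rewrite big_imset /=; last by move=> a b _ _; exact: keep_index_inj.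
  by apply: eq_big => [j|j _]; rewrite ?inE // /U1 trunc_basisE !mxE.
have U1w : U1^T *m (L *m w) = y1 by rewrite -U1y mulmxA U1U1 mul1mx.
have -> : V *m (W *m w) = S *m (L^T *m (U1 *m (isd *m (isd *m (Sr *m y1))))).
  by rewrite -U1w VE /W /projW trmxK -/U1 -/isd -/Sr !mulmxA.
have -> : isd *m (isd *m (Sr *m y1)) = mu^-1 *: y1.
  have d0 i : 0 < dr 0 i by case/andP: (sigma_kept_bnd i).
  apply/colP => j; rewrite invsqrt_diag_sqr // [RHS]mxE.
  have -> : (Sr *m y1) j 0 = sgn r 0 j * y1 j 0 by rewrite /Sr Smx_diag mul_diag_mx mxE.
  have := yE (keep_index j); rewrite /sg sgn_keep sigma_keep.
  rewrite [y1 j 0]mxE; set a := y _ _; have [->|a0] := eqVneq a 0; first by rewrite !mulr0.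
  move/(mulIf a0) <-; rewrite mulrA; congr (_ * _); rewrite invfM mulrC; congr (_ * _).
  rewrite -[j]splitK; case: (split j) => i /=; rewrite ?sgn_l ?sgn_r ?invr1 //.
  by rewrite invrN invr1.
rewrite -!scalemxAr U1y LL hw scalerA mulVf // scale1r.
by [].
Qed.

End Selection.

(** * Existence of a second order realization *)

Section FieldPencil.
Variables (F : fieldType) (r m : nat) (M D K : 'M[F]_r) (B : 'M[F]_(r, m)) (s : F).

(** The pencil s symE - symF is a symmetric linearization of s^2 M + s D + K,
    provided that K is invertible. *)
Definition symE : 'M[F]_(r + r) := block_mx (- K) 0 0 M.
Definition symF : 'M[F]_(r + r) := block_mx 0 (- K) (- K) (- D).
Let Pn := s *: symE - symF.
Let Q := s ^+ 2 *: M + s *: D + K.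

Lemma symPencilE : Pn = block_mx (- (s *: K)) K K (s *: M + D).
Proof.
rewrite /Pn /symE /symF scale_block_mx opp_block_mx add_block_mx !scaler0 !opprK !add0r.
by rewrite oppr0 addr0 scalerN.
Qed.

(** The pencil is the linearization with state (p, s p). *)
Lemma symPencil_second_order : Q \in unitmx -> Pn \in unitmx ->
  row_mx 0 B^T *m invmx Pn *m col_mx 0 B = s *: (B^T *m invmx Q *m B).
Proof.
move=> uQ uP; pose y := col_mx (invmx Q *m B) (s *: (invmx Q *m B)).
have Py : Pn *m y = col_mx 0 B.
  rewrite symPencilE mul_block_col; congr col_mx.
    by rewrite mulNmx -scalemxAl -scalemxAr addNr.
  rewrite -scalemxAr mulmxDl -scalemxAl scalerDr scalerA -expr2 addrC -addrA.
  rewrite scalemxAl [X in _ + (X + _)]scalemxAl -!mulmxDl addrA.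
  by rewrite mulmxA mulmxV // mul1mx.
rewrite -mulmxA -Py mulKmx // mul_row_col mul0mx add0r -scalemxAr.
by rewrite mulmxA.
Qed.

Lemma second_order_unit : Pn \in unitmx -> Q \in unitmx.
Proof.
move=> uP; rewrite -row_free_unit -kermx_eq0; apply/eqP/row_matrixP => i; rewrite row0.
set u := row i _; have uQ : u *m Q = 0 by apply: (sub_kermxP (row_sub _ _)).
have : row_mx u (s *: u) *m Pn = 0.
  rewrite symPencilE mul_row_block mulmxN -scalemxAr -scalemxAl addNr.
  rewrite mulmxDr -!scalemxAr -!scalemxAl scalerA -expr2.
  have -> : u *m K + (s ^+ 2 *: (u *m M) + s *: (u *m D)) = u *m Q.
    by rewrite /Q !mulmxDr -!scalemxAr addrC.
  by rewrite uQ row_mx0.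
move/(congr1 (mulmx^~ (invmx Pn))); rewrite mulmxK // mul0mx -[0 in X in _ = X]row_mx0.
by case/eq_row_mx.
Qed.

End FieldPencil.

Section Congruence.
Variables (R F : fieldType) (io : {rmorphism R -> F}) (s : F).
Let fc p q (A : 'M[R]_(p, q)) : 'M[F]_(p, q) := map_mx io A.

(** A congruence of pencils that respects the input also respects the output,
    because Ct = Bt^T S. *)
Lemma congruence_transfer r m (A T S : 'M[R]_(r + r)) (Bt : 'M[R]_(r + r, m))
    (M D K : 'M[R]_r) (B2 : 'M[R]_(r, m)) :
  T \in unitmx -> S^T = S -> S \in unitmx ->
  T^T *m S *m T = symE M K -> T^T *m (S *m A) *m T = symF D K ->
  T^T *m S *m Bt = col_mx 0 B2 ->
  s%:M - fc A \in unitmx ->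
  let Q : 'M[F]_r := s ^+ 2 *: fc M + s *: fc D + fc K in
  Q \in unitmx /\
  fc (Bt^T *m S) *m invmx (s%:M - fc A) *m fc Bt =
  s *: (fc B2^T *m invmx Q *m fc B2).
Proof.
move=> uT sS uS hE hF hB uRes Q.
pose Pn := s *: symE (fc M) (fc K) - symF (fc D) (fc K).
have ufT : fc T \in unitmx by rewrite map_unitmx.
have ufS : fc S \in unitmx by rewrite map_unitmx.
have PnE : Pn = (fc T)^T *m fc S *m (s%:M - fc A) *m fc T.
  rewrite mulmxBr mulmxBl mul_mx_scalar -scalemxAl /fc map_trmx -!map_mxM hE.
  have -> : T^T *m S *m A *m T = symF D K by rewrite -hF !mulmxA.
  by rewrite /symE /symF !map_block_mx !map_mxN !map_mx0.
have uPn : Pn \in unitmx by rewrite PnE !unitmx_mul unitmx_tr ufT ufS uRes.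
have uQ : Q \in unitmx.
  by apply: second_order_unit uPn.
split=> //.
have BT : fc B2^T = (fc B2)^T by rewrite /fc map_trmx.
rewrite BT -(symPencil_second_order (fc B2) uQ uPn).
have -> : col_mx 0 (fc B2) = (fc T)^T *m fc S *m fc Bt.
  by rewrite /fc map_trmx -!map_mxM hB map_col_mx map_mx0.
have -> : row_mx 0 (fc B2)^T = fc (Bt^T *m S) *m fc T.
  rewrite /fc -map_mxM -[RHS]trmxK -[LHS]trmxK; congr trmx.
  by rewrite tr_row_mx trmx0 trmxK map_trmx !trmx_mul trmxK sS mulmxA hB map_col_mx map_mx0.
rewrite -!mulmxA; congr (_ *m _).
rewrite -[LHS](mulKVmx ufT); congr (_ *m _).
rewrite -[LHS](mulKmx uPn); congr (_ *m _).
rewrite PnE -!mulmxA; congr (_ *m (_ *m _)).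
by rewrite mulKVmx // mulKVmx.
Qed.

End Congruence.

Section Transfer.
Variable R : realType.

Let io : {rmorphism R -> {fraction {poly R}}} :=
  (@tofrac {poly R}) \o polyC.

Lemma fmx_pmx p q (A : 'M[R]_(p, q)) : fmx (pmx A) = map_mx io A.
Proof. by apply/matrixP => i j; rewrite !mxE. Qed.

Lemma fmx_resolvent N (A : 'M[R]_N) : fmx ('X%:M - pmx A) = (tofrac 'X)%:M - map_mx io A.
Proof. by rewrite -fmx_pmx /fmx map_mxB map_scalar_mx. Qed.

Lemma resolvent_unit N (A : 'M[R]_N) : fmx ('X%:M - pmx A) \in unitmx.
Proof.
rewrite unitmxE /fmx det_map_mx unitfE tofrac_eq0.
exact: monic_neq0 (char_poly_monic A).
Qed.

Lemma fmx_quadratic r (M D K : 'M[R]_r) :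
  fmx ('X^2 *: pmx M + 'X *: pmx D + pmx K) =
  tofrac 'X ^+ 2 *: map_mx io M + tofrac 'X *: map_mx io D + map_mx io K.
Proof. by rewrite -!fmx_pmx /fmx !map_mxD !map_mxZ rmorphXn. Qed.

Lemma realization_of_congruence r m (A T : 'M[R]_(r + r)) (Bt : 'M[R]_(r + r, m))
    (M D K : 'M[R]_r) (B2 : 'M[R]_(r, m)) :
  T \in unitmx ->
  T^T *m Smx R r *m T = symE M K -> T^T *m (Smx R r *m A) *m T = symF D K ->
  T^T *m Smx R r *m Bt = col_mx 0 B2 ->
  second_order_realization (transfer A Bt (Bt^T *m Smx R r)) M D K B2.
Proof.
move=> uT hE hF hB.
have uS : Smx R r \in unitmx by have [h _] := mulmx1_unit (Smx_mul R r).
have uRes := resolvent_unit A; rewrite fmx_resolvent in uRes.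
have := congruence_transfer uT (Smx_tr R r) uS hE hF hB uRes.
rewrite /second_order_realization /transfer fmx_quadratic fmx_resolvent !fmx_pmx.
exact.
Qed.

End Transfer.

Section Similarity.
Variables (R : realType) (r : nat).

Lemma canonical_similarity (A T : 'M[R]_(r + r)) (lm lp : 'rV[R]_r) :
  T^T *m Smx R r *m T = Smx R r ->
  T^T *m (Smx R r *m A) *m T = block_mx (- diag_mx lm) 0 0 (diag_mx lp) ->
  A *m T = T *m block_mx (diag_mx lm) 0 0 (diag_mx lp).
Proof.
move=> TS TA; pose S := Smx R r.
have Ti1 : (S *m T^T *m S) *m T = 1%:M by rewrite -!mulmxA [X in S *m X]mulmxA TS Smx_mul.
have Ti2 := mulmx1C Ti1.
have -> : block_mx (diag_mx lm) 0 0 (diag_mx lp) = S *m (T^T *m (S *m A) *m T).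
  rewrite TA /S /Smx mulmx_block !mulmx0 !mul0mx !addr0 !add0r.
  by rewrite mulNmx mulmxN opprK !mul1mx.
rewrite -[LHS]mul1mx -Ti2 !mulmxA //.
Qed.

End Similarity.

Section Existence.
Variables (R : realType) (r m : nat) (A : 'M[R]_(r + r)) (Bt z : 'M[R]_(r + r, m)) (g : R).
Let S := Smx R r.
Hypothesis sA : (S *m A)^T = S *m A.
Hypothesis g0 : g < 0.
Hypothesis neg : forall x, x != 0 -> bf (S *m A) x x < g * bf S x x.
Hypothesis stable : forall (x : 'cV_(r + r)) (l : R), A *m x = l *: x -> 0 <= l -> x = 0.
Hypothesis Az : A *m z = Bt.
Hypothesis Cz : Bt^T *m S *m z = 0.

(** In canonical coordinates the form S A is diag (- lm, lp) with lm, lp < 0, and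
    z has components f and h with f^T (- lm) f = h^T (- lp) h as C z = 0.  An
    orthogonal Q extending the isometry between the rescaled components gives
    the graph X of Phi = (- lp)^(-1/2) Q (- lm)^(1/2), on which S A vanishes and
    which contains z. *)
Lemma neutral_complement : exists (X : 'M[R]_(r + r, r)) (f : 'M[R]_(r, m)),
  [/\ forall x : 'cV_r, X *m x = 0 -> x = 0, X^T *m (S *m A) *m X = 0 & z = X *m f].
Proof.
have [T [lm [lp [TS TA lmg lpg _]]]] := hyperbolic_canonical sA neg.
have Ti1 : (S *m T^T *m S) *m T = 1%:M by rewrite -!mulmxA [X in S *m X]mulmxA TS Smx_mul.
have Ti2 := mulmx1C Ti1.
have AT := canonical_similarity TS TA.
have lm0 i : lm 0 i < 0.
  rewrite ltNge; apply/negP => h.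
  pose e : 'cV[R]_(r + r) := col_mx (delta_mx i 0) 0.
  have Te : T *m e = 0.
    apply: (stable _ h); rewrite mulmxA AT -mulmxA /e mul_block_col !mul0mx !mulmx0 !addr0.
    rewrite scalemxAr; congr (_ *m _).
    rewrite scale_col_mx scaler0; congr col_mx; apply/colP => k.
    rewrite mul_diag_mx !mxE; case: eqP => [->|_] //; by rewrite !mulr0.
  have : e = 0 by rewrite -[e]mul1mx -Ti1 -mulmxA Te mulmx0.
  move/matrixP/(_ (lshift r i) 0); rewrite /e col_mxEu !mxE !eqxx => /eqP.
  by rewrite oner_eq0.
have lp0 i : lp 0 i < 0 by apply: lt_trans (lpg i) g0.
pose y := S *m T^T *m S *m z; have zy : z = T *m y by rewrite /y mulmxA Ti2 mul1mx.
pose f := usubmx y; pose h := dsubmx y.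
have dN (l : 'rV[R]_r) : diag_mx (- l) = - diag_mx l by rewrite linearN.
have gram : f^T *m diag_mx (- lm) *m f = h^T *m diag_mx (- lp) *m h.
  have : z^T *m (S *m A) *m z = 0.
    have -> : z^T *m (S *m A) *m z = (Bt^T *m S *m z)^T.
      by rewrite -!mulmxA Az !trmx_mul trmxK Smx_tr mulmxA.
    by rewrite Cz trmx0.
  have -> : z^T *m (S *m A) *m z = y^T *m (T^T *m (S *m A) *m T) *m y.
    by rewrite zy trmx_mul !mulmxA.
  rewrite TA -[y]vsubmxK -/f -/h tr_col_mx mul_row_block mul_row_col !mulmx0 addr0 add0r.
  move=> e0; rewrite !dN [h^T *m _]mulmxN [in RHS]mulNmx; apply/eqP.
  by rewrite -addr_eq0 e0.
pose rt (l : 'rV[R]_r) := diag_mx (\row_i Num.sqrt (- l 0 i)).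
have rt2 (l : 'rV[R]_r) : (forall i, l 0 i < 0) -> rt l *m rt l = diag_mx (- l).
  move=> l0; rewrite /rt mulmx_diag; congr diag_mx; apply/rowP => i.
  by rewrite !mxE -expr2 sqr_sqrtr // oppr_ge0 ltW.
have rtT (l : 'rV[R]_r) : (rt l)^T = rt l by rewrite /rt tr_diag_mx.
have [|Q QQ hQ] := @orth_extend R r m (rt lm *m f) (rt lp *m h).
  rewrite !trmx_mul !rtT.
  rewrite -!mulmxA !(mulmxA (rt _)) (rt2 _ lm0) (rt2 _ lp0) !mulmxA.
  exact: gram.
have urt : rt lp \in unitmx.
  have : rt lp *m rt lp \in unitmx.
    rewrite rt2 // unitmxE det_diag unitfE prodf_seq_neq0; apply/allP => i _ /=.
    by rewrite mxE oppr_eq0 lt_eqF.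
  by rewrite unitmx_mul => /andP[].
pose Phi := invmx (rt lp) *m Q *m rt lm.
have Phif : Phi *m f = h by rewrite /Phi -!mulmxA hQ mulKmx.
pose C : 'M[R]_(r + r, r) := col_mx 1%:M Phi.
exists (T *m C), f; split.
- move=> x hx; have : C *m x = 0 by rewrite -[C *m x]mul1mx -Ti1 -mulmxA (mulmxA T) hx mulmx0.
  by rewrite /C mul_col_mx mul1mx -[X in _ = X]col_mx0 => /eq_col_mx[].
- have -> : (T *m C)^T *m (S *m A) *m (T *m C) = C^T *m (T^T *m (S *m A) *m T) *m C.
    by rewrite trmx_mul !mulmxA.
  rewrite TA /C tr_col_mx trmx1 mul_row_block mul_row_col !mulmx0 addr0 add0r mul1mx mulmx1.
  have -> : diag_mx lp = - (rt lp *m rt lp) by rewrite rt2 // dN opprK.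
  have e3 (Z1 Z2 : 'M[R]_r) : Z1^T = Z1 -> Z2^T *m - (Z1 *m Z1) *m Z2 = - ((Z1 *m Z2)^T *m (Z1 *m Z2)).
    by move=> sZ; rewrite trmx_mul sZ mulmxN mulNmx !mulmxA.
  rewrite e3 ?rtT //.
  have -> : rt lp *m Phi = Q *m rt lm by rewrite /Phi -mulmxA mulKVmx.
  rewrite trmx_mul rtT -mulmxA (mulmxA Q^T) QQ mul1mx rt2 // dN.
  by rewrite opprK addNr.
- rewrite zy -mulmxA /C mul_col_mx mul1mx Phif /f /h vsubmxK //.
Qed.

(** The columns of X play the role of positions and those of A X the role of
    velocities: they are S-orthogonal because S A vanishes on X, S is negative
    on X because g < 0, hence positive on A X.  The factor - K0^-1 M rescales
    the positions so that both blocks of the pencil agree. *)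
Theorem second_order_exists : exists (M D K : 'M[R]_r) (B2 : 'M[R]_(r, m)),
  [/\ M^T = M, D^T = D, K^T = K &
    second_order_realization (transfer A Bt (Bt^T *m S)) M D K B2].
Proof.
have [X [f [Xinj XX zX]]] := neutral_complement.
have Ainj (x : 'cV_(r + r)) : A *m x = 0 -> x = 0.
  by move=> h; apply: (@stable _ 0); rewrite ?h ?scale0r.
have ATS : A^T *m S = S *m A by rewrite -sA trmx_mul Smx_tr.
pose K0 := - (X^T *m S *m X).
pose Y := A *m X.
pose M := Y^T *m S *m Y.
pose H := Y^T *m (S *m A) *m Y.
have sS : S^T = S by exact: Smx_tr.
have sM : M^T = M by apply: sym_congr.
have sH : H^T = H by apply: sym_congr.
have sK0 : K0^T = K0 by rewrite /K0 linearN /= sym_congr.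
have pK0 : pdmx K0.
  split=> // x x0; rewrite -/(bf _ _ _) /K0 bfN bf_congr oppr_gt0.
  have X0 : X *m x != 0 by apply: contra x0 => /eqP/Xinj ->.
  have e0 : bf (S *m A) (X *m x) (X *m x) = 0 by rewrite -bf_congr XX bf0.
  by have := neg X0; rewrite e0 nmulr_rgt0.
have uK0 := pd_unit pK0.
have XSY : X^T *m S *m Y = 0 by rewrite /Y -mulmxA (mulmxA S) mulmxA.
have YSX : Y^T *m S *m X = 0.
  by rewrite -(tr_congr X Y sS) XSY trmx0.
pose T0 := row_mx X Y.
have T0S : T0^T *m S *m T0 = block_mx (- K0) 0 0 M.
  by rewrite /T0 tr_row_mx mul_col_mx mul_col_row XSY YSX /K0 opprK.
have T0inj (x : 'cV_(r + r)) : T0 *m x = 0 -> x = 0.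
  rewrite -[x]vsubmxK; set a := usubmx x; set b := dsubmx x.
  rewrite /T0 mul_row_col => h.
  have a0 : a = 0.
    have : K0 *m a = 0.
      have : X^T *m S *m (X *m a + Y *m b) = 0 by rewrite h mulmx0.
      rewrite mulmxDr (mulmxA _ X a) (mulmxA _ Y b) XSY mul0mx addr0 => e.
      by rewrite /K0 mulNmx e oppr0.
    by move=> e; rewrite -[a](mulKmx uK0) e mulmx0.
  have b0 : b = 0.
    by apply: Xinj; apply: Ainj; rewrite mulmxA -/Y; move: h; rewrite a0 mulmx0 add0r.
  by rewrite a0 b0 col_mx0.
have pM : pdmx M.
  split=> // v v0; apply: (complement_pos T0inj T0S) => // x; by case: pK0 => _; apply.
have uM := pd_unit pM.
pose N := invmx K0 *m M.
have NT : N^T = M *m invmx K0 by rewrite /N trmx_mul sM trmx_inv sK0.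
pose K := M *m invmx K0 *m M.
pose T := row_mx (- (X *m N)) Y.
exists M, (- H), K, (M *m f); split=> //.
- by rewrite linearN /= sH.
- have -> : K = M^T *m invmx K0 *m M by rewrite sM.
  by apply: sym_congr; rewrite trmx_inv sK0.
have XT : (- (X *m N))^T = - (M *m invmx K0 *m X^T) by rewrite linearN /= trmx_mul NT.
have XAY : X^T *m (S *m A) *m Y = M by rewrite /M /Y -ATS trmx_mul !mulmxA.
have YAX : Y^T *m (S *m A) *m X = M by rewrite /M -!mulmxA.
apply: (@realization_of_congruence _ _ _ _ T).
- apply: mx_inj_unit => x; rewrite -[x]vsubmxK /T mul_row_col mulNmx -mulmxA -mulmxN.
  rewrite -mul_row_col => /T0inj; rewrite -[X in _ = X]col_mx0 => /eq_col_mx[/eqP].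
  rewrite oppr_eq0 => /eqP h ->.
  have uN : N \in unitmx by rewrite /N unitmx_mul unitmx_inv uK0.
  by rewrite -[usubmx x](mulKmx uN) h mulmx0 col_mx0.
- rewrite /T tr_row_mx mul_col_mx mul_col_row XT !(mulNmx, mulmxN) /symE.
  have e1 : M *m invmx K0 *m X^T *m S *m (X *m N) = - K.
    have -> : M *m invmx K0 *m X^T *m S *m (X *m N) = M *m invmx K0 *m (X^T *m S *m X) *m N.
      by rewrite !mulmxA.
    rewrite -[X^T *m S *m X]opprK -/K0 mulmxN mulNmx mulmxKV // /N /K.
    by rewrite mulmxA.
  have e2 : M *m invmx K0 *m X^T *m S *m Y = 0.
    by rewrite -!mulmxA (mulmxA X^T) XSY !mulmx0.
  have e3 : Y^T *m S *m (X *m N) = 0 by rewrite mulmxA YSX mul0mx.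
  by rewrite e1 e2 e3 !opprK !oppr0.
- rewrite /T tr_row_mx mul_col_mx mul_col_row XT !(mulNmx, mulmxN) /symF.
  have e1 : M *m invmx K0 *m X^T *m (S *m A) *m (X *m N) = 0.
    have -> : M *m invmx K0 *m X^T *m (S *m A) *m (X *m N) = M *m invmx K0 *m (X^T *m (S *m A) *m X) *m N.
      by rewrite !mulmxA.
    by rewrite XX mulmx0 mul0mx.
  have e2 : M *m invmx K0 *m X^T *m (S *m A) *m Y = K.
    by rewrite -(mulmxA _ X^T) -(mulmxA _ (X^T *m _)) XAY.
  have e3 : Y^T *m (S *m A) *m (X *m N) = K by rewrite mulmxA YAX /N /K mulmxA.
  by rewrite e1 e2 e3 !opprK.
- rewrite /T tr_row_mx mul_col_mx mul_col_mx XT !mulNmx -Az zX.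
  have e1 : M *m invmx K0 *m X^T *m S *m (A *m (X *m f)) = 0.
    have -> : M *m invmx K0 *m X^T *m S *m (A *m (X *m f)) = M *m invmx K0 *m (X^T *m (S *m A) *m X) *m f.
      by rewrite !mulmxA.
    by rewrite XX mulmx0 mul0mx.
  by rewrite e1 oppr0; congr col_mx; rewrite /M /Y !mulmxA.
Qed.

End Existence.

(** * Observability from finitely many points *)

Section Points.
Variable R : realType.

(** Among k + size p numbers fewer than size p are roots. *)
Lemma nonroots (p : {poly R}) k : p != 0 ->
  exists pt : 'I_k -> R, injective pt /\ forall i, ~~ root p (pt i).
Proof.
move=> p0; pose s := [seq (j%:R : R) | j <- iota 0 (k + size p)].
have us : uniq s.
  rewrite map_inj_uniq ?iota_uniq // => i j /eqP; by rewrite eqr_nat => /eqP.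
pose s1 := seq.filter (root p) s; pose s2 := seq.filter (predC (root p)) s.
have h1 : (size s1 < size p)%N.
  by apply: max_poly_roots => //; [apply/allP => x; rewrite mem_filter => /andP[]|apply: filter_uniq].
have h2 : (k <= size s2)%N.
  have : (size s1 + size s2)%N = (k + size p)%N.
    by rewrite !size_filter count_predC size_map size_iota.
  by move=> e; rewrite -(leq_add2l (size p)) [leqLHS]addnC -e leq_add2r ltnW.
have lt2 (i : 'I_k) : (i < size s2)%N by apply: leq_trans h2.
exists (fun i => nth 0 s2 i); split.
  move=> i j /eqP; rewrite nth_uniq ?filter_uniq // => /eqP; exact: val_inj.
by move=> i; have := mem_nth 0 (lt2 i); rewrite mem_filter => /andP[].
Qed.

End Points.

Section Observability.
Variables (R : realType) (N m k : nat) (A T Ti : 'M[R]_N) (lam : 'rV[R]_N) (C : 'M[R]_(m, N)).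
Hypotheses (TTi : T *m Ti = 1%:M) (AT : A *m T = T *m diag_mx lam).
Hypothesis obs : forall (x : 'cV_N) l, A *m x = l *: x -> C *m x = 0 -> x = 0.
Variable pt : 'I_k -> R.
Hypotheses (pt_inj : injective pt) (Nk : (N <= k)%N).
Hypothesis pt_lam : forall i j, pt i != lam 0 j.

Let TiT : Ti *m T = 1%:M. Proof. exact: mulmx1C. Qed.

Lemma shift_diag t : (t%:M - A) *m T = T *m diag_mx (\row_j (t - lam 0 j)).
Proof.
rewrite mulmxBl AT mul_scalar_mx -mul_mx_scalar -mulmxBr; congr (_ *m _).
rewrite -diag_const_mx -linearB; congr diag_mx; by apply/rowP => j; rewrite !mxE.
Qed.

Lemma shift_unit t : (forall j, t != lam 0 j) -> t%:M - A \in unitmx.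
Proof.
move=> h; apply: mx_inj_unit => x h0; have hx : (t%:M - A) *m x = 0 := h0.
have ex : x = T *m (Ti *m x) by rewrite mulmxA TTi mul1mx.
move: hx; rewrite ex mulmxA shift_diag -mulmxA => /(congr1 (mulmx Ti)).
rewrite mulmxA TiT mul1mx mulmx0 => hd.
suff -> : Ti *m x = 0 by rewrite mulmx0.
apply/colP => j; have := congr1 (fun M : 'cV_N => M j 0) hd.
rewrite mul_diag_mx !mxE => /eqP; rewrite mulf_eq0 subr_eq0 (negbTE (h j)) /= => /eqP.
by [].
Qed.

Lemma resolvent_diag t : (forall j, t != lam 0 j) ->
  invmx (t%:M - A) *m T = T *m diag_mx (\row_j (t - lam 0 j)^-1).
Proof.
move=> h; have u := shift_unit h.
have e : diag_mx (\row_j (t - lam 0 j)) *m diag_mx (\row_j (t - lam 0 j)^-1) = 1%:M.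
  rewrite mulmx_diag -diag_const_mx; congr diag_mx; apply/rowP => j.
  by rewrite !mxE mulfV // subr_eq0.
by rewrite -[RHS](mulKmx u) [X in _ = _ *m X]mulmxA shift_diag -[T *m _ *m _]mulmxA e mulmx1.
Qed.

(** In eigenvector coordinates the resolvent sums are rational functions with
    poles at the eigenvalues.  Vanishing at N points, they vanish identically;
    the residue at each eigenvalue is the output of the projection of w onto
    the eigenspace, which is then unobservable. *)
Lemma observable_points (w : 'cV[R]_N) :
  (forall i, C *m invmx ((pt i)%:M - A) *m w = 0) -> w = 0.
Proof.
move=> hw; pose y := Ti *m w; have wy : w = T *m y by rewrite /y mulmxA TTi mul1mx.
pose c := C *m T.
have sumE i l : \sum_j c l j * ((pt i - lam 0 j)^-1 * y j 0) = 0.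
  have := congr1 (fun M : 'cV_m => M l 0) (hw i).
  rewrite wy -mulmxA (mulmxA (invmx _)) resolvent_diag // -[T *m _ *m _]mulmxA (mulmxA C) -/c.
  rewrite [X in X = _ -> _]mxE [X in _ = X -> _]mxE => e; rewrite -[RHS]e.
  by apply: eq_bigr => j _; rewrite mul_diag_mx !mxE.
pose La := undup [seq lam 0 j | j <- enum 'I_N].
have uLa : uniq La by exact: undup_uniq.
have inLa j : lam 0 j \in La by rewrite mem_undup map_f ?mem_enum.
have szLa : (size La <= N)%N.
  by rewrite (leq_trans (size_undup _)) // size_map size_enum_ord.
(* the numerators; each distinct eigenvalue occurs once in La *)
pose g l : {poly R} := \sum_j (c l j * y j 0) *: \prod_(u <- rem (lam 0 j) La) ('X - u%:P).
have szg l : (size (g l) <= N)%N.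
  apply: leq_trans (size_sum _ _ _) _; apply/bigmax_leqP => j _.
  apply: leq_trans (size_scale_leq _ _) _; rewrite size_prod_XsubC size_rem //.
  by rewrite prednK //; case: (La) (inLa j).
have g0 l : g l = 0.
  apply/eqP; apply: contraT => gn0.
  have : (size [seq pt i | i <- enum 'I_k] < size (g l))%N.
    apply: max_poly_roots => //; last by rewrite map_inj_uniq ?enum_uniq.
    apply/allP => _ /mapP[i _ ->]; rewrite /root /g horner_sum.
    have -> : \sum_j ((c l j * y j 0) *: \prod_(u <- rem (lam 0 j) La) ('X - u%:P)).[pt i] =
       (\prod_(u <- La) (pt i - u)) * \sum_j c l j * ((pt i - lam 0 j)^-1 * y j 0).
      rewrite big_distrr /=; apply: eq_bigr => j _.
      rewrite hornerZ horner_prod (perm_big _ (perm_to_rem (inLa j))) /= big_cons.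
      under eq_bigr do rewrite hornerXsubC.
      have n0 : pt i - lam 0 j != 0 by rewrite subr_eq0.
      by field.
    by rewrite sumE mulr0.
  by rewrite size_map size_enum_ord ltnNge (leq_trans (szg l)).
have key l0 : \col_j (if lam 0 j == l0 then y j 0 else 0) = 0 :> 'cV[R]_N.
  set yl := \col_j _; have Tyl : T *m yl = 0.
    apply: (obs (l := l0)).
      rewrite mulmxA AT -mulmxA scalemxAr; congr (_ *m _); apply/colP => j.
      rewrite mul_diag_mx !mxE; case: eqP => [->//|_]; by rewrite !mulr0.
    rewrite mulmxA -/c; apply/colP => l; rewrite [RHS]mxE mxE.
    have [l0La|] := boolP (l0 \in La); last first.
      move=> h; apply: big1 => j _; rewrite [yl _ _]mxE ifF ?mulr0 //; apply/negP => /eqP e.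
      by move: h; rewrite -e inLa.
    have P0 : \prod_(u <- rem l0 La) (l0 - u) != 0.
      rewrite prodf_seq_neq0; apply/allP => u; rewrite mem_rem_uniq // !inE => /andP[un _] /=.
      by rewrite subr_eq0 eq_sym.
    apply: (mulfI P0); rewrite mulr0.
    have := congr1 (horner^~ l0) (g0 l); rewrite /= horner0 /g horner_sum => e; rewrite -[RHS]e.
    rewrite mulr_sumr; apply: eq_bigr => j _; rewrite /= hornerZ horner_prod [yl _ _]mxE.
    under [in RHS]eq_bigr do rewrite hornerXsubC.
    case: eqP => [->|/eqP ne]; first by rewrite mulrC.
    rewrite !mulr0; apply/esym/eqP; rewrite mulf_eq0; apply/orP; right.
    rewrite prodf_seq_eq0; apply/hasP; exists l0; rewrite /= ?subrr //.
    by rewrite mem_rem_uniq // inE eq_sym ne.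
  by rewrite -[yl]mul1mx -TiT -mulmxA Tyl mulmx0.
have y0 : y = 0.
  by apply/colP => j; have := congr1 (fun M : 'cV_N => M j 0) (key (lam 0 j)); rewrite !mxE eqxx.
by rewrite wy y0 mulmx0.
Qed.

(** The kernel of the stacked matrices is trivial, so they have a left inverse. *)
Lemma observer_exists : exists Ol : 'I_k -> 'M[R]_(N, m),
  \sum_i Ol i *m (C *m invmx ((pt i)%:M - A)) = 1%:M.
Proof.
pose B i := C *m invmx ((pt i)%:M - A).
have /mxalgebra.sub_sums_genmxP[u hu] : (1%:M <= \sum_(i < k) <<B i>>)%MS.
  rewrite submxE mul1mx; apply/eqP/matrixP => a b.
  set Co := cokermx _; suff : col b Co = 0.
    by move/matrixP/(_ a 0); rewrite !mxE.
  apply: observable_points => i; rewrite -/(B i) colE mulmxA.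
  have -> : B i *m Co = 0; last by rewrite mul0mx.
  apply/eqP; rewrite -submxE; apply: submx_trans (sumsmx_sup i _ (submx_refl _)) => //.
  by rewrite genmxE.
by exists u; rewrite hu.
Qed.

End Observability.

(** * Equivalence of pencils with the same transfer function *)

Section Loewner.
Variable F : fieldType.

(** The divided difference of the resolvent. *)
Lemma loewner_E N m p (E A : 'M[F]_N) (B : 'M[F]_(N, m)) (C : 'M[F]_(p, N)) s t :
  s != t -> s *: E - A \in unitmx -> t *: E - A \in unitmx ->
  C *m invmx (s *: E - A) *m E *m invmx (t *: E - A) *m B =
  (s - t)^-1 *: (C *m invmx (t *: E - A) *m B - C *m invmx (s *: E - A) *m B).
Proof.
move=> st us ut; have st0 : s - t != 0 by rewrite subr_eq0.
set X := invmx (s *: E - A); set Y := invmx (t *: E - A).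
have e : (s - t) *: (X *m E *m Y) = Y - X.
  have : X *m ((s *: E - A) - (t *: E - A)) *m Y = Y - X.
    by rewrite mulmxBr mulmxBl mulVmx // mul1mx -[X *m _ *m Y]mulmxA mulmxV // mulmx1.
  by rewrite opprB addrA subrK -scalerBl -scalemxAr -scalemxAl.
have -> : C *m X *m E *m Y *m B = C *m (X *m E *m Y) *m B by rewrite !mulmxA.
rewrite -[X *m E *m Y](scalerK st0) e -scalemxAr -scalemxAl.
by rewrite mulmxBr mulmxBl.
Qed.

Lemma loewner_A N m p (E A : 'M[F]_N) (B : 'M[F]_(N, m)) (C : 'M[F]_(p, N)) s t :
  s != t -> s *: E - A \in unitmx -> t *: E - A \in unitmx ->
  C *m invmx (s *: E - A) *m A *m invmx (t *: E - A) *m B =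
  (s - t)^-1 *: (t *: (C *m invmx (t *: E - A) *m B) - s *: (C *m invmx (s *: E - A) *m B)).
Proof.
move=> st us ut; have st0 : s - t != 0 by rewrite subr_eq0.
set X := invmx (s *: E - A); set Y := invmx (t *: E - A).
have e : (s - t) *: (X *m A *m Y) = t *: Y - s *: X.
  have : X *m (t *: (s *: E - A) - s *: (t *: E - A)) *m Y = t *: Y - s *: X.
    rewrite mulmxBr mulmxBl -!scalemxAr -!scalemxAl mulVmx // mul1mx.
    by rewrite -[X *m _ *m Y]mulmxA mulmxV // mulmx1.
  rewrite !scalerBr !scalerA mulrC opprB addrC addrA subrK -scalerBl.
  by rewrite -scalemxAr -scalemxAl.
have -> : C *m X *m A *m Y *m B = C *m (X *m A *m Y) *m B by rewrite !mulmxA.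
rewrite -[X *m A *m Y](scalerK st0) e -scalemxAr -scalemxAl.
by rewrite mulmxBr mulmxBl -!scalemxAr -!scalemxAl.
Qed.

Variables (N m p k : nat) (E E' A A' : 'M[F]_N) (B B' : 'M[F]_(N, m)) (C C' : 'M[F]_(p, N)).
Variables (x y : 'I_k -> F) (Ol : 'I_k -> 'M[F]_(N, p)) (Rr : 'I_k -> 'M[F]_(m, N)).
Let P t := t *: E - A.
Let P' t := t *: E' - A'.
Hypothesis xy : forall i j, x i != y j.
Hypotheses (uPx : forall i, P (x i) \in unitmx) (uPy : forall i, P (y i) \in unitmx).
Hypotheses (uP'x : forall i, P' (x i) \in unitmx) (uP'y : forall i, P' (y i) \in unitmx).
Hypothesis Gx : forall i, C *m invmx (P (x i)) *m B = C' *m invmx (P' (x i)) *m B'.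
Hypothesis Gy : forall i, C *m invmx (P (y i)) *m B = C' *m invmx (P' (y i)) *m B'.
Hypothesis hO : \sum_i Ol i *m (C *m invmx (P (x i))) = 1%:M.
Hypothesis hR : \sum_i invmx (P (y i)) *m B *m Rr i = 1%:M.

(** The divided differences of the transfer function between the points x i and
    y j factor through E, and those of s times the transfer function through A,
    for either pencil.  The left and right inverses Ol, Rr of the outer factors
    of the first pencil, applied to the outer factors of the second one, are T1
    and T2. *)
Theorem loewner_equivalence : exists T1 T2 : 'M[F]_N,
  [/\ T1 *m E' *m T2 = E, T1 *m A' *m T2 = A, T1 *m B' = B & C' *m T2 = C].
Proof.
exists (\sum_i Ol i *m (C' *m invmx (P' (x i)))), (\sum_i invmx (P' (y i)) *m B' *m Rr i).
have expand (Z : 'M[F]_N) (O1 : 'I_k -> 'M[F]_N) (R1 : 'I_k -> 'M[F]_N) :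
    (\sum_i O1 i) *m Z *m (\sum_j R1 j) = \sum_i \sum_j O1 i *m Z *m R1 j.
  by rewrite !mulmx_suml; apply: eq_bigr => i _; rewrite mulmx_sumr.
split.
- rewrite expand -[RHS]mulmx1 -[E in RHS]mul1mx -{1}hO -hR expand.
  apply: eq_bigr => i _; apply: eq_bigr => j _.
  have := loewner_E B' C' (xy i j) (uP'x i) (uP'y j).
  rewrite -/(P' _) -/(P' _) -Gx -Gy -(loewner_E B C (xy i j) (uPx i) (uPy j)) => h.
  have e (Z : 'M[F]_N) (X1 : 'M[F]_(p, N)) (Y1 : 'M[F]_(N, m)) :
    Ol i *m X1 *m Z *m (Y1 *m Rr j) = Ol i *m (X1 *m Z *m Y1) *m Rr j by rewrite !mulmxA.
  rewrite !e; congr (_ *m _ *m _); move: h; rewrite -!mulmxA => ->.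
  by [].
- rewrite expand -[RHS]mulmx1 -[A in RHS]mul1mx -{1}hO -hR expand.
  apply: eq_bigr => i _; apply: eq_bigr => j _.
  have := loewner_A B' C' (xy i j) (uP'x i) (uP'y j).
  rewrite -/(P' _) -/(P' _) -Gx -Gy -(loewner_A B C (xy i j) (uPx i) (uPy j)) => h.
  have e (Z : 'M[F]_N) (X1 : 'M[F]_(p, N)) (Y1 : 'M[F]_(N, m)) :
    Ol i *m X1 *m Z *m (Y1 *m Rr j) = Ol i *m (X1 *m Z *m Y1) *m Rr j by rewrite !mulmxA.
  rewrite !e; congr (_ *m _ *m _); move: h; rewrite -!mulmxA => ->.
  by [].
- rewrite -[RHS]mul1mx -hO !mulmx_suml; apply: eq_bigr => i _.
  by rewrite -!mulmxA !(mulmxA C) !(mulmxA C') Gx.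
- rewrite -[RHS]mulmx1 -hR !mulmx_sumr; apply: eq_bigr => i _.
  by rewrite !mulmxA Gy.
Qed.

End Loewner.

Section Evaluation.
Variable R : realType.

Lemma adj_inverse (F : fieldType) N p q (X : 'M[F]_N) (C : 'M[F]_(p, N)) (B : 'M[F]_(N, q)) :
  X \in unitmx -> \det X *: (C *m invmx X *m B) = C *m \adj X *m B.
Proof.
move=> uX; rewrite /invmx uX -scalemxAr -scalemxAl scalerA mulfV ?scale1r //.
by rewrite -unitfE -unitmxE.
Qed.

(** Clearing denominators by adjugates turns the identity of rational functions
    into one of polynomials, which can be evaluated; q collects both
    denominators. *)
Lemma realization_eval r m N (A : 'M[R]_N) (Bt : 'M[R]_(N, m)) (Ct : 'M[R]_(m, N))
    (M D K : 'M[R]_r) (B2 : 'M[R]_(r, m)) :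
  second_order_realization (transfer A Bt Ct) M D K B2 ->
  exists2 q : {poly R}, q != 0 &
  forall t, ~~ root q t ->
    [/\ t ^+ 2 *: M + t *: D + K \in unitmx, t%:M - A \in unitmx &
    Ct *m invmx (t%:M - A) *m Bt =
    t *: (B2^T *m invmx (t ^+ 2 *: M + t *: D + K) *m B2)].
Proof.
case; set PQ := 'X^2 *: pmx M + 'X *: pmx D + pmx K => uQ hH.
pose PA := 'X%:M - pmx A.
have uA : fmx PA \in unitmx by exact: resolvent_unit.
pose q1 := \det PA; pose q2 := \det PQ.
have dQ : \det (fmx PQ) = tofrac q2 by rewrite /fmx det_map_mx.
have dA : \det (fmx PA) = tofrac q1 by rewrite /fmx det_map_mx.
have q20 : q2 != 0 by move: uQ; rewrite unitmxE unitfE dQ tofrac_eq0.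
have q10 : q1 != 0 by move: uA; rewrite unitmxE unitfE dA tofrac_eq0.
have key : q2 *: (pmx Ct *m \adj PA *m pmx Bt) = (q1 * 'X) *: (pmx B2^T *m \adj PQ *m pmx B2).
  have tofrac_inj : injective (@tofrac {poly R}).
    by move=> a b /eqP; rewrite tofrac_eq => /eqP.
  have fmx_inj (X Y : 'M[{poly R}]_m) : fmx X = fmx Y -> X = Y.
    move=> h; apply/matrixP => i j; apply: tofrac_inj.
    by have := congr1 (fun M : 'M_m => M i j) h; rewrite !mxE.
  apply: fmx_inj.
  rewrite /fmx !map_mxZ !map_mxM !map_mx_adj -!/(fmx _) rmorphM /= -dA -dQ.
  rewrite -(adj_inverse _ _ uA) -(adj_inverse _ _ uQ) -/(transfer A Bt Ct) hH.
  rewrite !scalerA; congr (_ *: _).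
  by rewrite -mulrA mulrC.
exists (q1 * q2); first by rewrite mulf_neq0.
move=> t; rewrite rootM negb_or => /andP[t1 t2].
have evM p k (X : 'M[R]_(p, k)) : map_mx (horner_eval t) (pmx X) = X.
  by apply/matrixP => i j; rewrite !mxE /horner_eval hornerC.
have evA : map_mx (horner_eval t) PA = t%:M - A.
  by rewrite map_mxB map_scalar_mx evM; congr (_%:M - _); exact: hornerX.
have evQ : map_mx (horner_eval t) PQ = t ^+ 2 *: M + t *: D + K.
  rewrite !map_mxD !map_mxZ !evM; congr (_ *: _ + _ *: _ + _).
    exact: hornerXn.
  exact: hornerX.
have e1 : \det (t%:M - A) = q1.[t] by rewrite -evA det_map_mx.
have e2 : \det (t ^+ 2 *: M + t *: D + K) = q2.[t] by rewrite -evQ det_map_mx.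
have u1 : t%:M - A \in unitmx by rewrite unitmxE unitfE e1.
have u2 : t ^+ 2 *: M + t *: D + K \in unitmx by rewrite unitmxE unitfE e2.
split=> //.
have evZ k l a (X : 'M[{poly R}]_(k, l)) :
    map_mx (horner_eval t) (a *: X) = a.[t] *: map_mx (horner_eval t) X by exact: map_mxZ.
have := congr1 (map_mx (horner_eval t)) key.
rewrite !evZ !map_mxM !map_mx_adj !evM evA evQ.
rewrite -(adj_inverse _ _ u1) -(adj_inverse _ _ u2) hornerM hornerX e1 e2.
rewrite !scalerA => h.
have n0 : q1.[t] * q2.[t] != 0 by rewrite mulf_neq0.
apply: (scalerI n0); rewrite scalerA mulrC h; congr (_ *: _).
by ring.
Qed.

End Evaluation.

(** * Definiteness of every realization *)

Section Companion.
Variables (F : fieldType) (r m : nat) (M D K : 'M[F]_r) (B : 'M[F]_(r, m)).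

(** The companion pencil t compE - compF linearizes t^2 M + t D + K. *)
Definition compE : 'M[F]_(r + r) := block_mx 1%:M 0 0 M.
Definition compF : 'M[F]_(r + r) := block_mx 0 1%:M (- K) (- D).

Lemma companion_pencilE t : t *: compE - compF = block_mx t%:M (- 1%:M) K (t *: M + D).
Proof.
rewrite /compE /compF scale_block_mx opp_block_mx add_block_mx !scaler0 !opprK.
by rewrite scalemx1 !add0r oppr0 addr0.
Qed.

(** This linearization, with state (p, t p), is available before K is known to
    be invertible. *)
Lemma companion_transfer t : t ^+ 2 *: M + t *: D + K \in unitmx ->
  t *: compE - compF \in unitmx /\
  row_mx 0 B^T *m invmx (t *: compE - compF) *m col_mx 0 B =
  t *: (B^T *m invmx (t ^+ 2 *: M + t *: D + K) *m B).
Proof.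
set Q := _ + K => uQ.
have mulP p (a b : 'M[F]_(r, p)) : (t *: compE - compF) *m col_mx a b =
    col_mx (t *: a - b) (K *m a + t *: (M *m b) + D *m b).
  rewrite companion_pencilE mul_block_col mul_scalar_mx mulNmx mul1mx.
  by rewrite mulmxDl -scalemxAl addrA.
have QE p (a : 'M[F]_(r, p)) : K *m a + t *: (M *m (t *: a)) + D *m (t *: a) = Q *m a.
  rewrite /Q !mulmxDl -!scalemxAr -!scalemxAl scalerA -expr2.
  by rewrite -addrA addrC.
have uP : t *: compE - compF \in unitmx.
  apply: mx_inj_unit => x; rewrite -[x]vsubmxK mulP -[X in _ = X]col_mx0 => /eq_col_mx[/eqP].
  rewrite subr_eq0 => /eqP <-; rewrite QE => h.
  have -> : usubmx x = 0 by rewrite -[usubmx x](mulKmx uQ) h mulmx0.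
  by rewrite scaler0 col_mx0.
split=> //.
have <- : (t *: compE - compF) *m col_mx (invmx Q *m B) (t *: (invmx Q *m B)) = col_mx 0 B.
  by rewrite mulP subrr QE mulKVmx.
by rewrite -mulmxA mulKmx // mul_row_col mul0mx add0r -scalemxAr mulmxA.
Qed.

End Companion.

Section Definite.
Variables (R : realType) (r m : nat) (A : 'M[R]_(r + r)) (Bt : 'M[R]_(r + r, m)) (g : R).
Let S := Smx R r.
Let Ct := Bt^T *m S.
Hypothesis sA : (S *m A)^T = S *m A.
Hypothesis g0 : g < 0.
Hypothesis neg : forall x, x != 0 -> bf (S *m A) x x < g * bf S x x.
Hypothesis obs : forall (x : 'cV_(r + r)) (l : R), A *m x = l *: x -> Ct *m x = 0 -> x = 0.
Hypothesis Ainj : forall x : 'cV_(r + r), A *m x = 0 -> x = 0.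
Variables (M D K : 'M[R]_r) (B2 : 'M[R]_(r, m)).
Hypotheses (sM : M^T = M) (sD : D^T = D) (sK : K^T = K).
Hypothesis hreal : second_order_realization (transfer A Bt Ct) M D K B2.

Let ATS : A^T = S *m A *m S.
Proof. by rewrite -sA trmx_mul Smx_tr -mulmxA Smx_mul mulmx1. Qed.

Lemma CtT_realization : Ct^T = S *m Bt.
Proof. by rewrite /Ct trmx_mul trmxK Smx_tr. Qed.

Lemma resolvent_tr t : t%:M - A \in unitmx ->
  (invmx (t%:M - A))^T = S *m invmx (t%:M - A) *m S.
Proof.
move=> u; rewrite trmx_inv linearB /= tr_scalar_mx ATS.
have -> : t%:M - S *m A *m S = S *m (t%:M - A) *m S.
  by rewrite mulmxBr mulmxBl mul_mx_scalar -scalemxAl Smx_mul scalemx1.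
have uS : S \in unitmx by have [h _] := mulmx1_unit (Smx_mul R r).
have e : S *m (t%:M - A) *m S *m (S *m invmx (t%:M - A) *m S) = 1%:M.
  by rewrite -!mulmxA SmxK mulKVmx // Smx_mul.
have uX : S *m (t%:M - A) *m S \in unitmx by rewrite !unitmx_mul uS u.
by rewrite -[RHS](mulKmx uX) e mulmx1.
Qed.

(** Strict equivalence T1, T2 of the companion pencil with (1, A) first shows
    that K is invertible, whence the symmetric linearization is equivalent as
    well, through T3 and T2.  Transposing this equivalence gives another one,
    and observability at the points x makes the two equal: T3 = S T2^T. *)
Lemma pencil_congruence : exists T : 'M[R]_(r + r),
  [/\ T \in unitmx, T^T *m symE M K *m T = S & T^T *m symF D K *m T = S *m A].
Proof.
have [T [lm [lp [TS TA _ _ _]]]] := hyperbolic_canonical sA neg.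
have AT := canonical_similarity TS TA; rewrite -diag_mx_row in AT.
have Ti1 : (S *m T^T *m S) *m T = 1%:M by rewrite -!mulmxA [X in S *m X]mulmxA TS Smx_mul.
have Ti2 := mulmx1C Ti1.
set lam := row_mx lm lp in AT.
have [q q0 hq] := realization_eval hreal.
pose N := (r + r)%N.
have p0 : q * \prod_j ('X - (lam 0 j)%:P) != 0.
  by rewrite mulf_neq0 // monic_neq0 // monic_prod_XsubC.
have [pt [pt_inj pt_root]] := nonroots (N + N) p0.
have ptq i : ~~ root q (pt i) by move: (pt_root i); rewrite rootM negb_or => /andP[].
have pt_lam i j : pt i != lam 0 j.
  move: (pt_root i); rewrite rootM negb_or => /andP[_]; apply: contra => /eqP ->.
  by rewrite (bigD1 j) //= rootM root_XsubC eqxx.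
pose x (i : 'I_N) := pt (lshift N i); pose y (i : 'I_N) := pt (rshift N i).
have xinj : injective x by move=> i j /pt_inj/lshift_inj.
have yinj : injective y by move=> i j /pt_inj/rshift_inj.
have xy i j : x i != y j by rewrite (inj_eq pt_inj) eq_lrshift.
have [Ol hOl] := observer_exists Ti2 AT obs xinj (leqnn N) (fun i j => pt_lam _ j).
have [Oy hOy] := observer_exists Ti2 AT obs yinj (leqnn N) (fun i j => pt_lam _ j).
pose Rr i := (Oy i)^T *m S.
have uR i : (pt i)%:M - A \in unitmx by have [] := hq _ (ptq i).
(* controllability is observability of the S-adjoint system *)
have hR : \sum_i invmx ((y i)%:M - A) *m Bt *m Rr i = 1%:M.
  have e i : invmx ((y i)%:M - A) *m Bt *m Rr i =
      S *m (Oy i *m (Ct *m invmx ((y i)%:M - A)))^T *m S.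
    rewrite trmx_mul [(Ct *m _)^T]trmx_mul resolvent_tr ?uR // CtT_realization /Rr.
    by rewrite -!mulmxA !SmxK.
  rewrite (eq_bigr _ (fun i _ => e i)) -mulmx_suml -mulmx_sumr -linear_sum /= hOy trmx1 mulmx1.
  by rewrite Smx_mul.
pose C' : 'M[R]_(m, r + r) := row_mx 0 B2^T; pose B' := col_mx (0 : 'M[R]_(r, m)) B2.
have one t : t *: 1%:M - A = t%:M - A by rewrite scalemx1.
have comp i : pt i *: compE M - compF D K \in unitmx /\
    Ct *m invmx (pt i *: 1%:M - A) *m Bt = C' *m invmx (pt i *: compE M - compF D K) *m B'.
  have [uQ _ h] := hq _ (ptq i); have [u e] := companion_transfer B2 uQ.
  by split=> //; rewrite one h e.
have [||||||||T1 [T2 [hE hF hB hC]]] := @loewner_equivalence R N m m N 1%:M (compE M) A (compF D K)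
  Bt B' Ct C' x y Ol Rr xy.
- by move=> i; rewrite one; exact: uR.
- by move=> i; rewrite one; exact: uR.
- by move=> i; have [] := comp (lshift N i).
- by move=> i; have [] := comp (rshift N i).
- by move=> i; have [] := comp (lshift N i).
- by move=> i; have [] := comp (rshift N i).
- by under eq_bigr do rewrite one.
- by under eq_bigr do rewrite one.
have uA : A \in unitmx by apply: mx_inj_unit.
have [uT1 uE2] : T1 \in unitmx /\ compE M *m T2 \in unitmx by apply: mulmx1_unit; rewrite mulmxA.
have uT2 : T2 \in unitmx by move: uE2; rewrite unitmx_mul => /andP[].
have uF : compF D K \in unitmx.
  by move: uA; rewrite -hF !unitmx_mul => /andP[/andP[]].
have uK : K \in unitmx.
  apply: mx_inj_unit => v Kv.
  have : compF D K *m col_mx v 0 = 0.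
    by rewrite /compF mul_block_col !mul0mx !mulmx0 mulNmx Kv oppr0 !addr0 col_mx0.
  move/(congr1 (mulmx (invmx (compF D K)))); rewrite mulKmx // mulmx0 -[X in _ = X]col_mx0.
  by case/eq_col_mx.
pose J : 'M[R]_(r + r) := block_mx (- K) 0 0 1%:M.
pose Ji : 'M[R]_(r + r) := block_mx (- invmx K) 0 0 1%:M.
have JiJ : Ji *m J = 1%:M.
  rewrite /Ji /J mulmx_block !mulmx0 !mul0mx !addr0 !add0r mulNmx mulmxN opprK mulVmx // mulmx1.
  by rewrite -scalar_mx_block.
have JE : J *m compE M = symE M K.
  by rewrite /J /compE /symE mulmx_block !mulmx0 !mul0mx !addr0 !add0r mul1mx mulmx1.
have JF : J *m compF D K = symF D K.
  by rewrite /J /compF /symF mulmx_block !mulmx0 !mul0mx !addr0 !add0r !mul1mx mulmx1.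
have JB : J *m B' = B' by rewrite /J /B' mul_block_col !mulmx0 !mul0mx !add0r mul1mx.
pose T3 := T1 *m Ji.
have T3E : T3 *m symE M K *m T2 = 1%:M.
  by rewrite -JE /T3 -(mulmxA T1) (mulmxA Ji) JiJ mul1mx.
have T3F : T3 *m symF D K *m T2 = A.
  by rewrite -JF /T3 -(mulmxA T1) (mulmxA Ji) JiJ mul1mx.
have T3B : T3 *m B' = Bt by rewrite -JB /T3 -mulmxA (mulmxA Ji) JiJ mul1mx.
have uT3 : T3 \in unitmx by rewrite unitmx_mul uT1; case: (mulmx1_unit JiJ).
clearbody T3.
have BC : C' = B'^T by rewrite /C' /B' tr_col_mx trmx0.
have uS : S \in unitmx by have [h _] := mulmx1_unit (Smx_mul R r).
have symEs : (symE M K)^T = symE M K.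
  by rewrite /symE tr_block_mx !trmx0 linearN /= sK sM.
have symFs : (symF D K)^T = symF D K.
  by rewrite /symF tr_block_mx trmx0 !linearN /= sK sD.
have T3S : T3 = S *m T2^T.
  have step i : Ct *m invmx ((x i)%:M - A) *m (T3 - S *m T2^T) = 0.
    set t := x i; have ut : t%:M - A \in unitmx by exact: uR.
    pose Pt := t *: symE M K - symF D K.
    have Pt1 : T3 *m Pt *m T2 = t%:M - A.
      by rewrite mulmxBr mulmxBl -scalemxAr -scalemxAl T3E T3F scalemx1.
    have uPt : Pt \in unitmx by move: ut; rewrite -Pt1 !unitmx_mul => /andP[/andP[]].
    have sPt : Pt^T = Pt by rewrite /Pt linearB linearZ /= symEs symFs.
    have e1 : invmx Pt = T2 *m invmx (t%:M - A) *m T3.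
      apply: (can_inj (mulKmx uPt)); rewrite mulmxV //.
      apply: (can_inj (mulKmx uT3)); rewrite mulmx1 !mulmxA Pt1 mulmxV //.
      by rewrite mul1mx.
    have e2 : invmx Pt = T3^T *m (invmx (t%:M - A))^T *m T2^T.
      by rewrite -[LHS]trmxK trmx_inv sPt e1 !trmx_mul mulmxA.
    have h1 : C' *m invmx Pt = Ct *m invmx (t%:M - A) *m T3 by rewrite e1 !mulmxA hC.
    have h2 : C' *m invmx Pt = Ct *m invmx (t%:M - A) *m (S *m T2^T).
      by rewrite e2 BC !mulmxA -trmx_mul T3B resolvent_tr // !mulmxA.
    by rewrite mulmxBr -h1 -h2 subrr.
  apply/eqP; rewrite -subr_eq0 -[X in X == _]mul1mx -hOl mulmx_suml big1 // => i _.
  by rewrite -mulmxA step mulmx0.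
exists T2; split=> //.
- move: T3E; rewrite T3S -!mulmxA => /(congr1 (mulmx S)); rewrite SmxK mulmx1 => <-.
  by rewrite !mulmxA.
- move: T3F; rewrite T3S -!mulmxA => /(congr1 (mulmx S)); rewrite SmxK => <-.
  by rewrite !mulmxA.
Qed.

(** On the vectors (v, 0) the definite pencil gives K > 0; the signature then
    gives M > 0; the vectors (v / g, v) give the value of the quadratic
    polynomial at g. *)
Theorem realization_definite : [/\ pdmx M, pdmx D, pdmx K &
  forall v, v != 0 -> g ^+ 2 * bf M v v + g * bf D v v + bf K v v < 0].
Proof.
have [T [uT hE hF]] := pencil_congruence.
pose Y := invmx T.
have YE : Y^T *m S *m Y = symE M K.
  rewrite -hE -mulmxA -(mulmxA _ T) mulmxV // mulmx1 mulmxA -trmx_mul mulmxV //.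
  by rewrite trmx1 mul1mx.
have YF : Y^T *m (S *m A) *m Y = symF D K.
  rewrite -hF -mulmxA -(mulmxA _ T) mulmxV // mulmx1 mulmxA -trmx_mul mulmxV //.
  by rewrite trmx1 mul1mx.
have Yinj (x : 'cV_(r + r)) : Y *m x = 0 -> x = 0.
  by move=> h; rewrite -[x](mulKVmx uT) -/Y h mulmx0.
have dneg x : x != 0 -> bf (symF D K) x x < g * bf (symE M K) x x.
  move=> x0; rewrite -YE -YF !bf_congr; apply: neg.
  by apply: contra x0 => /eqP/Yinj ->.
have Kpos v : v != 0 -> 0 < bf K v v.
  move=> v0; have : col_mx v (0 : 'cV[R]_r) != 0.
    by apply: contra v0; rewrite -[X in _ == X]col_mx0 => /eqP/eq_col_mx[->].
  move/dneg; rewrite /symE /symF !bf_block !(bf0l, bf0r) !bf0 bfN !addr0 mulrN.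
  by rewrite oppr_gt0 nmulr_rlt0.
have Mpos := complement_pos Yinj YE Kpos.
have quad v : v != 0 -> g ^+ 2 * bf M v v + g * bf D v v + bf K v v < 0.
  move=> v0; have : col_mx (g^-1 *: v) v != 0.
    by apply: contra v0; rewrite -[X in _ == X]col_mx0 => /eqP/eq_col_mx[_ ->].
  move/dneg; rewrite /symE /symF !bf_block !bf0 !bfE => h.
  have gn : g != 0 by rewrite lt_eqF.
  move: h; rewrite -subr_lt0 -(nmulr_rgt0 _ g0).
  set mm := bf M v v; set d := bf D v v; set k := bf K v v.
  have -> : g * (0 + g^-1 * - k + g^-1 * - k + - d - g * (g^-1 * (g^-1 * - k) + 0 + 0 + mm)) =
    - (g ^+ 2 * mm + g * d + k) by field.
  by rewrite oppr_gt0.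
split=> //; split=> // v v0; rewrite -/(bf _ _ _).
rewrite ltNge; apply/negP => d0; have := quad v v0; have := Kpos v v0.
have := mulr_ge0 (sqr_ge0 g) (ltW (Mpos v v0)); have := mulr_le0 (ltW g0) d0.
lra.
Qed.

End Definite.

(** * Complex quadratic forms and the conclusion *)

Section ComplexForms.
Local Open Scope complex_scope.
Local Open Scope sesquilinear_scope.
Variable R : realType.

Let re n (v : 'cV[R[i]]_n) : 'cV[R]_n := map_mx (@complex.Re R) v.
Let im n (v : 'cV[R[i]]_n) : 'cV[R]_n := map_mx (@complex.Im R) v.

Lemma cqformE n (X : 'M[R]_n) (v : 'cV[R[i]]_n) : X^T = X ->
  cqform X v = (bf X (re v) (re v) + bf X (im v) (im v))%:C.
Proof.
move=> sX; rewrite /cqform.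
have vE : v = cmx (re v) + 'i *: cmx (im v).
  apply/matrixP => i j; rewrite !mxE; case: (v i j) => a b /=.
  by simpc.
have vT : v ^t* = cmx (re v)^T - 'i *: cmx (im v)^T.
  apply/matrixP => i j; rewrite !mxE; case: (v j i) => a b /=.
  by simpc.
have scal (a b : 'cV[R]_n) : (cmx a^T *m cmx X *m cmx b) 0 0 = (bf X a b)%:C.
  by rewrite /cmx -!map_mxM mxE.
rewrite vT; move: vE; move: (re v) (im v) => a b ->.
rewrite !mulmxBl !mulmxDr -!scalemxAl -!scalemxAr.
have e : (cmx a^T *m cmx X *m cmx a + 'i *: (cmx a^T *m cmx X *m cmx b)
  - ('i *: (cmx b^T *m cmx X *m cmx a) + 'i *: ('i *: (cmx b^T *m cmx X *m cmx b)))) 0 0 =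
  (bf X a a)%:C + 'i * (bf X a b)%:C - ('i * (bf X b a)%:C + 'i * ('i * (bf X b b)%:C)).
  by rewrite -!scal !mxE.
by rewrite e (bf_sym a b sX); simpc.
Qed.

Lemma re_im_neq0 n (v : 'cV[R[i]]_n) : v != 0 -> re v != 0 \/ im v != 0.
Proof.
move=> v0; have [/eqP e1|] := boolP (re v == 0); last by left.
right; apply: contra v0 => /eqP e2; apply/eqP/matrixP => i j.
have := congr1 (fun M : 'cV_n => M i j) e1; have := congr1 (fun M : 'cV_n => M i j) e2.
by rewrite !mxE; case: (v i j) => a b /= -> ->.
Qed.

Lemma overdamped_real n (D K : 'M[R]_n) : D^T = D -> K^T = K -> overdamped 1%:M D K ->
  forall v, v != 0 -> 4 * bf 1%:M v v * bf K v v < bf D v v ^+ 2.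
Proof.
move=> sD sK od v v0; have v0' : cmx v != 0.
  apply: contra v0 => /eqP h; apply/eqP/matrixP => i j.
  by have := congr1 (fun M : 'cV_n => M i j) h; rewrite !mxE => -[].
have := od _ v0'; rewrite !cqformE ?trmx1 //.
have -> : re (cmx v) = v by apply/matrixP => i j; rewrite !mxE.
have -> : im (cmx v) = 0 by apply/matrixP => i j; rewrite !mxE.
rewrite !bf0l !addr0.
have -> : (4%:R : R[i]) = (4%:R)%:C by rewrite rmorph_nat.
by rewrite -!rmorphM -rmorphXn ltcR.
Qed.

(** A quadratic polynomial with positive leading coefficient and a negative value
    has positive discriminant. *)
Lemma overdamped_of_gap n (M D K : 'M[R]_n) g : pdmx M -> D^T = D -> K^T = K ->
  (forall v, v != 0 -> g ^+ 2 * bf M v v + g * bf D v v + bf K v v < 0) ->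
  overdamped M D K.
Proof.
move=> pM sD sK hg v v0; rewrite !cqformE //; last by case: pM.
have -> : (4%:R : R[i]) = (4%:R)%:C by rewrite rmorph_nat.
rewrite -!rmorphM -rmorphXn ltcR.
set m := _ + _; set k := _ + _; set d := _ + _.
have hle u : g ^+ 2 * bf M u u + g * bf D u u + bf K u u <= 0.
  by have [->|/hg/ltW//] := eqVneq u 0; rewrite !bf0l; lra.
have mle u : 0 <= bf M u u by exact: pdmx_ge0.
have [m0 q0] : 0 < m /\ g ^+ 2 * m + g * d + k < 0.
  have h1 := hle (re v); have h2 := hle (im v); have m1 := mle (re v); have m2 := mle (im v).
  case: (re_im_neq0 v0) => u0; have h3 := hg _ u0; have h4 : 0 < bf M _ _ := pM.2 _ u0.
    by rewrite /m /d /k; split; lra.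
  by rewrite /m /d /k; split; lra.
have h5 : m * (g ^+ 2 * m + g * d + k) < 0 by rewrite pmulr_rlt0.
have := sqr_ge0 (2 * g * m + d); lra.
Qed.

End ComplexForms.

Lemma gap_exists (R : realType) n (G D : 'M[R]_n) : pdmx D -> overdamped 1%:M D (G *m G^T) ->
  exists2 g, g < 0 & forall x, x != 0 ->
    bf (Smx R n *m Asys G D) x x < g * bf (Smx R n) x x.
Proof.
move=> pD od; have sD : D^T = D by case: pD.
have sK : (G *m G^T)^T = G *m G^T by rewrite trmx_mul trmxK.
have pK : psdmx (G *m G^T).
  split=> // x; rewrite -/(bf _ _ _).
  have -> : bf (G *m G^T) x x = bf 1%:M (G^T *m x) (G^T *m x).
    by rewrite bf_mull bf_mulr trmxK mulmx1.
  exact: bf1_ge0.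
have [g g0 hg] := hyperbolic_gap pD pK (overdamped_real sD sK od).
by exists g => //; apply: SA_neg.
Qed.

Theorem theorem7p7 (R : realType) (n m : nat)
    (G D : 'M[R]_n) (B : 'M[R]_(n, m))
    (Pmin L U : 'M[R]_(n + n))
    (hm hp : nat) (sm sp : nat -> R) (km kp : nat -> nat)
    (qm qp r : nat) :
  let A := Asys G D in
  let Bc := Bsys B in
  let C := Bc^T in
  G \in unitmx -> D^T = D -> \rank B = m ->
  stabilizable A Bc ->
  pdmx D ->
  overdamped 1%:M D (G *m G^T) ->
  KYP_minimal_solution A Bc C Pmin ->
  Pmin = L^T *m L ->
  U^T *m U = 1%:M ->
  graded n sm km hm -> graded n sp kp hp ->
  L *m Smx R n *m L^T =
    U *m Smx R n *m diag_mx (sigma_row n sm sp km kp hm hp) *m U^T ->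
  admissible sm sp hm hp qm qp ->
  (\sum_(1 <= j < qm.+1) km j = r)%N ->
  (\sum_(1 <= j < qp.+1) kp j = r)%N ->
  let d1 := sigma_row r sm sp km kp qm qp in
  let W := projW L U d1 in
  let V := projV L U d1 in
  let At := W^T *m A *m V in
  let Bt := W^T *m Bc in
  let Ct := C *m V in
  (forall z : R[i], eigenvalue (cmx A) z -> semisimple_eigenvalue A z) ->
  (forall z : R[i], eigenvalue (cmx At) z -> semisimple_eigenvalue At z) ->
  (forall z : R[i], system_zero A Bc C z -> semisimple_zero A Bc C z) ->
  (forall z : R[i], system_zero At Bt Ct z -> semisimple_zero At Bt Ct z) ->
  [/\ forall z : R[i], eigenvalue (cmx At) z -> z \is Num.real,
      exists lm lp : r.-tuple R,
        [/\ typed_eigenvalues (Smx R r) At lm lp,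
            sorted <=%R lp, sorted <=%R lm
          & forall i j : 'I_r, tnth lp i < tnth lm j],
      forall (Mt Dt Kt : 'M[R]_r) (B2 : 'M[R]_(r, m)),
        Mt^T = Mt -> Dt^T = Dt -> Kt^T = Kt ->
        second_order_realization (transfer At Bt Ct) Mt Dt Kt B2 ->
        [/\ pdmx Mt, pdmx Dt, pdmx Kt & overdamped Mt Dt Kt]
    & exists (Mt Dt Kt : 'M[R]_r) (B2 : 'M[R]_(r, m)),
        [/\ Mt^T = Mt, Dt^T = Dt, Kt^T = Kt
          & second_order_realization (transfer At Bt Ct) Mt Dt Kt B2]].
Proof.
move=> A Bc C uG sD rB _ pD od minP PL UU gm gp eig adm rm rp d1 W V At Bt Ct _ _ _ _.
have rn : (r <= n)%N.
  have qh : (qm <= hm)%N by case: adm => [[/andP[]]].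
  have [<- _ _ _] := gm; rewrite -rm.
  by rewrite [leqRHS](@big_cat_nat _ _ _ qm.+1) //= leq_addr.
have [g g0 neg] := gap_exists pD od.
have keep := @proj_keep _ _ _ rn _ _ _ _ _ _ _ _ gm gp adm rm rp _ _ _ PL UU eig.
have WE : W^T = Smx R r *m V^T *m Smx R n by exact: proj_WE.
have VSV : V^T *m Smx R n *m V = Smx R r := proj_VSV rn gm gp adm rm rp UU eig.
have PV : Pmin *m V = Smx R n *m V *m Smx R r *m diag_mx d1 := proj_PV rn gp adm rm rp PL UU eig.
have bnd i := sigma_kept_bnd gm gp adm rm rp i.
have d0 i : 0 < d1 0 i by case/andP: (bnd i).
have d1le i : d1 0 i <= 1 by case/andP: (bnd i).
have keep1 (w : 'cV_(n + n)) : Smx R n *m (Pmin *m w) = w -> V *m (W^T *m w) = w.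
  move=> h; apply: (keep 1 w); rewrite ?oner_eq0 ?scale1r //.
  by move=> k /(dropped_ne1 gm gp adm rm rp)[].
have keepN1 (w : 'cV_(n + n)) : Smx R n *m (Pmin *m w) = - w -> V *m (W^T *m w) = w.
  move=> h; apply: (keep (-1) w); rewrite ?oppr_eq0 ?oner_eq0 ?scaleN1r //.
  by move=> k /(dropped_ne1 gm gp adm rm rp)[].
have keepopp i (w : 'cV_(n + n)) :
    Smx R n *m (Pmin *m w) = (- ((row_mx (const_mx (-1)) (const_mx 1) : 'rV_(r + r)) 0 i * d1 0 i)) *: w ->
    V *m (W^T *m w) = w.
  apply: keep; last by move=> k hk; apply: (dropped_ne_opp gm gp adm rm rp).
  rewrite oppr_eq0; apply: mulf_neq0; last by rewrite gt_eqF.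
  rewrite -(splitK i); case: (split i) => j /=.
    by rewrite row_mxEl mxE oppr_eq0 oner_eq0.
  by rewrite row_mxEr mxE oner_eq0.
have sSA := red_SA_sym WE pD (erefl At).
have negt (x : 'cV_(r + r)) : x != 0 -> bf (Smx R r *m At) x x < g * bf (Smx R r) x x.
  move=> x0; rewrite (red_SA WE (erefl At)) -VSV !bf_congr; apply: neg.
  apply: contra x0 => /eqP h; apply/eqP.
  exact: (V_inj WE VSV h).
pose Tht := V^T *m - (A^T *m Pmin + Pmin *m A) *m V.
have stable := red_stable WE uG pD minP VSV PV d0 keepopp (erefl At) (erefl Tht).
have obs := red_observable WE uG pD rB minP VSV PV d0 d1le keep1 keepopp
  (erefl At) (erefl Bt) (erefl Ct) (erefl Tht).
have [z Az Cz] := red_static uG pD minP keepN1 (erefl At) (erefl Bt) (erefl Ct).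
have CtE : Ct = Bt^T *m Smx R r := red_CtE WE (erefl Bt) (erefl Ct).
have [T [lm [lp [TS TA lmg lpg [slm slp]]]]] := hyperbolic_canonical sSA negt.
have [real typed] := hyperbolic_typed negt TS TA lmg lpg slm slp.
rewrite CtE in obs Cz *; split=> //.
- move=> Mt Dt Kt B2 sM sD' sK hreal.
  have Ainj (x : 'cV_(r + r)) : At *m x = 0 -> x = 0.
    by move=> h; apply: (@stable _ 0) => //; rewrite h scale0r.
  have [pM pDt pK quad] := realization_definite sSA g0 negt obs Ainj sM sD' sK hreal.
  by split=> //; apply: overdamped_of_gap quad.
- exact: second_order_exists sSA g0 negt stable Az Cz.
Qed.
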